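(* Let $M$ be a smooth manifold and let $\varpi\in \Omega^{1,1}_{\Delta_M}(M\mid M)$ be a contrast bi-form such that $(M,g^\varpi,\nabla^\varpi)$ is a statistical manifold. Then there exists $D\in\Omega^{0,0}_{\Delta_M}(M\mid M)$ such that $D$ vanishes to first order along $\Delta_M$ and $\varpi$ is statistically equivalent to $\mathrm d^L\mathrm d^R D$.
   Context: $M$ is a finite-dimensional, paracompact, connected smooth manifold; $\pi_L,\pi_R\colon M\times M\to M$ are the projections $\pi_L(m,n)=m$, $\pi_R(m,n)=n$; $\iota\colon M\to M\times M$, $\iota(m)=(m,m)$, is the diagonal embedding with image $\Delta_M$. For $X\in\mathfrak X(M)$, the lifts are $X^L=(X,0)$ and $X^R=(0,X)$ in $\mathfrak X(M\times M)$. A $(p,q)$-bi-form is a smooth section of the vector bundle $\bigwedge^p\pi_L^*T^*M\otimes\bigwedge^q\pi_R^*T^*M\to M\times M$. $\Omega^{p,q}_{\Delta_M}(M\mid M)$ denotes the local $(p,q)$-bi-forms, i.e. those defined on some open neighbourhood of $\Delta_M$ in $M\times M$; so $\Omega^{0,0}_{\Delta_M}(M\mid M)$ consists of smooth real functions on neighbourhoods of the diagonal. For vector fields on $M$, $\varpi(X_1,\dots,X_p\mid Y_1,\dots,Y_q)$ is the function $(m,n)\mapsto\varpi_{(m,n)}((X_1)_m,\dots\mid (Y_1)_n,\dots)$. The diagonal restriction is $\varpi_{\restriction\Delta_M}(Z_1,\dots,Z_{p+q})=\iota^*\big(\varpi(Z_1,\dots,Z_p\mid Z_{p+1},\dots,Z_{p+q})\big)$.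 For $D\in\Omega^{0,0}_{\Delta_M}(M\mid M)$: $(\mathrm d^RD)(\mid Y)=\mathcal L_{Y^R}D$ and $(\mathrm d^L\mathrm d^RD)(X\mid Y)=\mathcal L_{X^L}\mathcal L_{Y^R}D$. The left Lie derivative of a $(1,1)$-bi-form is $(\mathcal L_{Z\mid}\varpi)(X\mid Y)=\mathcal L_{Z^L}(\varpi(X\mid Y))-\varpi([Z,X]\mid Y)$. $D$ vanishes to first order along $\Delta_M$ if $D$ and $\mathcal L_{\mathbb Z}D$ vanish at every point of $\Delta_M$, for every vector field $\mathbb Z$ on $M\times M$. A local bi-form $\varpi\in\Omega^{1,1}_{\Delta_M}(M\mid M)$ is a contrast bi-form if $g^\varpi:=\varpi_{\restriction\Delta_M}$ is a pseudo-Riemannian metric on $M$. It then induces an affine connection $\nabla^\varpi$ on $M$ by $g^\varpi(\nabla^\varpi_ZX,Y)=(\mathcal L_{Z\mid}\varpi)_{\restriction\Delta_M}(X,Y)+g^\varpi([Z,X],Y)$. For a pseudo-Riemannian metric $g$ and affine connection $\nabla$, the $g$-conjugate connection $\nabla^\dag$ is defined by $\mathcal L_Z(g(X,Y))=g(\nabla_ZX,Y)+g(X,\nabla^\dag_ZY)$; $(M,g,\nabla)$ is a statistical manifold if both $\nabla$ and $\nabla^\dag$ are torsion-free. Two contrast bi-forms are statistically equivalent if they induce the same metric and the same connection (in particular, statistical equivalence to $\mathrm d^L\mathrm d^RD$ includes that $\mathrm d^L\mathrm d^RD$ is a contrast bi-form). *)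

(* Defs.v *)
From HB Require Import structures.
From mathcomp Require Import all_boot all_order all_algebra.
From mathcomp Require Import all_classical all_reals all_analysis.

Set Implicit Arguments.
Unset Strict Implicit.
Unset Printing Implicit Defensive.

Import Order.TTheory GRing.Theory Num.Theory.
Import numFieldNormedType.Exports.

Local Open Scope classical_set_scope.
Local Open Scope ring_scope.

(* Smooth maps between normed spaces.  For a finite-dimensional [V] and an    *)
(* open [S], [smooth_on S f] says that all iterated partial derivatives of    *)
(* [f] exist and are continuous on [S]; the values of [f] outside [S] are     *)
(* irrelevant.                                                                *)

Definition iter_derive (R : realType) (V W : normedModType R) (vs : seq V)
    (f : V -> W) : V -> W :=
  foldr (fun (v : V) (g : V -> W) (x : V) => 'D_v g x) f vs.

Definition smooth_on (R : realType) (V W : normedModType R) (S : set V)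
    (f : V -> W) : Prop :=
  forall (vs : seq V) (x : V), S x ->
    {for x, continuous (iter_derive vs f)} /\
    (forall v : V, derivable (iter_derive vs f) x v).

(* A chart is stored as total functions [cmap], [cinv] of which only the      *)
(* restrictions to [cdom] and to its image matter.  An atlas also selects a   *)
(* preferred chart [chart_at] at each point; it serves to represent tangent   *)
(* spaces, see [dird].                                                        *)

Record chart (M V : Type) := Chart {
  cdom : set M;
  cmap :> M -> V;
  cinv : V -> M }.

Record atlas (M V : Type) := Atlas {
  charts : set (chart M V);
  chart_at : M -> chart M V }.

Definition is_chart (R : realType) (M : topologicalType) (V : normedModType R)
    (c : chart M V) : Prop :=
  [/\ open (cdom c),
      open (c @` cdom c),
      forall m, cdom c m -> cinv c (c m) = m,
      forall m, cdom c m -> {for m, continuous c} &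
      forall x, (c @` cdom c) x -> {for x, continuous (cinv c)}].

Definition smooth_atlas (R : realType) (M : topologicalType)
    (V : normedModType R) (A : atlas M V) : Prop :=
  [/\ forall c, charts A c -> is_chart c,
      forall m, charts A (chart_at A m) /\ cdom (chart_at A m) m &
      forall c d, charts A c -> charts A d ->
        smooth_on (c @` (cdom c `&` cdom d)) (d \o cinv c)].

Definition paracompact (T : topologicalType) : Prop :=
  forall C : set (set T),
    (forall U, C U -> open U) -> \bigcup_(U in C) U = setT ->
  exists B : set (set T),
    [/\ forall U, B U -> open U,
        \bigcup_(U in B) U = setT,
        forall U, B U -> exists2 U', C U' & U `<=` U' &
        forall x : T, exists2 N, nbhs x N &
          finite_set [set U | B U /\ U `&` N !=set0]].

Definition smooth_manifold (R : realType) (n : nat) (M : topologicalType)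
    (A : atlas M 'rV[R]_n) : Prop :=
  [/\ smooth_atlas A, hausdorff_space M, paracompact M &
      connected [set: M]].

Definition prod_chart (M N V W : Type) (c : chart M V) (d : chart N W) :
    chart (M * N) (V * W) :=
  Chart (cdom c `*` cdom d) (fun p => (c p.1, d p.2))
        (fun x => (cinv c x.1, cinv d x.2)).

Definition prod_atlas (M N V W : Type) (A : atlas M V) (B : atlas N W) :
    atlas (M * N) (V * W) :=
  Atlas [set e | exists c d,
           [/\ charts A c, charts B d & e = prod_chart c d]]
        (fun p => prod_chart (chart_at A p.1) (chart_at B p.2)).

(* [msmooth A S f]: the map [f] is smooth on the open subset [S] of [M]. *)
Definition msmooth (R : realType) (M : topologicalType)
    (V W : normedModType R) (A : atlas M V) (S : set M) (f : M -> W) : Prop :=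
  forall c, charts A c -> smooth_on (c @` (cdom c `&` S)) (f \o cinv c).

(* The tangent space at [m] is the model space [V]: a tangent vector at [m]   *)
(* is given by its coordinates in the preferred chart at [m].  Hence the      *)
(* tangent space of a product at [(m, n)] is the product of the tangent       *)
(* spaces.  [dird A f m v] is the derivative of [f] at [m] along the tangent  *)
(* vector [v].                                                                *)
Definition dird (R : realType) (M : topologicalType) (V W : normedModType R)
    (A : atlas M V) (f : M -> W) (m : M) (v : V) : W :=
  'D_v (f \o cinv (chart_at A m)) (chart_at A m m).

Definition lie (R : realType) (M : topologicalType) (V W : normedModType R)
    (A : atlas M V) (X : M -> V) (f : M -> W) : M -> W :=
  fun m => dird A f m (X m).

(* [lie A X c] is the vector of components of [X] in the chart [c]. *)
Definition vector_field (R : realType) (M : topologicalType)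
    (V : normedModType R) (A : atlas M V) (X : M -> V) : Prop :=
  forall c, charts A c -> msmooth A (cdom c) (lie A X c).

(* Since [lie A Z c m] is the vector [Z m] itself for the preferred chart     *)
(* [c] at [m], this is [[X, Y] c = X (Y c) - Y (X c)].                        *)
Definition lie_bracket (R : realType) (M : topologicalType)
    (V : normedModType R) (A : atlas M V) (X Y : M -> V) : M -> V :=
  fun m => let c := chart_at A m in
    lie A X (lie A Y c) m - lie A Y (lie A X c) m.

(* [frame A c v] is the coordinate vector field on [cdom c] that has constant *)
(* components [v] in the chart [c].                                           *)
Definition frame (R : realType) (M : topologicalType) (V : normedModType R)
    (A : atlas M V) (c : chart M V) (v : V) : M -> V :=
  fun m => 'D_v (chart_at A m \o cinv c) (c m).

Definition bilinear_form (R : realType) (V W : normedModType R)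
    (b : V -> W -> R) : Prop :=
  (forall a u u' v, b (a *: u + u') v = a * b u v + b u' v) /\
  (forall a u v v', b u (a *: v + v') = a * b u v + b u v').

Definition pseudo_riemannian (R : realType) (M : topologicalType)
    (V : normedModType R) (A : atlas M V) (g : M -> V -> V -> R) : Prop :=
  [/\ forall m, bilinear_form (g m),
      forall c v w, charts A c ->
        msmooth A (cdom c) (fun m => g m (frame A c v m) (frame A c w m)),
      forall m u v, g m u v = g m v u &
      forall m u, (forall v, g m u v = 0) -> u = 0].

(* [nabla Z X] is the covariant derivative of [X] along [Z]; only its values  *)
(* on smooth vector fields matter.                                            *)
Definition affine_connection (R : realType) (M : topologicalType)
    (V : normedModType R) (A : atlas M V)
    (nabla : (M -> V) -> (M -> V) -> (M -> V)) : Prop :=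
  [/\ forall Z X, vector_field A Z -> vector_field A X ->
        vector_field A (nabla Z X),
      forall (f : M -> R) Z Z' X, msmooth A setT f ->
        vector_field A Z -> vector_field A Z' -> vector_field A X ->
        forall m, nabla (fun p => f p *: Z p + Z' p) X m =
                  f m *: nabla Z X m + nabla Z' X m,
      forall Z X X', vector_field A Z -> vector_field A X ->
        vector_field A X' ->
        forall m, nabla Z (fun p => X p + X' p) m =
                  nabla Z X m + nabla Z X' m &
      forall (f : M -> R) Z X, msmooth A setT f ->
        vector_field A Z -> vector_field A X ->
        forall m, nabla Z (fun p => f p *: X p) m =
                  lie A Z f m *: X m + f m *: nabla Z X m].

Definition torsion_free (R : realType) (M : topologicalType)
    (V : normedModType R) (A : atlas M V)
    (nabla : (M -> V) -> (M -> V) -> (M -> V)) : Prop :=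
  forall X Y, vector_field A X -> vector_field A Y ->
    forall m, nabla X Y m - nabla Y X m = lie_bracket A X Y m.

Definition conjugate_connection (R : realType) (M : topologicalType)
    (V : normedModType R) (A : atlas M V) (g : M -> V -> V -> R)
    (nabla nabla' : (M -> V) -> (M -> V) -> (M -> V)) : Prop :=
  affine_connection A nabla' /\
  forall X Y Z, vector_field A X -> vector_field A Y -> vector_field A Z ->
    forall m, lie A Z (fun p => g p (X p) (Y p)) m =
              g m (nabla Z X m) (Y m) + g m (X m) (nabla' Z Y m).

Definition statistical_manifold (R : realType) (M : topologicalType)
    (V : normedModType R) (A : atlas M V) (g : M -> V -> V -> R)
    (nabla : (M -> V) -> (M -> V) -> (M -> V)) : Prop :=
  [/\ pseudo_riemannian A g,
      affine_connection A nabla,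
      torsion_free A nabla &
      exists nabla', conjugate_connection A g nabla nabla' /\
                     torsion_free A nabla'].

(* Geometry of [M * M].  Local objects are represented by total functions     *)
(* that are only constrained on an open neighbourhood of the diagonal.        *)

Definition liftL (R : realType) (M : Type) (V : normedModType R)
    (X : M -> V) : M * M -> V * V := fun p => (X p.1, 0).

Definition liftR (R : realType) (M : Type) (V : normedModType R)
    (Y : M -> V) : M * M -> V * V := fun p => (0, Y p.2).

Definition diag_nbhd (M : topologicalType) (U : set (M * M)) : Prop :=
  open U /\ forall m, U (m, m).

Definition local_function (R : realType) (M : topologicalType)
    (V : normedModType R) (A : atlas M V) (D : M * M -> R) : Prop :=
  exists2 U, diag_nbhd U & msmooth (prod_atlas A A) U D.

(* A (1,1)-bi-form at [(m, n)] is an element of                               *)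
(* [T*_m M \otimes T*_n M], i.e. a bilinear form on [T_m M * T_n M].          *)
Definition local_biform11 (R : realType) (M : topologicalType)
    (V : normedModType R) (A : atlas M V) (w : M * M -> V -> V -> R) : Prop :=
  exists2 U, diag_nbhd U &
    (forall p, U p -> bilinear_form (w p)) /\
    (forall c d x y, charts A c -> charts A d ->
       msmooth (prod_atlas A A) (U `&` (cdom c `*` cdom d))
         (fun p => w p (frame A c x p.1) (frame A d y p.2))).

Definition biform_app (R : realType) (M V : Type) (w : M * M -> V -> V -> R)
    (X Y : M -> V) : M * M -> R := fun p => w p (X p.1) (Y p.2).

Definition diag_restr (R : realType) (M V : Type) (w : M * M -> V -> V -> R) :
    M -> V -> V -> R := fun m => w (m, m).

Definition left_lie (R : realType) (M : topologicalType)
    (V : normedModType R) (A : atlas M V) (Z : M -> V)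
    (w : M * M -> V -> V -> R) (X Y : M -> V) : M * M -> R :=
  fun p => lie (prod_atlas A A) (liftL Z) (biform_app w X Y) p -
           biform_app w (lie_bracket A Z X) Y p.

Definition contrast_biform (R : realType) (M : topologicalType)
    (V : normedModType R) (A : atlas M V) (w : M * M -> V -> V -> R) : Prop :=
  local_biform11 A w /\ pseudo_riemannian A (diag_restr w).

(* As the metric [diag_restr w] is nondegenerate, this determines [nabla] on  *)
(* smooth vector fields.                                                      *)
Definition induced_connection (R : realType) (M : topologicalType)
    (V : normedModType R) (A : atlas M V) (w : M * M -> V -> V -> R)
    (nabla : (M -> V) -> (M -> V) -> (M -> V)) : Prop :=
  affine_connection A nabla /\
  forall X Y Z, vector_field A X -> vector_field A Y -> vector_field A Z ->
    forall m, diag_restr w m (nabla Z X m) (Y m) =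
              left_lie A Z w X Y (m, m) +
              diag_restr w m (lie_bracket A Z X m) (Y m).

Definition statistically_equivalent (R : realType) (M : topologicalType)
    (V : normedModType R) (A : atlas M V)
    (w w' : M * M -> V -> V -> R) : Prop :=
  [/\ contrast_biform A w,
      contrast_biform A w',
      forall m u v, diag_restr w m u v = diag_restr w' m u v &
      exists nabla, induced_connection A w nabla /\
                    induced_connection A w' nabla].

Definition vanishes_to_first_order (R : realType) (M : topologicalType)
    (V : normedModType R) (A : atlas M V) (D : M * M -> R) : Prop :=
  forall m, D (m, m) = 0 /\
    forall Z : M * M -> V * V, vector_field (prod_atlas A A) Z ->
      lie (prod_atlas A A) Z D (m, m) = 0.

(* The (0,1)-bi-form d^R D. *)
Definition dR (R : realType) (M : topologicalType) (V : normedModType R)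
    (A : atlas M V) (D : M * M -> R) : M * M -> V -> R :=
  fun p y => dird (prod_atlas A A) D p (0, y).

(* The differential of a (0,1)-bi-form in its left variable: the right point  *)
(* [p.2] is fixed, so that the tangent vector [y] at [p.2] stays fixed too.   *)
Definition dL (R : realType) (M : topologicalType) (V : normedModType R)
    (A : atlas M V) (e : M * M -> V -> R) : M * M -> V -> V -> R :=
  fun p x y => dird A (fun m => e (m, p.2) y) p.1 x.

Lemma dRE (R : realType) (M : topologicalType) (V : normedModType R)
    (A : atlas M V) (D : M * M -> R) (Y : M -> V) (p : M * M) :
  dR A D p (Y p.2) = lie (prod_atlas A A) (liftR Y) D p.
Proof. by []. Qed.

Lemma dLdRE (R : realType) (M : topologicalType) (V : normedModType R)
    (A : atlas M V) (D : M * M -> R) (X Y : M -> V) (p : M * M) :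
  smooth_atlas A ->
  biform_app (dL A (dR A D)) X Y p =
  lie (prod_atlas A A) (liftL X) (lie (prod_atlas A A) (liftR Y) D) p.
Proof.
move=> [hc hat _]; case: p => m n; rewrite /biform_app /dL {1}/lie /dird /=.
rewrite /derive; set F := (X in lim (X @ _)); set G := (X in _ = lim (X @ _)).
have [cn dn] := hat n; have [_ _ K _ _] := hc _ cn.
suff -> : F = G by [].
by apply/funext => h; rewrite /F /G /= scaler0 add0r K.
Qed.

(* Main.v *)
(** In a chart write [omega_ij(x,y)] for the components of [varpi], [g_ij(x)] for
    [omega_ij(x,x)] and [h = y - x].  Then

      [D(x,y) = - (1/6) sum_ij (omega_ij(y,x) + 2 omega_ij(x,y)) h_i h_j]

    vanishes to first order on the diagonal, has mixed second derivatives
    [g_ij], and its derivative along [(u,0)], [(v,0)], [(0,w)] is the derivative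
    of [omega(v,w)] along [(u,0)].  The last point uses the symmetries of the
    first derivatives of [omega] on the diagonal: torsion-freeness of the
    induced connection exchanges [u] and [v] in the derivative of [omega(v,w)]
    along [(u,0)], torsion-freeness of the conjugate connection exchanges [u]
    and [w] in the derivative along [(0,u)], and the sum of the two derivatives
    is symmetric in [v], [w] because [g] is.

    These conditions on [D] are conditions on the one-form
    [x |-> d^L d^R D (. | y)] for fixed right-hand data, and they are affine in
    [D]; local solutions are therefore glued by a partition of unity in the
    left-hand variable, the terms in its derivatives cancelling because the
    local solutions have the same lower order jets. *)

From HB Require Import structures.
Require Import Defs.
From mathcomp Require Import all_boot all_order all_algebra finmap.
From mathcomp Require Import all_classical all_reals all_analysis.
From mathcomp Require Import ring lra.

Set Implicit Arguments.
Unset Strict Implicit.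
Unset Printing Implicit Defensive.

Import Order.TTheory GRing.Theory Num.Theory.
Import numFieldNormedType.Exports.

Local Open Scope classical_set_scope.
Local Open Scope ring_scope.

(** * Calculus in finite-dimensional normed spaces *)

(** The constants in [D] come from comparing two groups of first derivatives on the diagonal. Write
    Gamma(uv,w) for the derivative of omega(v,w) along (u,0). The symmetries say that the derivative
    along (0,u) is Gamma(uw,v) + C(u,v,w) with C totally symmetric. For the ansatz sum_ij (alpha
    omega_ij(y,x) + beta omega_ij(x,y)) h_i h_j, the mixed second derivative is -2 (alpha + beta) g
    and the third derivative is -2 (alpha + beta) Gamma(uv,w) + (2 beta - 4 alpha) C. Hence alpha =
    -1/6 and beta = -1/3.

    Two more points shape the proof. Smoothness is given by iterated directional derivatives, so the
    Fréchet differentiability that the chain rule requires has to be extracted from the continuity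
    of the partial derivatives. And the glued function has no cut-off in the right variable: as the
    supports are closed and locally finite, all pieces that contribute are smooth on one common
    neighbourhood of the diagonal. *)

Section lines.
Context {R : realType} {V W : normedModType R}.
Implicit Types (f : V -> W) (x v : V).

Lemma is_derive_line f x v (t : R) : derivable f (x + t *: v) v ->
  is_derive t 1 (fun s : R => f (x + s *: v)) ('D_v f (x + t *: v)).
Proof.
have E : (fun h : R => h^-1 *: (((fun s : R => f (x + s *: v)) \o shift t) (h *: 1) -
            f (x + t *: v))) =
  (fun h => h^-1 *: ((f \o shift (x + t *: v)) (h *: v) - f (x + t *: v))).
  apply/funext => h /=; congr (_ *: (f _ - _)).
  by rewrite [h *: 1]mulr1 scalerDl addrCA.
by move=> df; split; rewrite ?/derivable ?/derive E.
Qed.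

Lemma is_derive_translate f (w x v : V) : derivable f (x + w) v ->
  is_derive x v (fun y => f (y + w)) ('D_v f (x + w)).
Proof.
have E : (fun h : R => h^-1 *: (((fun y => f (y + w)) \o shift x) (h *: v) -
     f (x + w))) = (fun h => h^-1 *: ((f \o shift (x + w)) (h *: v) - f (x + w))).
  by apply/funext => k; rewrite /= addrA.
by move=> df; split; rewrite ?/derivable ?/derive E.
Qed.

End lines.

(** * Mean values and symmetry of mixed derivatives *)

Section mvt.
Context {R : realType} {V : normedModType R}.
Implicit Types (f : V -> R) (x v : V).

(** The step [t] may be negative, hence the two orientations of the segment in the proof; bounding
    the intermediate parameter by its absolute value suits both. *)
Lemma mean_value_line f x v (t : R) :
  (forall s : R, `|s| <= `|t| -> derivable f (x + s *: v) v) ->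
  exists2 s : R, `|s| <= `|t| &
    f (x + t *: v) - f x = t * 'D_v f (x + s *: v).
Proof.
move=> df; pose g : R -> R := fun s => f (x + s *: v).
pose dg : R -> R := fun s => 'D_v f (x + s *: v).
have gd (s : R) : `|s| <= `|t| -> is_derive s 1 g (dg s).
  by move=> st; exact: (@is_derive_line _ _ _ f x v s (df s st)).
have gc (a b : R) : (forall s, s \in `[a, b]%R -> `|s| <= `|t|) ->
    {within `[a, b], continuous g}.
  move=> ab; apply: derivable_within_continuous => s /ab /gd [] //.
have E0 : g 0 = f x by rewrite /g scale0r addr0.
have [t0|t0] := leP 0 t.
  have H (s : R) : s \in `[0, t]%R -> `|s| <= `|t|.
    by rewrite in_itv /= => /andP[s0 st]; rewrite !ger0_norm.
  have [|||s sI Es] := @MVT_segment R g dg 0 t => //.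
    move=> s sI; apply: gd; apply: H; move: sI; rewrite !in_itv /= => /andP[].
    by move=> /ltW -> /ltW ->.
    exact: gc.
  exists s; first exact: H.
  by rewrite -E0 -/(g t) Es subr0 mulrC.
have H (s : R) : s \in `[t, 0]%R -> `|s| <= `|t|.
  rewrite in_itv /= => /andP[st s0].
  by rewrite !ler0_norm ?lerN2 // ltW.
have [|||s sI Es] := @MVT_segment R g dg t 0; first exact: ltW.
  move=> s sI; apply: gd; apply: H; move: sI; rewrite !in_itv /= => /andP[].
  by move=> /ltW -> /ltW ->.
  exact: gc.
exists s; first exact: H.
by rewrite -E0 -/(g t) -opprB Es /dg; ring.
Qed.

(** Two mean value theorems: one along [u] for the increment [h] of [f] in direction [v], then one
    along [v] for ['D_u f]. The left-hand side is symmetric in [u] and [v], which is what makes it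
    useful for comparing mixed derivatives. *)
Lemma second_difference f x u v (t : R) :
  (forall a b : R, `|a| <= `|t| -> `|b| <= `|t| ->
     derivable f (x + a *: u + b *: v) u /\
     derivable ('D_u f) (x + a *: u + b *: v) v) ->
  exists2 a : R, `|a| <= `|t| & exists2 b : R, `|b| <= `|t| &
    f (x + t *: u + t *: v) - f (x + t *: u) - (f (x + t *: v) - f x) =
    t * (t * 'D_v ('D_u f) (x + a *: u + b *: v)).
Proof.
move=> H; pose h y := f (y + t *: v) - f y.
have hd (s : R) : `|s| <= `|t| -> is_derive (x + s *: u) u h
    ('D_u f (x + s *: u + t *: v) - 'D_u f (x + s *: u)).
  move=> st; set y := x + s *: u.
  have [dy _] : derivable f y u /\ derivable ('D_u f) y v.
    by have := H s 0 st; rewrite scale0r addr0; apply; rewrite normr0.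
  have h2 : is_derive y u (fun y => f (y + t *: v)) ('D_u f (y + t *: v)).
    have [dy2 _] := H s t st (lexx _).
    exact: is_derive_translate.
  exact: is_deriveB.
have [|a at_ E] := @mean_value_line h x u t.
  by move=> s st; have [] := hd s st.
have [|b bt E'] := @mean_value_line ('D_u f) (x + a *: u) v t.
  by move=> s st; have [] := H a s at_ st.
exists a => //; exists b => //.
by have [_ E2] := hd a at_; rewrite -E' -E2 -E.
Qed.

Lemma near_line2 (P : set V) x u v : (\forall y \near x, P y) ->
  exists2 t : R, 0 < t & forall a b : R, `|a| <= t -> `|b| <= t ->
    P (x + a *: u + b *: v).
Proof.
move=> /nbhs_ballP[d /= d0 H].
(* The [+ 1] keeps [N] positive when [u] and [v] are both zero. *)
pose N := `|u| + `|v| + 1.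
have N0 : 0 < N by rewrite /N ltr_wpDl // addr_ge0.
exists (d / (2 * N)); first by rewrite divr_gt0 // mulr_gt0.
move=> a b; set t := d / (2 * N) => at_ bt; apply: H.
rewrite -ball_normE /ball_ /= opprD addrA opprD addrA subrr sub0r.
rewrite -opprD normrN (le_lt_trans (ler_normD _ _)) // !normrZ.
have h1 : `|a| * `|u| <= t * `|u| by rewrite ler_wpM2r.
have h2 : `|b| * `|v| <= t * `|v| by rewrite ler_wpM2r.
apply: le_lt_trans (lerD h1 h2) _.
have -> : d = t * (2 * N) by rewrite /t divfK // mulf_neq0 ?gt_eqF.
rewrite -mulrDr ltr_pM2l ?divr_gt0 ?mulr_gt0 // /N.
have := normr_ge0 u; have := normr_ge0 v; lra.
Qed.

(* The second difference quotient is a value of either mixed derivative. *)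
Lemma derive_comm f x u v :
  (\forall y \near x, [/\ derivable f y u, derivable f y v,
      derivable ('D_u f) y v & derivable ('D_v f) y u]) ->
  {for x, continuous ('D_v ('D_u f))} -> {for x, continuous ('D_u ('D_v f))} ->
  'D_v ('D_u f) x = 'D_u ('D_v f) x.
Proof.
move=> nf c1 c2; apply/eqP; rewrite -subr_eq0 -normr_le0; apply/ler_addgt0Pl => e e0.
rewrite addr0.
have e20 : 0 < e / 2 by rewrite divr_gt0.
move/cvgrPdist_le : c1 => /(_ _ e20) c1.
move/cvgrPdist_le : c2 => /(_ _ e20) c2.
have [t t0 H] := near_line2 u v (filterI nf (filterI c1 c2)).
have tE : `|t| = t by rewrite ger0_norm // ltW.
have [a b at_ bt|a at_ [b bt E]] := @second_difference f x u v t.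
  by rewrite tE in at_ bt; have [[h1 _ h2 _] _] := H _ _ at_ bt; split; [exact: h1|exact: h2].
have [b' a' bt' at_'|b' bt' [a' at_' E']] := @second_difference f x v u t.
  by rewrite tE in bt' at_'; rewrite addrAC; have [[_ h1 _ h2] _] := H _ _ at_' bt'; split; [exact: h1|exact: h2].
rewrite !tE in at_ bt at_' bt'.
have [_ [h1 _]] := H _ _ at_ bt; have [_ [_ h2]] := H _ _ at_' bt'.
have tn : t != 0 by rewrite gt_eqF.
have Ez : 'D_v ('D_u f) (x + a *: u + b *: v) =
          'D_u ('D_v f) (x + a' *: u + b' *: v); last first.
  move: h1 h2; rewrite Ez.
  move: ('D_u ('D_v f) (x + a' *: u + b' *: v)) ('D_u ('D_v f) x) => z w.
  move: ('D_v ('D_u f) x) => w' h1 h2.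
  apply: (le_trans (ler_distD z _ _)); rewrite [e]splitr; apply: lerD; first exact: h1.
  by rewrite distrC; exact: h2.
rewrite [x + a' *: u + _]addrAC; move: E E'; rewrite [x + t *: v + _]addrAC.
move: ('D_v ('D_u f) _) ('D_u ('D_v f) _) => p q E E'.
by apply: (mulfI tn); apply: (mulfI tn); rewrite -E -E'; ring.
Qed.

End mvt.

Section big_sums.
Context {R : realType} {V W : normedModType R}.

Lemma continuous_bigsum (T : topologicalType) (I : Type) (r : seq I)
    (F : I -> T -> W) (x : T) :
  (forall i, {for x, continuous (F i)}) ->
  {for x, continuous (fun y => \sum_(i <- r) F i y)}.
Proof.
move=> cF; elim: r => [|i r IH].
  rewrite (_ : (fun _ => _) = cst 0); first exact: cvg_cst.
  by apply/funext => y; rewrite big_nil.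
rewrite (_ : (fun _ => _) = fun y => F i y + \sum_(j <- r) F j y); last first.
  by apply/funext => y; rewrite big_cons.
exact: (@continuousD _ _ _ (F i) (fun y => \sum_(j <- r) F j y) _ (cF i) IH).
Qed.

Lemma is_derive_bigsum (I : Type) (r : seq I) (F : I -> V -> W) (dF : I -> W)
    (x v : V) : (forall i, is_derive x v (F i) (dF i)) ->
  is_derive x v (fun y => \sum_(i <- r) F i y) (\sum_(i <- r) dF i).
Proof.
move=> FF; elim: r => [|i r IH].
  rewrite (_ : (fun _ => _) = cst 0) ?big_nil; first exact: is_derive_cst.
  by apply/funext => y; rewrite big_nil.
rewrite (_ : (fun _ => _) = fun y => F i y + \sum_(j <- r) F j y); last first.
  by apply/funext => y; rewrite big_cons.
rewrite big_cons.
exact: (@is_deriveD _ _ _ (F i) (fun y => \sum_(j <- r) F j y) _ _ _ _ (FF i) IH).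
Qed.

End big_sums.

(* Finite dimension is given by a basis with continuous coordinate forms. *)
Class findim (R : realType) (V : normedModType R) := Findim {
  fdI : finType;
  fde : fdI -> V;
  fdl : fdI -> {linear V -> R};
  fdl_continuous : forall i, continuous (fdl i);
  fdE : forall v, v = \sum_i fdl i v *: fde i }.
Arguments fdI {R} V {_}.
Arguments fde {R V _} i.
Arguments fdl {R V _} i.

(** * Differentiability from continuous partial derivatives *)

Section partials.
Context {R : realType} {V : normedModType R} {bV : findim V}.
Implicit Types (f : V -> R) (x h : V).

Let psum (s : seq (fdI V)) h : V := \sum_(i <- s) fdl i h *: fde i.

Lemma fdl_lipschitz (i : fdI V) : exists2 k : R, 0 < k & forall h, `|fdl i h| <= k * `|h|.
Proof. exact/linear_lipschitz/fdl_continuous. Qed.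

Let psum_lipschitz s : exists2 k : R, 0 < k & forall h, `|psum s h| <= k * `|h|.
Proof.
elim: s => [|i s [k k0 ks]].
  by exists 1 => // h; rewrite /psum big_nil normr0 mul1r.
have [c c0 ci] := fdl_lipschitz i; exists (c * `|fde i| + k).
  by rewrite ltr_wpDl // mulr_ge0 // ltW.
move=> h; rewrite /psum big_cons (le_trans (ler_normD _ _)) // mulrDl.
by apply: lerD; [rewrite normrZ mulrAC ler_wpM2r|exact: ks].
Qed.

(** The point [x] is joined to [x + h] by a broken line with sides parallel to the basis vectors. On
    each side the mean value theorem and the continuity of one partial derivative at [x] replace the
    increment by a linear term. *)
Lemma differentiable_of_partials f x :
  (forall i, \forall y \near x, derivable f y (fde i)) ->
  (forall i, {for x, continuous ('D_(fde i) f)}) -> differentiable f x.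
Proof.
move=> df cf.
have key (s : seq (fdI V)) : forall e : R, 0 < e -> \forall h \near (0 : V),
    `|f (x + psum s h) - f x - \sum_(i <- s) fdl i h * 'D_(fde i) f x| <= e * `|h|.
  elim: s => [|i s IH] e e0.
    apply: nearW => h; rewrite /psum !big_nil addr0 !subrr normr0.
    by rewrite mulr_ge0 // ltW.
  have e20 : 0 < e / 2 by rewrite divr_gt0.
  have [c c0 ci] := fdl_lipschitz i.
  have [k k0 ks] := psum_lipschitz s.
  (* As [c] bounds the coordinate [fdl i], this tolerance costs e/2 times the norm of [h] on the
     last side; the other half is left to the earlier sides. *)
  have ec0 : 0 < e / 2 / c by rewrite divr_gt0.
  move/cvgrPdist_le : (cf i) => /(_ _ ec0) cfi.
  have : \forall y \near x, derivable f y (fde i) /\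
      `|'D_(fde i) f x - 'D_(fde i) f y| <= e / 2 / c.
    exact: filterI (df i) cfi.
  move => /nbhs_ballP[d /= d0 H].
  near=> h.
  have hd : (k + c * `|fde i|) * `|h| < d.
    rewrite mulrC -ltr_pdivlMr; last by rewrite ltr_wpDr // mulr_ge0 // ltW.
    by near: h; apply: nbhs0_lt; rewrite divr_gt0 // ltr_wpDr // mulr_ge0 // ltW.
  have B (t : R) : `|t| <= `|fdl i h| -> ball x d (x + psum s h + t *: fde i).
    move=> th; rewrite -ball_normE /ball_ /= -addrA opprD addrA subrr sub0r normrN.
    apply: le_lt_trans hd; apply: le_trans (ler_normD _ _) _.
    rewrite mulrDl lerD // normrZ mulrAC ler_wpM2r //.
    exact: le_trans th (ci h).
  have [|t th E] := @mean_value_line _ _ f (x + psum s h) (fde i) (fdl i h).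
    by move=> t /B /H [].
  have [_ Dt] := H _ (B _ th).
  have IHh : `|f (x + psum s h) - f x - \sum_(i <- s) fdl i h * 'D_(fde i) f x|
    <= e / 2 * `|h| by near: h; exact: IH.
  have -> : psum (i :: s) h = psum s h + fdl i h *: fde i.
    by rewrite /psum big_cons addrC.
  rewrite big_cons addrA; move: Dt E.
  move: ('D_(fde i) f (x + _ + _)) => b; move: ('D_(fde i) f x) => a /= ab E.
  rewrite -[f _](subrK (f (x + psum s h))) E.
  move: IHh; move: (f (x + psum s h)) (f x) (\sum_(j <- s) _) => p q r IHh.
  have -> : fdl i h * b + p - q - (fdl i h * a + r) =
     (p - q - r) + fdl i h * (b - a) by ring.
  rewrite (le_trans (ler_normD _ _)) // [e]splitr mulrDl lerD //.
  rewrite normrM distrC (le_trans (ler_pM _ _ (ci h) ab)) //.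
  have cn : c != 0 by rewrite gt_eqF.
  by rewrite (_ : c * `|h| * (e / 2 / c) = e / 2 * `|h|) //; field.
pose D (h : V) : R := \sum_(i : fdI V) @fdl _ _ bV i h * 'D_(fde i) f x.
have linD : linear D.
  move=> a u v; rewrite /D scaler_sumr -big_split /=; apply: eq_bigr => i _.
  by rewrite linearP /GRing.scale /= mulrDl mulrA.
pose DM := GRing.isLinear.Build _ _ _ _ _ linD.
pose DL : {linear _ -> _} := HB.pack D DM.
apply/diffP => /=.
(* The differential is picked by choice among the continuous linear maps with the first-order
   expansion, so exhibiting one such map is enough. *)
apply: (@getPex _ (fun (df : {linear V -> R}) => continuous df /\
  forall y, f y = f (lim (nbhs x)) + df (y - lim (nbhs x))
                  +o_(y \near x) (y - lim (nbhs x)))).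
exists DL; split.
  move=> z; apply: (@continuous_bigsum _ _ _ _ _ (fun i h => fdl i h * _)) => i.
  apply: (@continuousM _ _ (fdl i) (fun=> 'D_(fde i) f x)); last exact: cvg_cst.
  exact: fdl_continuous.
rewrite lim_id //; suff : f = cst (f x) + DL \o center x +o_x (center x).
  by rewrite funeqE.
apply/eqaddoP => e e0.
suff : \forall y \near x, `|(f - (cst (f x) + DL \o center x)) y| <= e * `|center x y|.
  by [].
rewrite (near_shift 0) subr0; near=> h.
have: `|f (x + psum (index_enum (fdI V)) h) - f x - D h| <= e * `|h|.
  by near: h; exact: key.
by rewrite /psum -fdE !fctE /= addrK [h + x]addrC opprD addrA.
Unshelve. all: by end_near. Qed.

End partials.

(** Grading smoothness by order allows induction on [k]: the derivative of a product, an inverse or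
    a composite involves the original functions again, and these are available one order lower by
    [CkW]. *)
Fixpoint Ck (R : realType) (V W : normedModType R) (k : nat) (S : set V)
    (f : V -> W) : Prop :=
  (forall x, S x -> {for x, continuous f}) /\
  if k is k'.+1 then
    forall v, (forall x, S x -> derivable f x v) /\ Ck k' S ('D_v f)
  else True.

Section Ck.
Context {R : realType} {V W : normedModType R}.
Implicit Types (f g : V -> W) (S : set V) (x v : V).

Lemma near_eq_continuous (T U : topologicalType) (f g : T -> U) (x : T) :
  (\forall y \near x, f y = g y) -> {for x, continuous f} ->
  {for x, continuous g}.
Proof.
move=> fg cf; have E := nbhs_singleton fg.
rewrite /prop_for /continuous_at -E; apply: cvg_trans cf.
exact: near_eq_cvg.
Qed.

Lemma Ck_continuous k S f x : Ck k S f -> S x -> {for x, continuous f}.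
Proof. by case: k => [|k] [h _]; exact: h. Qed.

Lemma Ck_derive k S f v : Ck k.+1 S f -> Ck k S ('D_v f).
Proof. by case=> _ /(_ v) []. Qed.

Lemma Ck_is_derive k S f x v : Ck k.+1 S f -> S x -> is_derive x v f ('D_v f x).
Proof. by case=> _ /(_ v) [h _] /h /derivableP. Qed.

Lemma CkW k S f : Ck k.+1 S f -> Ck k S f.
Proof.
elim: k f => [|k IH] f [cf df]; split=> // v.
by have [h1 h2] := df v; split=> //; exact: IH.
Qed.

Lemma Ck_eq k S f g : open S -> (forall x, S x -> f x = g x) ->
  Ck k S f -> Ck k S g.
Proof.
move=> oS; elim: k f g => [|k IH] f g fg [cf df].
  split=> // x Sx; apply: near_eq_continuous (cf _ Sx).
  by apply: filterS (open_nbhs_nbhs (conj oS Sx)).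
have nfg x : S x -> \forall y \near x, f y = g y.
  by move=> Sx; apply: filterS (open_nbhs_nbhs (conj oS Sx)).
split=> [x Sx|v]; first exact: near_eq_continuous (nfg _ Sx) (cf _ Sx).
have [h1 h2] := df v; split=> [x Sx|].
  exact: near_eq_derivable (nfg _ Sx) (h1 _ Sx).
by apply: IH h2 => x Sx; exact: near_eq_derive (nfg _ Sx).
Qed.

(** Formulas for derivatives hold on [S] only, whereas [Ck] speaks of the total function ['D_v f].
    On an open set agreement on [S] suffices, so the formula [d] may be used instead. *)
Lemma CkS k S f : open S -> (forall v, exists2 d : V -> W,
    (forall x, S x -> is_derive x v f (d x)) & Ck k S d) ->
  (forall x, S x -> {for x, continuous f}) -> Ck k.+1 S f.
Proof.
move=> oS H cf; split=> // v; have [d h1 h2] := H v; split=> [x Sx|].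
  by have := h1 _ Sx => -[].
by apply: Ck_eq h2 => // x Sx; have := h1 _ Sx => -[_ ->].
Qed.

Lemma iter_derive_rcons vs v f :
  iter_derive (rcons vs v) f = iter_derive vs ('D_v f).
Proof. by rewrite /iter_derive foldr_rcons. Qed.

(** The list of directions is peeled from its end: [foldr] takes the derivative along the last entry
    first, and so does the recursion of [Ck]. *)
Lemma smooth_onP S f : smooth_on S f <-> forall k, Ck k S f.
Proof.
split.
  move=> + k; elim: k f => [|k IH] f sf.
    by split=> // x Sx; have [] := sf [::] x Sx.
  split=> [x Sx|v]; first by have [] := sf [::] x Sx.
  split=> [x Sx|]; first by have [_] := sf [::] x Sx; exact.
  by apply: IH => vs x Sx; have := sf (rcons vs v) x Sx; rewrite iter_derive_rcons.
move=> H vs; elim/last_ind: vs f H => [|vs v IH] f H x Sx.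
  split; first by have [h _] := H 0%N; exact: h.
  by move=> v; have [_ /(_ v) [h _]] := H 1%N; exact: h.
by rewrite iter_derive_rcons; apply: IH => // k; exact: Ck_derive (H k.+1).
Qed.

Lemma Ck_cst k S (w : W) : Ck k S (cst w : V -> W).
Proof.
elim: k w => [|k IH] w; first by split=> // x _; exact: cvg_cst.
split=> [x _|v]; first exact: cvg_cst.
split=> [x _|]; first exact: derivable_cst.
rewrite (_ : 'D_v (cst w) = cst 0); first exact: IH.
by apply/funext => x; exact: derive_cst.
Qed.

Lemma CkD k S f g : open S -> Ck k S f -> Ck k S g ->
  Ck k S (fun x => f x + g x).
Proof.
move=> oS; elim: k f g => [|k IH] f g Cf Cg.
  by split=> // x Sx; apply: cvgD; [exact: Ck_continuous Cf Sx|exact: Ck_continuous Cg Sx].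
apply: CkS => // [v|x Sx]; last first.
  by apply: cvgD; [exact: Ck_continuous Cf Sx|exact: Ck_continuous Cg Sx].
exists (fun x => 'D_v f x + 'D_v g x); last first.
  exact: (IH _ _ (Ck_derive v Cf) (Ck_derive v Cg)).
move=> x Sx.
exact: (is_deriveD (Ck_is_derive v Cf Sx) (Ck_is_derive v Cg Sx)).
Qed.

Lemma Ck_sum k S (I : Type) (r : seq I) (F : I -> V -> W) : open S ->
  (forall i, Ck k S (F i)) -> Ck k S (fun x => \sum_(i <- r) F i x).
Proof.
move=> oS CF; elim: r => [|i r IH].
  by under eq_fun do rewrite big_nil; exact: Ck_cst.
by under eq_fun do rewrite big_cons; exact: CkD.
Qed.

End Ck.

Section Ck_scalar.
Context {R : realType} {V : normedModType R}.
Implicit Types (f g : V -> R) (S : set V) (x v : V).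

Lemma is_derive_mul f g x v (df dg : R) :
  is_derive x v f df -> is_derive x v g dg ->
  is_derive x v (fun y => f y * g y) (f x * dg + g x * df).
Proof. exact: is_deriveM. Qed.

Lemma CkM k S f g : open S -> Ck k S f -> Ck k S g ->
  Ck k S (fun x => f x * g x).
Proof.
move=> oS; elim: k f g => [|k IH] f g Cf Cg.
  by split=> // x Sx; apply: cvgM; [exact: Ck_continuous Cf Sx|exact: Ck_continuous Cg Sx].
apply: CkS => // [v|x Sx]; last first.
  by apply: cvgM; [exact: Ck_continuous Cf Sx|exact: Ck_continuous Cg Sx].
exists (fun x => f x * 'D_v g x + g x * 'D_v f x).
  move=> x Sx.
  exact: (is_derive_mul (Ck_is_derive v Cf Sx) (Ck_is_derive v Cg Sx)).
apply: CkD => //.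
  exact: (IH _ _ (CkW Cf) (Ck_derive v Cg)).
exact: (IH _ _ (CkW Cg) (Ck_derive v Cf)).
Qed.

(** The derivative of the inverse is a product of the inverse with itself and with ['D_v f], so the
    induction hypothesis covers it. *)
Lemma CkV k S f : open S -> (forall x, S x -> f x != 0) -> Ck k S f ->
  Ck k S (fun x => (f x)^-1).
Proof.
move=> oS f0; elim: k => [|k IH] Cf.
  by split=> // x Sx; apply: cvgV; [exact: f0|exact: Ck_continuous Cf Sx].
apply: CkS => // [v|x Sx]; last first.
  by apply: cvgV; [exact: f0|exact: Ck_continuous Cf Sx].
exists (fun x => -1 * ((f x)^-1 * (f x)^-1) * 'D_v f x).
  move=> x Sx; have fx := f0 _ Sx.
  have [h1 h2] := Ck_is_derive v Cf Sx.
  split; first exact: derivableV.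
  by rewrite deriveV // mulN1r expr2 invfM.
have C := IH (CkW Cf).
do 2?apply: CkM => //; [exact: Ck_cst|exact: CkM|exact: Ck_derive].
Qed.

Lemma Ck_differentiable {bV : findim V} k S f x : open S -> Ck k.+1 S f -> S x ->
  differentiable f x.
Proof.
move=> oS Cf Sx; apply: differentiable_of_partials => i.
  apply: filterS (open_nbhs_nbhs (conj oS Sx)) => y Sy.
  by have [] := Ck_is_derive (fde i) Cf Sy.
exact: Ck_continuous (Ck_derive (fde i) Cf) Sx.
Qed.

End Ck_scalar.

Section linear_post.
Context {R : realType} {V W X : normedModType R} (l : {linear W -> X}).
Hypothesis lc : continuous l.

Lemma is_derive_linear_comp (f : V -> W) x v (df : W) : is_derive x v f df ->
  is_derive x v (l \o f) (l df).
Proof.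
move=> [h1 h2].
have E : (fun h : R => h^-1 *: (((l \o f) \o shift x) (h *: v) - (l \o f) x)) =
    l \o (fun h => h^-1 *: ((f \o shift x) (h *: v) - f x)).
  by apply/funext => h; rewrite /= -linearB -linearZ.
have C : (fun h : R => h^-1 *: (((l \o f) \o shift x) (h *: v) - (l \o f) x)) @ 0^'
    --> l df.
  rewrite E; apply: continuous_cvg; first exact: lc.
  by rewrite -h2; exact: h1.
by split; [apply/cvg_ex; exists (l df)|exact: cvg_lim C].
Qed.

Lemma Ck_linear_comp k S (f : V -> W) : open S -> Ck k S f -> Ck k S (l \o f).
Proof.
move=> oS; elim: k f => [|k IH] f Cf.
  split=> // x Sx; apply: continuous_comp; first exact: Ck_continuous Cf Sx.
  exact: lc.
apply: CkS => // [v|x Sx].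
  exists (l \o 'D_v f); last exact: IH (Ck_derive v Cf).
  by move=> x Sx; exact: is_derive_linear_comp (Ck_is_derive v Cf Sx).
by apply: continuous_comp; [exact: Ck_continuous Cf Sx|exact: lc].
Qed.

End linear_post.

Lemma Ck_id (R : realType) (V : normedModType R) k S : Ck k S (@id V).
Proof.
case: k => [|k]; first by split=> // x _; exact: cvg_id.
split=> [x _|v]; first exact: cvg_id.
split=> [x _|]; first exact: derivable_id.
rewrite (_ : 'D_v id = cst v); first exact: Ck_cst.
by apply/funext => x; exact: derive_id.
Qed.

Section coordinates.
Context {R : realType} {V W : normedModType R} {bW : findim W}.
Implicit Types (f : V -> W) (S : set V).

Lemma Ck_scalev k S (a : V -> R) (w : W) : open S -> Ck k S a ->
  Ck k S (fun x => a x *: w).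
Proof.
move=> oS Ca.
have lin : linear (fun c : R => c *: w).
  move=> b u v; rewrite scalerDl; congr (_ + _); exact/esym/scalerA.
pose lM := GRing.isLinear.Build _ _ _ _ _ lin.
pose lL : {linear R -> W} := HB.pack (fun c : R => c *: w) lM.
by apply: (@Ck_linear_comp _ _ _ _ lL) => //; exact: scalel_continuous.
Qed.

Lemma Ck_coordP k S f : open S ->
  Ck k S f <-> forall i : fdI W, Ck k S (fun x => fdl i (f x)).
Proof.
move=> oS; split=> [Cf i|H].
  by apply: (@Ck_linear_comp _ _ _ _ (fdl i)) => //; exact: fdl_continuous.
rewrite (_ : f = fun x => \sum_(i : fdI W) fdl i (f x) *: fde i).
  by apply: Ck_sum => // i; exact: Ck_scalev.
by apply/funext => x; exact: fdE.
Qed.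

Lemma Ck_vdifferentiable {bV : findim V} k S f x : open S -> Ck k.+1 S f -> S x ->
  differentiable f x.
Proof.
move=> oS Cf Sx.
rewrite (_ : f = fun x => \sum_(i : fdI W) fdl i (f x) *: fde i); last first.
  by apply/funext => y; exact: fdE.
have H i : differentiable (fun x => fdl i (f x) *: fde i) x.
  apply: differentiableZl; move: Cf => /(Ck_coordP _ _ oS) /(_ i) C.
  exact: Ck_differentiable C Sx.
elim: (index_enum _) => [|i r IH].
  by under eq_fun do rewrite big_nil; exact: differentiable_cst.
by under eq_fun do rewrite big_cons; exact: differentiableD.
Qed.

End coordinates.

Section composition.
Context {R : realType} {V W : normedModType R} {bV : findim V} {bW : findim W}.

Lemma chain_rule (X : normedModType R) (f : V -> W) (g : W -> X) x v :
  differentiable f x -> differentiable g (f x) ->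
  is_derive x v (g \o f) ('D_('D_v f x) g (f x)).
Proof.
move=> df dg; have dgf := differentiable_comp df dg.
split; first exact: diff_derivable.
by rewrite deriveE // diff_comp // !deriveE.
Qed.

Lemma derive_coord (X : normedModType R) (g : W -> X) y w : differentiable g y ->
  'D_w g y = \sum_(i : fdI W) fdl i w *: 'D_(fde i) g y.
Proof.
move=> dg; rewrite deriveE // {1}[w]fdE linear_sum; apply: eq_bigr => i _.
by rewrite linearZ deriveE.
Qed.

(** Expanding the chain rule in coordinates of [W] keeps the induction among scalar functions: each
    ['D_(fde i) g] is composed with the same [f]. Vector-valued [g] are treated coordinatewise
    afterwards. *)
Lemma Ck_comp k S (T : set W) (f : V -> W) (g : W -> R) :
  open S -> open T -> (forall x, S x -> T (f x)) ->
  Ck k S f -> Ck k T g -> Ck k S (g \o f).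
Proof.
move=> oS oT ST; elim: k g => [|k IH] g Cf Cg.
  split=> // x Sx; apply: continuous_comp; first exact: Ck_continuous Cf Sx.
  exact: Ck_continuous Cg (ST _ Sx).
apply: CkS => // [v|x Sx]; last first.
  apply: continuous_comp; first exact: Ck_continuous Cf Sx.
  exact: Ck_continuous Cg (ST _ Sx).
exists (fun x => \sum_(i : fdI W) fdl i ('D_v f x) * ('D_(fde i) g \o f) x).
  move=> x Sx; have df : differentiable f x by exact: Ck_vdifferentiable Cf Sx.
  have dg : differentiable g (f x) by exact: Ck_differentiable Cg (ST _ Sx).
  by rewrite -(derive_coord _ dg); exact: chain_rule.
apply: Ck_sum => // i; apply: CkM => //.
  by move: (Ck_derive v Cf) => /(Ck_coordP _ _ oS); exact.
by apply: IH; [exact: CkW|exact: Ck_derive].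
Qed.

End composition.

#[export] Instance findim_scalar (R : realType) : findim R.
Proof.
exists unit (fun=> 1) (fun=> idfun) => [_ x|v]; first exact: cvg_id.
by rewrite big_const cardT enumT unlock /= addr0; exact/esym/mulr1.
Defined.

Section findim_rV.
Context {R : realType} {n : nat}.

Definition rV_coord (i : 'I_n) (v : 'rV[R]_n) : R := v ord0 i.

Fact rV_coord_linear i : linear (rV_coord i).
Proof. by move=> a u v; rewrite /rV_coord !mxE. Qed.
HB.instance Definition _ i :=
  GRing.isLinear.Build R 'rV[R]_n R *:%R (rV_coord i) (rV_coord_linear i).

Fact rV_coordE v : v = \sum_i rV_coord i v *: delta_mx 0 i.
Proof. exact: row_sum_delta. Qed.

#[export] Instance findim_rV : findim 'rV[R]_n :=
  @Findim R 'rV[R]_n 'I_n (fun i => delta_mx 0 i) (fun i => rV_coord i : {linear _ -> _})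
    (fun i => @coord_continuous _ 1 n ord0 i) rV_coordE.

End findim_rV.

Section findim_prod.
Context {R : realType} {V W : normedModType R} {bV : findim V} {bW : findim W}.

Definition prod_basis (i : fdI V + fdI W) : V * W :=
  match i with inl j => (fde j, 0) | inr j => (0, fde j) end.

Definition prod_coord (i : fdI V + fdI W) (p : V * W) : R :=
  match i with inl j => fdl j p.1 | inr j => fdl j p.2 end.

Fact prod_coord_linear i : linear (prod_coord i).
Proof. by case: i => i a u v; rewrite /prod_coord linearP. Qed.
HB.instance Definition _ i :=
  GRing.isLinear.Build R (V * W)%type R *:%R (prod_coord i) (prod_coord_linear i).

Fact prod_coord_continuous i : continuous (prod_coord i).
Proof.
case: i => i p.
  apply: (@continuous_comp _ _ _ fst (fdl i)); first exact: cvg_fst.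
  exact: fdl_continuous.
apply: (@continuous_comp _ _ _ snd (fdl i)); first exact: cvg_snd.
exact: fdl_continuous.
Qed.

Fact prod_coordE p : p = \sum_i prod_coord i p *: prod_basis i.
Proof.
case: p => v w; rewrite big_sumType /=.
have E1 (r : seq (fdI V)) :
    \sum_(i <- r) fdl i v *: (fde i, 0 : W) = (\sum_(i <- r) fdl i v *: fde i, 0).
  elim: r => [|i r IH]; first by rewrite !big_nil.
  by rewrite !big_cons IH; congr (_, _); rewrite /= ?scaler0 ?addr0.
have E2 (r : seq (fdI W)) :
    \sum_(i <- r) fdl i w *: (0 : V, fde i) = (0, \sum_(i <- r) fdl i w *: fde i).
  elim: r => [|i r IH]; first by rewrite !big_nil.
  by rewrite !big_cons IH; congr (_, _); rewrite /= ?scaler0 ?addr0.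
by rewrite E1 E2 -!fdE; congr (_, _); rewrite /= ?addr0 ?add0r.
Qed.

#[export] Instance findim_prod : findim (V * W)%type :=
  @Findim R (V * W)%type (fdI V + fdI W)%type prod_basis
    (fun i => prod_coord i : {linear _ -> _}) prod_coord_continuous prod_coordE.

End findim_prod.

Section smooth_on.
Context {R : realType} {V W X : normedModType R}
  {bV : findim V} {bW : findim W} {bX : findim X}.
Implicit Types (S : set V) (x v : V).

Lemma smooth_on_subset S S' (f : V -> W) : S' `<=` S -> smooth_on S f ->
  smooth_on S' f.
Proof. by move=> SS sf vs x /SS; exact: sf. Qed.

Lemma smooth_on_local S (f : V -> W) :
  (forall x, S x -> exists2 S', S' x & smooth_on S' f) -> smooth_on S f.
Proof. by move=> H vs x /H [S' S'x]; exact. Qed.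

Lemma smooth_on_eq S (f g : V -> W) : open S -> (forall x, S x -> f x = g x) ->
  smooth_on S f -> smooth_on S g.
Proof.
by move=> oS fg /smooth_onP sf; apply/smooth_onP => k; exact: Ck_eq fg (sf k).
Qed.

Lemma smooth_on_continuous S (f : V -> W) x : smooth_on S f -> S x ->
  {for x, continuous f}.
Proof. by move=> sf /(sf [::]) []. Qed.

Lemma smooth_on_derive S (f : V -> W) v : smooth_on S f -> smooth_on S ('D_v f).
Proof.
by move=> /smooth_onP sf; apply/smooth_onP => k; exact: Ck_derive (sf k.+1).
Qed.

Lemma smooth_on_is_derive S (f : V -> W) x v : smooth_on S f -> S x ->
  is_derive x v f ('D_v f x).
Proof. by move=> /smooth_onP sf Sx; exact: Ck_is_derive (sf 1%N) Sx. Qed.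

Lemma smooth_on_cst S (w : W) : smooth_on S (cst w : V -> W).
Proof. by apply/smooth_onP => k; exact: Ck_cst. Qed.

Lemma smooth_on_id S : smooth_on S (@id V).
Proof. by apply/smooth_onP => k; exact: Ck_id. Qed.

Lemma smooth_onD S (f g : V -> W) : open S -> smooth_on S f -> smooth_on S g ->
  smooth_on S (fun x => f x + g x).
Proof.
by move=> oS /smooth_onP sf /smooth_onP sg; apply/smooth_onP => k; exact: CkD.
Qed.

Lemma smooth_on_sum S (I : Type) (r : seq I) (F : I -> V -> W) : open S ->
  (forall i, smooth_on S (F i)) -> smooth_on S (fun x => \sum_(i <- r) F i x).
Proof.
move=> oS sF; apply/smooth_onP => k; apply: Ck_sum => // i.
by move: (sF i) => /smooth_onP; exact.
Qed.

Lemma smooth_onM S (f g : V -> R) : open S -> smooth_on S f -> smooth_on S g ->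
  smooth_on S (fun x => f x * g x).
Proof.
by move=> oS /smooth_onP sf /smooth_onP sg; apply/smooth_onP => k; exact: CkM.
Qed.

Lemma smooth_onV S (f : V -> R) : open S -> (forall x, S x -> f x != 0) ->
  smooth_on S f -> smooth_on S (fun x => (f x)^-1).
Proof. by move=> oS f0 /smooth_onP sf; apply/smooth_onP => k; exact: CkV. Qed.

Lemma smooth_on_linear_comp (l : {linear W -> X}) S (f : V -> W) :
  continuous l -> open S -> smooth_on S f -> smooth_on S (l \o f).
Proof.
move=> cl oS /smooth_onP sf; apply/smooth_onP => k; exact: Ck_linear_comp.
Qed.

Lemma smooth_on_coordP S (f : V -> W) : open S ->
  smooth_on S f <-> forall i : fdI W, smooth_on S (fun x => fdl i (f x)).
Proof.
move=> oS; split=> [sf i|H].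
  move: sf => /smooth_onP sf; apply/smooth_onP => k.
  by move: (sf k) => /(Ck_coordP _ _ oS).
by apply/smooth_onP => k; apply/Ck_coordP => // i; move: (H i) => /smooth_onP; exact.
Qed.

Lemma smooth_on_differentiable S (f : V -> W) x : open S -> smooth_on S f ->
  S x -> differentiable f x.
Proof. by move=> oS /smooth_onP sf Sx; exact: Ck_vdifferentiable (sf 1%N) Sx. Qed.

Lemma smooth_on_comp S (T : set W) (f : V -> W) (g : W -> X) :
  open S -> open T -> (forall x, S x -> T (f x)) ->
  smooth_on S f -> smooth_on T g -> smooth_on S (g \o f).
Proof.
move=> oS oT ST sf sg; apply/smooth_onP => k; apply/Ck_coordP => // i.
move: sg sf => /smooth_onP /(_ k) /(Ck_coordP _ _ oT) /(_ i) sg /smooth_onP /(_ k) sf.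
exact: Ck_comp ST sf sg.
Qed.

Lemma smooth_on_pair S (f : V -> W) (g : V -> X) : open S -> smooth_on S f ->
  smooth_on S g -> smooth_on S (fun x => (f x, g x)).
Proof.
move=> oS sf sg; apply/smooth_onP => k.
apply/(@Ck_coordP _ _ _ (@findim_prod _ _ _ bW bX)) => //.
move: sf sg => /smooth_onP/(_ k) sf /smooth_onP/(_ k) sg.
change (forall i : fdI W + fdI X, Ck k S (fun x => prod_coord i (f x, g x))).
by case=> i; [move: sf|move: sg] => /(Ck_coordP _ _ oS) /(_ i).
Qed.

End smooth_on.

Section smooth_proj.
Context {R : realType} {V W : normedModType R}.

Lemma smooth_on_fst (S : set (V * W)) : smooth_on S fst.
Proof.
have lin : linear (@fst V W) by [].
pose lM := GRing.isLinear.Build _ _ _ _ _ lin.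
pose l : {linear (V * W)%type -> V} := HB.pack (@fst V W) lM.
apply: (@smooth_on_subset _ _ _ setT) => //.
apply: (@smooth_on_linear_comp _ _ _ _ l setT id) => //; first last.
- exact: smooth_on_id.
- exact: openT.
by move=> x; exact: cvg_fst.
Qed.

Lemma smooth_on_snd (S : set (V * W)) : smooth_on S snd.
Proof.
have lin : linear (@snd V W) by [].
pose lM := GRing.isLinear.Build _ _ _ _ _ lin.
pose l : {linear (V * W)%type -> W} := HB.pack (@snd V W) lM.
apply: (@smooth_on_subset _ _ _ setT) => //.
apply: (@smooth_on_linear_comp _ _ _ _ l setT id) => //; first last.
- exact: smooth_on_id.
- exact: openT.
by move=> x; exact: cvg_snd.
Qed.

End smooth_proj.

(** * Bump functions *)

Section bump.
Context {R : realType}.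
Implicit Types (t : R) (k : nat).

Lemma is_derive_scalar (W : normedModType R) (f : R -> W) (x v : R) :
  derivable f x 1 -> is_derive x v f (v *: 'D_1 f x).
Proof.
move=> /derivable1_diffP df; split; first exact: diff_derivable.
by rewrite !deriveE // -linearZ; congr ('d f x _); exact/esym/mulr1.
Qed.

(** The classical flat function is the case [k = 0]. The whole family is introduced because it is
    closed under differentiation up to linear combinations. *)
Definition flat k t : R := if t <= 0 then 0 else (t^-1) ^+ k * expR (- t^-1).

(** For positive [t] a single term of the exponential series bounds [expR t^-1] from below. A bound
    of second order in [t] makes the difference quotient at the origin tend to 0 for all [k] at
    once. *)
Lemma flat_le k t : `|flat k t| <= (k.+2)`!%:R * t ^+ 2.
Proof.
rewrite /flat; case: ifPn => [_|]; first by rewrite normr0 mulr_ge0 // sqr_ge0.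
rewrite -ltNge => t0; have ti : 0 <= t^-1 by rewrite invr_ge0 ltW.
rewrite ger0_norm; last by rewrite mulr_ge0 ?exprn_ge0 ?expR_ge0.
have tn : t != 0 by rewrite gt_eqF.
have h : (t^-1) ^+ k.+2 / (k.+2)`!%:R <= expR t^-1.
  by apply: le_trans (expR_ge1Dxn k.+1 ti); rewrite lerDr.
rewrite expRN ler_pdivrMr ?expR_gt0 //.
move: h; rewrite ler_pdivrMr ?ltr0n ?fact_gt0 // => h.
have -> : t^-1 ^+ k = t ^+ 2 * t^-1 ^+ k.+2.
  by rewrite -(addn2 k) exprD [RHS]mulrCA -exprMn divff // expr1n mulr1.
rewrite [leRHS](_ : _ = t ^+ 2 * (expR t^-1 * (k.+2)`!%:R)); last by ring.
by rewrite ler_wpM2l // sqr_ge0.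
Qed.

Lemma flat_le0 k t : t <= 0 -> flat k t = 0.
Proof. by rewrite /flat => ->. Qed.

Lemma flat_gt0 k t : 0 < t -> flat k t = (t^-1) ^+ k * expR (- t^-1).
Proof. by rewrite /flat leNgt => ->. Qed.

Lemma is_derive_flat k t :
  is_derive t 1 (flat k) (flat k.+2 t - k%:R * flat k.+1 t).
Proof.
have [t0|t0|->] := ltgtP t 0.
- rewrite !flat_le0 ?ltW // mulr0 subr0.
  apply: (near_eq_is_derive (f := cst 0)).
  by near=> s; rewrite flat_le0 // ltW //; near: s; exact: lt_nbhsl.
- rewrite !flat_gt0 //.
  have tn : t != 0 by rewrite gt_eqF.
  have dV : is_derive t 1 (fun s : R => s^-1) (- t ^- 2).
    have := @is_derive_id _ _ t 1 => -[h1 h2]; split; first exact: derivableV.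
    by rewrite deriveV // h2; exact: mulr1.
  have dE : is_derive t 1 (fun s : R => expR (- s^-1)) (expR (- t^-1) * t ^- 2).
    have dN : is_derive t 1 (fun s : R => - s^-1) (t ^- 2).
      by have := is_deriveN dV; rewrite opprK.
    have /derivable1_diffP h1 : derivable (fun s : R => - s^-1) t 1 by [].
    have h2 : differentiable (@expR R) (- t^-1) by apply/derivable1_diffP; exact: derivable_expR.
    have := @chain_rule _ _ _ _ (fun s : R => - s^-1) (@expR R) t 1 h1 h2.
    rewrite derive_val.
    have [_ ->] := is_derive_scalar (t ^- 2) (derivable_expR (x := - t^-1)).
    have E := congr1 (fun g : R -> R => g (- t^-1)) (@derive_expR R).
    by rewrite /= in E; rewrite E mulrC.
  have dX : is_derive t 1 (fun s : R => s^-1 ^+ k) (- (k%:R * t^-1 ^+ k.+1)).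
    elim: (k) => [|j IH]; first by rewrite mul0r oppr0; exact: is_derive_cst.
    under eq_fun do rewrite exprS.
    apply: (is_derive_eq (is_derive_mul dV IH)).
    by rewrite !exprS -natr1; field.
  have ne : \forall s \near t, s^-1 ^+ k * expR (- s^-1) = flat k s.
    by near=> s; rewrite flat_gt0 //; near: s; exact: lt_nbhsr.
  apply: (is_derive_eq (near_eq_is_derive ne (is_derive_mul dX dE))).
  rewrite !(exprS t^-1); move: (t^-1 ^+ k) (expR _) => a E; field; exact: tn.
- rewrite !flat_le0 // mulr0 subr0.
  have C : (fun h : R => h^-1 *: ((flat k \o shift (0:R)) (h *: (1:R)) - flat k 0)) @ 0^' --> (0:R).
    rewrite [flat k 0]flat_le0 //.
    apply/cvgr0Pnorm_le => e e0; near=> h.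
    have hn : h != 0 by near: h; exact: nbhs_dnbhs_neq.
    rewrite /= addr0 subr0 [h *: 1]mulr1 normrM normfV.
    rewrite mulrC ler_pdivrMr ?normr_gt0 //; apply: le_trans (flat_le _ _) _.
    rewrite -real_normK ?num_real // expr2 mulrA ler_wpM2r //.
    rewrite mulrC -ler_pdivlMr ?ltr0n ?fact_gt0 //.
    near: h; apply: dnbhs0_le; by rewrite divr_gt0 // ltr0n fact_gt0.
  by split; [apply/cvg_ex; exists 0|exact: cvg_lim C].
Unshelve. all: by end_near. Qed.

Lemma Ck_flat i k : Ck i setT (flat k).
Proof.
elim: i k => [|i IH] k.
  split=> // x _; apply: differentiable_continuous; apply/derivable1_diffP.
  by have [] := is_derive_flat k x.
apply: CkS; first exact: openT; last first.
  move=> x _; apply: differentiable_continuous; apply/derivable1_diffP.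
  by have [] := is_derive_flat k x.
move=> v; exists (fun t => v * (flat k.+2 t + (- k%:R) * flat k.+1 t)).
  move=> x _; have [h1 h2] := is_derive_flat k x.
  have := is_derive_scalar v h1; rewrite h2 mulNr; exact.
have C (c : R) : Ck i setT (cst c : R -> R) by exact: Ck_cst.
have oT : open [set: R] by exact: openT.
apply: (CkM oT (C v)); apply: (CkD oT (IH _)); exact: (CkM oT (C _) (IH _)).
Qed.

Lemma flat_ge0 t : 0 <= flat 0 t.
Proof. by rewrite /flat; case: ifP => // _; rewrite mulr_ge0 // expR_ge0. Qed.

Lemma flat0_gt0 t : 0 < t -> 0 < flat 0 t.
Proof. by move=> t0; rewrite flat_gt0 // expr0 mul1r expR_gt0. Qed.

Definition step t : R := flat 0 t / (flat 0 t + flat 0 (1 - t)).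

Let step_den_gt0 t : 0 < flat 0 t + flat 0 (1 - t).
Proof.
have [t0|t0] := leP t 0.
  by rewrite ltr_wpDl ?flat_ge0 // flat0_gt0 // subr_gt0 (le_lt_trans t0).
by rewrite ltr_pwDl ?flat_ge0 // flat0_gt0.
Qed.

Lemma step_ge0 t : 0 <= step t.
Proof. by rewrite divr_ge0 ?flat_ge0 // ltW. Qed.

Lemma step_le0 t : t <= 0 -> step t = 0.
Proof. by move=> t0; rewrite /step flat_le0 // mul0r. Qed.

Lemma step_ge1 t : 1 <= t -> step t = 1.
Proof.
move=> t1; have := step_den_gt0 t.
rewrite /step [flat 0 (1 - t)]flat_le0 ?subr_le0 // addr0 => h.
by rewrite divff // gt_eqF.
Qed.

Lemma smooth_step : smooth_on setT step.
Proof.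
have sf : smooth_on setT (flat 0) by apply/smooth_onP => i; exact: Ck_flat.
have oT : open [set: R] by exact: openT.
have sc (c : R) : smooth_on setT (cst c : R -> R) by exact: smooth_on_cst.
have sg : smooth_on setT (fun t : R => 1 - t).
  rewrite (_ : (fun _ => _) = fun t : R => 1 + -1 * t).
    have s1 : smooth_on setT (fun t : R => -1 * t).
      exact: (@smooth_onM R R setT (cst (-1)) id oT (sc (-1)) (@smooth_on_id R R setT)).
    exact: (@smooth_onD R R R setT (cst 1) (fun t => -1 * t) oT (sc 1) s1).
  by apply/funext => t; rewrite mulN1r.
apply: (smooth_onM oT sf (g := fun t => (flat 0 t + flat 0 (1 - t))^-1)).
apply: (smooth_onV oT) => [x _|]; first by rewrite gt_eqF.
apply: (smooth_onD oT sf).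
exact: (@smooth_on_comp _ _ _ _ _ _ _ setT setT (fun t => 1 - t) (flat 0)).
Qed.

(** The norm of row vectors is the maximum norm, so balls are cubes and a product of one-variable
    bumps fits them. Squares replace absolute values to keep the argument of [step] smooth:
    [2 - 2 * q ^ 2] is at least 1 for [q] of size at most 1/2, and at most 0 for [q] of size at
    least 1. *)
Lemma bump_rV n (a : 'rV[R]_n) (r : R) : 0 < r ->
  exists chi : 'rV[R]_n -> R, [/\ smooth_on setT chi, forall x, 0 <= chi x,
    forall x, `|x - a| <= r / 2 -> chi x = 1 &
    forall x, chi x != 0 -> `|x - a| < r].
Proof.
move=> r0; pose q (i : 'I_n) (x : 'rV[R]_n) : R := (x ord0 i - a ord0 i) / r.
pose chi x := \prod_(i < n) step (2 - 2 * (q i x * q i x)).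
have oT : open [set: 'rV[R]_n] by exact: openT.
have rn : r != 0 by rewrite gt_eqF.
have qE i x : q i x * q i x = (`|(x - a) ord0 i| / r) ^+ 2.
  by rewrite /q !mxE exprMn real_normK ?num_real // -expr2 exprMn.
exists chi; split.
- have sC (c : R) : smooth_on [set: 'rV[R]_n] (cst c) by exact: smooth_on_cst.
  have sM (f g : 'rV[R]_n -> R) := @smooth_onM _ _ setT f g oT.
  have sq i : smooth_on setT (q i).
    have si : smooth_on setT (fun x : 'rV[R]_n => x ord0 i).
      have := @smooth_on_id R 'rV[R]_n setT.
      by move=> /(@smooth_on_coordP _ _ _ findim_rV _ _ oT) /(_ i).
    exact: (sM _ _ (smooth_onD oT si (sC (- a ord0 i))) (sC r^-1)).
  rewrite /chi; elim: (index_enum _) => [|i s IH].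
    by under eq_fun do rewrite big_nil; exact: sC.
  under eq_fun do rewrite big_cons.
  have s2 : smooth_on setT (fun x => 2 - 2 * (q i x * q i x)).
    rewrite (_ : (fun _ => _) = fun x => 2 + (-2) * (q i x * q i x)).
      exact: (smooth_onD oT (sC 2) (sM _ _ (sC (-2)) (sM _ _ (sq i) (sq i)))).
    by apply/funext => x; rewrite mulNr.
  have s3 : smooth_on setT (fun x => step (2 - 2 * (q i x * q i x))).
    exact: (@smooth_on_comp _ _ _ _ _ _ _ setT setT _ step oT openT _ s2 smooth_step).
  exact: (sM _ _ s3 IH).
- by move=> x; apply: prodr_ge0 => i _; exact: step_ge0.
- move=> x xa; rewrite /chi big1 // => i _; apply: step_ge1; rewrite qE.
  have h : `|(x - a) ord0 i| / r <= 1 / 2.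
    rewrite ler_pdivrMr // mul1r mulrC; apply: le_trans xa.
    by rewrite [leRHS]/Num.Def.normr /= mx_normrE; exact: (le_bigmax _ _ (ord0, i)).
  have h0 : 0 <= `|(x - a) ord0 i| / r by rewrite divr_ge0 // ltW.
  nra.
- move=> x; apply: contraNT; rewrite -leNgt => rx.
  have [i hi] : exists i, r <= `|(x - a) ord0 i|.
    apply: contrapT => /forallNP H; move: rx; apply/negP; rewrite -ltNge.
    rewrite [ltLHS]/Num.Def.normr /= mx_normrE bigmax_lt // => -[j i] _ /=.
    by rewrite ord1 ltNge; apply/negP/H.
  rewrite /chi (bigD1 i) //= step_le0 ?mul0r // qE.
  have : 1 <= `|(x - a) ord0 i| / r by rewrite ler_pdivlMr // mul1r.
  nra.
Qed.

End bump.

(** * Smooth functions on a manifold *)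

Section charts.
Context {R : realType} {M : topologicalType} {V : normedModType R}
  {bV : findim V}.
Variable A : atlas M V.
Hypothesis hA : smooth_atlas A.
Implicit Types (c d : chart M V) (m p : M) (v u : V).

Lemma chart_at_charts m : charts A (chart_at A m).
Proof. by have [_ /(_ m) []] := hA. Qed.

Lemma chart_at_dom m : cdom (chart_at A m) m.
Proof. by have [_ /(_ m) []] := hA. Qed.

Lemma cinvK c m : charts A c -> cdom c m -> cinv c (c m) = m.
Proof. by have [h _ _] := hA; move=> /h [_ _ + _ _]; exact. Qed.

Lemma chart_open_dom c : charts A c -> open (cdom c).
Proof. by have [h _ _] := hA; move=> /h []. Qed.

Lemma chart_dom_nbhs c m : charts A c -> cdom c m -> nbhs m (cdom c).
Proof. by move=> hc cm; apply: open_nbhs_nbhs; split => //; exact: chart_open_dom. Qed.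

Lemma chart_continuous c m : charts A c -> cdom c m -> {for m, continuous c}.
Proof. by have [h _ _] := hA; move=> /h [_ _ _ + _]; exact. Qed.

Lemma cinv_continuous c m : charts A c -> cdom c m -> {for c m, continuous (cinv c)}.
Proof.
by have [h _ _] := hA; move=> /h [_ _ _ _ H] cm; apply: H; exists m.
Qed.

Lemma nbhs_chart c m (P : set M) : charts A c -> cdom c m -> nbhs m P ->
  nbhs (c m) (cinv c @^-1` P).
Proof.
move=> hc cm nP; have C := cinv_continuous hc cm; apply: C.
by rewrite cinvK.
Qed.

Lemma nbhs_cinv c m (P : set V) : charts A c -> cdom c m -> nbhs (c m) P ->
  nbhs m (c @^-1` P).
Proof. by move=> hc cm nP; have C := chart_continuous hc cm; exact: C. Qed.

Lemma chart_image_open c (O : set M) : charts A c -> open O ->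
  open (c @` (cdom c `&` O)).
Proof.
move=> hc oO; have oI : open (c @` cdom c) by have [h _ _] := hA; have [] := h _ hc.
rewrite openE => x [m [cm Om] <-].
have n1 : nbhs (c m) (c @` cdom c) by apply: open_nbhs_nbhs; split=> //; exists m.
have n2 : nbhs (c m) (cinv c @^-1` O).
  by apply: nbhs_chart => //; exact: open_nbhs_nbhs.
apply: filterS2 n1 n2 => y [p cp <-] Op; exists p => //; split=> //.
by move: Op; rewrite /preimage /= cinvK.
Qed.

Lemma chart_preimage_open c (S : set V) : charts A c -> open S ->
  open (cdom c `&` c @^-1` S).
Proof.
move=> hc oS; rewrite openE => m [cm Sm].
apply: filterI; first exact: chart_dom_nbhs.
by apply: nbhs_cinv => //; exact: open_nbhs_nbhs.
Qed.

Section smooth_at.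
Context {W : normedModType R} {bW : findim W}.
Implicit Types (f g : M -> W).

(** Smoothness near a point, tested in a single chart. It spares carrying domains along for
    functions that are smooth only near the diagonal, and it is an open condition on the point. *)
Definition smooth_at (f : M -> W) (m : M) : Prop :=
  exists c, [/\ charts A c, cdom c m &
    exists S, [/\ open S, S (c m) & smooth_on S (f \o cinv c)]].

(** Transition maps are smooth, so the chart in the definition can be exchanged for any chart at
    [m]. The last clause lets each point of [S] be written [d p], where [cinv d] is under
    control. *)
Lemma smooth_at_chart f m d : charts A d -> cdom d m -> smooth_at f m ->
  exists S, [/\ open S, S (d m), smooth_on S (f \o cinv d) &
    S `<=` d @` cdom d].
Proof.
move=> hd dm [c [hc cm [S [oS Sm sf]]]].
pose O := cdom c `&` c @^-1` S.
have oO : open O by exact: chart_preimage_open.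
have oS' := chart_image_open hd oO.
have SS : d @` (cdom d `&` O) `<=` d @` (cdom d `&` cdom c).
  by apply: image_subset => p [dp [cp _]].
exists (d @` (cdom d `&` O)); split=> //; first by exists m.
  have st : smooth_on (d @` (cdom d `&` O)) (c \o cinv d).
    by apply: smooth_on_subset SS _; have [_ _ h] := hA; exact: h.
  have ST x : (d @` (cdom d `&` O)) x -> S ((c \o cinv d) x).
    by move=> [p [dp [_ Sp]] <-]; rewrite /= cinvK.
  pose proof (smooth_on_comp oS' oS ST st sf) as C.
  refine (smooth_on_eq oS' _ C) => x [p [dp [cp Sp]] <-].
  by rewrite /= cinvK // cinvK.
by apply: image_subset => p [].
Qed.

Lemma smooth_at_msmooth f m (O : set M) : open O -> O m -> msmooth A O f ->
  smooth_at f m.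
Proof.
move=> oO Om sf; exists (chart_at A m).
have [hc cm] := (chart_at_charts m, chart_at_dom m); split=> //.
exists (chart_at A m @` (cdom (chart_at A m) `&` O)); split.
- exact: chart_image_open.
- by exists m.
- exact: sf.
Qed.

Lemma msmooth_local f (O : set M) : (forall m, O m -> smooth_at f m) ->
  msmooth A O f.
Proof.
move=> H c hc; apply: smooth_on_local => x [m [cm Om] <-].
by have [S [oS Sm sf _]] := smooth_at_chart hc cm (H m Om); exists S.
Qed.

Lemma smooth_at_near f m : smooth_at f m -> \forall p \near m, smooth_at f p.
Proof.
move=> [c [hc cm [S [oS Sm sf]]]].
have : nbhs m (cdom c `&` c @^-1` S).
  by apply: open_nbhs_nbhs; split => //; exact: chart_preimage_open.
by apply: filterS => p [cp Sp]; exists c; split=> //; exists S.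
Qed.

Lemma smooth_at_eq f g m : (\forall p \near m, f p = g p) -> smooth_at f m ->
  smooth_at g m.
Proof.
move=> fg [c [hc cm [S [oS Sm sf]]]].
have := nbhs_chart hc cm fg; rewrite nbhsE => -[T [oT Tm] TE].
exists c; split=> //; exists (S `&` T); split=> //; first exact: openI.
apply: (@smooth_on_eq _ _ _ _ (f \o cinv c)); first exact: openI.
  by move=> x [_ /TE].
by apply: smooth_on_subset sf => x [].
Qed.

Lemma smooth_at_cst (w : W) m : smooth_at (cst w) m.
Proof.
exists (chart_at A m); split; [exact: chart_at_charts|exact: chart_at_dom|].
exists setT; split; [exact: openT|by []|exact: smooth_on_cst].
Qed.

Lemma smooth_at2 (X : normedModType R) (g : M -> X) f m :
  smooth_at f m ->
  (exists c, [/\ charts A c, cdom c m &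
    exists S, [/\ open S, S (c m) & smooth_on S (g \o cinv c)]]) ->
  exists c, [/\ charts A c, cdom c m & exists S, [/\ open S, S (c m),
    smooth_on S (f \o cinv c) & smooth_on S (g \o cinv c)]].
Proof.
move=> sf [c [hc cm [S [oS Sm sg]]]].
have [S' [oS' Sm' sf' _]] := smooth_at_chart hc cm sf.
exists c; split=> //; exists (S `&` S'); split=> //.
- exact: openI.
- by apply: smooth_on_subset sf' => x [].
- by apply: smooth_on_subset sg => x [].
Qed.

Lemma smooth_atD f g m : smooth_at f m -> smooth_at g m ->
  smooth_at (fun p => f p + g p) m.
Proof.
move=> sf sg; have [c [hc cm [S [oS Sm sf' sg']]]] := smooth_at2 sf sg.
by exists c; split=> //; exists S; split=> //; exact: (smooth_onD oS sf' sg').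
Qed.

Lemma smooth_at_sum (I : Type) (r : seq I) (F : I -> M -> W) m :
  (forall i, smooth_at (F i) m) -> smooth_at (fun p => \sum_(i <- r) F i p) m.
Proof.
move=> sF; elim: r => [|i r IH].
  by under eq_fun do rewrite big_nil; exact: smooth_at_cst.
by under eq_fun do rewrite big_cons; exact: smooth_atD.
Qed.

Lemma smooth_at_derivable f m c v : smooth_at f m -> charts A c -> cdom c m ->
  derivable (f \o cinv c) (c m) v.
Proof.
move=> sf hc cm; have [S [oS Sm sf' _]] := smooth_at_chart hc cm sf.
by have [] := smooth_on_is_derive v sf' Sm.
Qed.

Lemma smooth_at_differentiable f m c : smooth_at f m -> charts A c -> cdom c m ->
  differentiable (f \o cinv c) (c m).
Proof.
move=> sf hc cm; have [S [oS Sm sf' _]] := smooth_at_chart hc cm sf.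
exact: smooth_on_differentiable sf' Sm.
Qed.

Lemma smooth_at_continuous f m : smooth_at f m -> {for m, continuous f}.
Proof.
move=> [c [hc cm [S [oS Sm sf]]]].
have h1 := smooth_on_continuous sf Sm.
have h2 : {for m, continuous ((f \o cinv c) \o c)}.
  by apply: continuous_comp => //; exact: chart_continuous.
apply: near_eq_continuous h2; apply: filterS (chart_dom_nbhs hc cm) => p cp.
by rewrite /= cinvK.
Qed.

End smooth_at.

Lemma smooth_atM (f g : M -> R) m : smooth_at f m -> smooth_at g m ->
  smooth_at (fun p => f p * g p) m.
Proof.
move=> sf sg; have [c [hc cm [S [oS Sm sf' sg']]]] := smooth_at2 (bW := findim_scalar R) sf sg.
exists c; split; [exact: hc|exact: cm|exists S; split; [exact: oS|exact: Sm|]].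
exact: (smooth_onM oS sf' sg').
Qed.

Lemma smooth_atV (f : M -> R) m : smooth_at f m -> f m != 0 ->
  smooth_at (fun p => (f p)^-1) m.
Proof.
move=> [c [hc cm [S [oS Sm sf]]]] fm.
pose T := S `&` (f \o cinv c) @^-1` [set r | r != 0].
have oT : open T.
  rewrite openE => x [Sx fx]; apply: filterI; first exact: open_nbhs_nbhs.
  have C := smooth_on_continuous sf Sx; apply: C.
  by apply: open_nbhs_nbhs; split=> //; exact: open_neq.
exists c; split; [exact: hc|exact: cm|exists T; split; first exact: oT].
  by split=> //; rewrite /= cinvK.
have sfT : smooth_on T (f \o cinv c) by apply: smooth_on_subset sf => x [].
by apply: (@smooth_onV _ _ T (f \o cinv c) oT _ sfT) => x [].
Qed.

Lemma smooth_at_chart_map c m : charts A c -> cdom c m -> smooth_at (c : M -> V) m.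
Proof.
move=> hc cm; exists c; split=> //; exists (c @` cdom c); split.
- by have [h _ _] := hA; have [] := h _ hc.
- by exists m.
- by have [_ _ /(_ c c hc hc)] := hA; rewrite setIid.
Qed.

Lemma near_cinvK c m : charts A c -> cdom c m ->
  \forall x \near c m, c (cinv c x) = x.
Proof.
move=> hc cm; have oI : open (c @` cdom c) by have [h _ _] := hA; have [] := h _ hc.
have n1 : nbhs (c m) (c @` cdom c) by apply: open_nbhs_nbhs; split=> //; exists m.
by apply: filterS n1 => _ [p cp <-]; rewrite cinvK.
Qed.

Lemma derive_chart_self c m v : charts A c -> cdom c m ->
  'D_v (c \o cinv c) (c m) = v.
Proof.
move=> hc cm; rewrite (near_eq_derive (g := id)) ?derive_id //.
exact: near_cinvK.
Qed.

Section change.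
Context {W : normedModType R} {bW : findim W}.
Implicit Types (f : M -> W).

(** The chain rule for the transition map [c \o cinv d], whose derivative carries components of
    tangent vectors from [d] to [c]. *)
Lemma derive_change f m c d v : smooth_at f m -> charts A c -> cdom c m ->
  charts A d -> cdom d m ->
  'D_v (f \o cinv d) (d m) = 'D_('D_v (c \o cinv d) (d m)) (f \o cinv c) (c m).
Proof.
move=> sf hc cm hd dm.
rewrite (near_eq_derive (g := (f \o cinv c) \o (c \o cinv d))); last first.
  have := nbhs_chart hd dm (chart_dom_nbhs hc cm); apply: filterS => x cx.
  by rewrite /= cinvK.
have d1 : differentiable (c \o cinv d) (d m).
  by apply: smooth_at_differentiable => //; exact: smooth_at_chart_map.
have d2 : differentiable (f \o cinv c) ((c \o cinv d) (d m)).
  by rewrite /= cinvK //; exact: smooth_at_differentiable.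
by have [_ ->] := chain_rule v d1 d2; rewrite /= cinvK.
Qed.

Lemma dird_chartE f m c u : smooth_at f m -> charts A c -> cdom c m ->
  dird A f m u = 'D_(dird A c m u) (f \o cinv c) (c m).
Proof.
move=> sf hc cm.
exact: (derive_change _ sf hc cm (chart_at_charts m) (chart_at_dom m)).
Qed.

Lemma dird_frame f m c v : smooth_at f m -> charts A c -> cdom c m ->
  dird A f m (frame A c v m) = 'D_v (f \o cinv c) (c m).
Proof.
move=> sf hc cm; rewrite /dird /frame.
by rewrite [RHS](derive_change _ sf (chart_at_charts m) (chart_at_dom m) hc cm).
Qed.

Lemma dird_linear f m : smooth_at f m -> linear (dird A f m).
Proof.
move=> sf a u v; have df : differentiable (f \o cinv (chart_at A m)) (chart_at A m m).
  by apply: smooth_at_differentiable => //; [exact: chart_at_charts|exact: chart_at_dom].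
by rewrite /dird !deriveE // linearP.
Qed.

End change.

Lemma dird_chart_at m u : dird A (chart_at A m) m u = u.
Proof.
by apply: derive_chart_self; [exact: chart_at_charts|exact: chart_at_dom].
Qed.

Lemma frame_dird c m u : charts A c -> cdom c m -> frame A c (dird A c m u) m = u.
Proof.
move=> hc cm; rewrite -[RHS](dird_chart_at m u); apply/esym/dird_chartE => //.
by apply: smooth_at_chart_map; [exact: chart_at_charts|exact: chart_at_dom].
Qed.

Lemma frame_chart_at m v : frame A (chart_at A m) v m = v.
Proof.
by apply: derive_chart_self; [exact: chart_at_charts|exact: chart_at_dom].
Qed.

Lemma vector_field_smooth_at X c m : vector_field A X -> charts A c -> cdom c m ->
  smooth_at (lie A X c) m.
Proof.
move=> hX hc cm; apply: (smooth_at_msmooth (O := cdom c)) => //.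
  exact: chart_open_dom.
exact: hX.
Qed.

(** In the chart [c], the derivative of [f] along [X] is the sum of the components of [X] times the
    partial derivatives of [f]. *)
Lemma smooth_at_lie (f : M -> R) X m c : charts A c -> cdom c m ->
  smooth_at (lie A X c) m -> smooth_at f m -> smooth_at (lie A X f) m.
Proof.
move=> hc cm sX sf.
have [S [oS Sm sX' SI]] := smooth_at_chart (bW := bV) hc cm sX.
have [T [oT Tm sf' _]] := smooth_at_chart (bW := findim_scalar R) hc cm sf.
have oU : open (S `&` T) by exact: openI.
have sX2 : smooth_on (S `&` T) (lie A X c \o cinv c).
  by apply: smooth_on_subset sX' => x [].
have sf2 i : smooth_on (S `&` T) ('D_(fde i) (f \o cinv c)).
  by apply: smooth_on_subset (smooth_on_derive (fde i) sf') => x [].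
exists c; split; [exact: hc|exact: cm|].
exists (S `&` T); split; [exact: oU|by []|].
have sX3 i : smooth_on (S `&` T) (fun x => fdl i (lie A X c (cinv c x))).
  exact: (proj1 (smooth_on_coordP _ oU) sX2 i).
apply: (@smooth_on_eq _ _ _ _ (fun x => \sum_(i : fdI V)
  fdl i (lie A X c (cinv c x)) * 'D_(fde i) (f \o cinv c) x) _ oU); last first.
  apply: (@smooth_on_sum _ _ _ _ _ _ (fun i x => fdl i (lie A X c (cinv c x)) *
    'D_(fde i) (f \o cinv c) x) oU) => i.
  exact: (smooth_onM oU (sX3 i) (sf2 i)).
move=> x [Sx Tx]; have [p cp E] := SI _ Sx.
have sfp : smooth_at f p.
  exists c; split; [exact: hc|exact: cp|exists T; split; rewrite ?E //; exact: sf'].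
have df : differentiable (f \o cinv c) x by rewrite -E; exact: smooth_at_differentiable.
rewrite /= -(derive_coord _ df) -E cinvK // [RHS]/lie (dird_chartE _ sfp hc cp) //.
Qed.

End charts.

Section dird_algebra.
Context {R : realType} {M : topologicalType} {V : normedModType R}
  {bV : findim V}.
Variable A : atlas M V.
Hypothesis hA : smooth_atlas A.
Implicit Types (f g : M -> R) (m : M) (u : V).

Lemma dird_near_eq (W : normedModType R) (f g : M -> W) m u :
  (\forall p \near m, f p = g p) -> dird A f m u = dird A g m u.
Proof.
move=> fg; apply: near_eq_derive.
by have := nbhs_chart hA (chart_at_charts hA m) (chart_at_dom hA m) fg.
Qed.

Lemma is_derive_dird f m u : smooth_at A f m ->
  is_derive (chart_at A m m) u (f \o cinv (chart_at A m)) (dird A f m u).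
Proof.
move=> sf; split => //.
exact: (smooth_at_derivable hA sf (chart_at_charts hA m) (chart_at_dom hA m)).
Qed.

Lemma dirdD f g m u : smooth_at A f m -> smooth_at A g m ->
  dird A (fun p => f p + g p) m u = dird A f m u + dird A g m u.
Proof.
move=> sf sg.
by have [_] := is_deriveD (is_derive_dird u sf) (is_derive_dird u sg).
Qed.

Lemma dirdM f g m u : smooth_at A f m -> smooth_at A g m ->
  dird A (fun p => f p * g p) m u = f m * dird A g m u + g m * dird A f m u.
Proof.
move=> sf sg.
have [_] := is_derive_mul (is_derive_dird u sf) (is_derive_dird u sg).
by rewrite /= (cinvK hA (chart_at_charts hA m) (chart_at_dom hA m)).
Qed.

Lemma dird_cst (a : R) m u : dird A (cst a) m u = 0.
Proof. exact: derive_cst. Qed.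

Lemma dirdZ (a : R) f m u : smooth_at A f m ->
  dird A (fun p => a * f p) m u = a * dird A f m u.
Proof.
move=> sf; have sa : smooth_at A (cst a) m by exact: smooth_at_cst.
by have := dirdM u sa sf; rewrite dird_cst mulr0 addr0.
Qed.

(** Both conclusions are proved together because the induction step for the formula uses smoothness
    of the remaining sum. Smoothness is asked only of indices in [r]: in the gluing, the other
    pieces need not be smooth at the point. *)
Lemma dird_sum (I : eqType) (r : seq I) (F : I -> M -> R) m u :
  (forall i, i \in r -> smooth_at A (F i) m) ->
  smooth_at A (fun p => \sum_(i <- r) F i p) m /\
  dird A (fun p => \sum_(i <- r) F i p) m u = \sum_(i <- r) dird A (F i) m u.
Proof.
elim: r => [|i r IH] H.
  under eq_fun do rewrite big_nil; rewrite big_nil; split; last exact: dird_cst.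
  exact: smooth_at_cst.
have [|s1 E1] := IH; first by move=> j jr; apply: H; rewrite inE jr orbT.
have s2 : smooth_at A (F i) m by apply: H; rewrite inE eqxx.
under eq_fun do rewrite big_cons; rewrite big_cons; split.
  exact: (smooth_atD hA s2 s1).
by rewrite (dirdD u s2 s1) E1.
Qed.

End dird_algebra.

(** * Products of manifolds *)

Section products.
Context {R : realType} {M N : topologicalType} {V W : normedModType R}
  {bV : findim V} {bW : findim W}.
Variables (A : atlas M V) (B : atlas N W).
Hypotheses (hA : smooth_atlas A) (hB : smooth_atlas B).

Lemma continuous_prod_map (S T S' T' : topologicalType) (f : S -> S') (g : T -> T')
    (p : S * T) : {for p.1, continuous f} -> {for p.2, continuous g} ->
  {for p, continuous (fun p => (f p.1, g p.2))}.
Proof.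
case: p => s t cf cg; apply: cvg_pair => /=.
  have c1 : {for (s, t), continuous (@fst S T)} by exact: cvg_fst.
  exact: (continuous_comp c1 cf).
have c2 : {for (s, t), continuous (@snd S T)} by exact: cvg_snd.
exact: (continuous_comp c2 cg).
Qed.

Lemma open_setX (S T : topologicalType) (P : set S) (Q : set T) :
  open P -> open Q -> open (P `*` Q).
Proof.
move=> oP oQ; rewrite openE => -[s t] [/= Ps Qt].
by exists (P, Q) => //=; split; exact: open_nbhs_nbhs.
Qed.

Lemma smooth_atlas_prod : smooth_atlas (prod_atlas A B).
Proof.
split.
- move=> _ [c [d [hc hd ->]]].
  have [hA1 _ _] := hA; have [hB1 _ _] := hB.
  have [oc oi Kc cc ccv] := hA1 _ hc; have [od oj Kd cd cdv] := hB1 _ hd.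
  have E : prod_chart c d @` (cdom c `*` cdom d) = (c @` cdom c) `*` (d @` cdom d).
    apply/seteqP; split.
      by move=> _ [[m n] [/= cm dn] <-]; split => /=; [exists m|exists n].
    by move=> [x y] [/= [m cm <-] [n dn <-]]; exists (m, n).
  split.
  + exact: open_setX.
  + by have := open_setX oi oj; rewrite -E.
  + by move=> [m n] [/= cm dn]; rewrite Kc ?Kd.
  + by move=> p [cp dp]; apply: continuous_prod_map; [exact: cc|exact: cd].
  + move=> p; have -> : (prod_chart c d @` cdom (prod_chart c d)) p = 
      ((c @` cdom c) `*` (d @` cdom d)) p by rewrite -E.
    by move=> [cp dp]; apply: continuous_prod_map; [exact: ccv|exact: cdv].
- move=> [m n]; split; last by split; [exact: chart_at_dom|exact: chart_at_dom].
  by exists (chart_at A m), (chart_at B n); split=> //; exact: chart_at_charts.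
- move=> _ _ [c [d [hc hd ->]]] [c' [d' [hc' hd' ->]]].
  set S := _ @` _.
  have ES : S = (c @` (cdom c `&` cdom c')) `*` (d @` (cdom d `&` cdom d')).
    apply/seteqP; split.
      by move=> _ [[m n] [[/= cm dn] [/= cm' dn']] <-]; split => /=; [exists m|exists n].
    by move=> [x y] [/= [m [cm cm'] <-] [n [dn dn'] <-]]; exists (m, n).
  have o1 : open (c @` (cdom c `&` cdom c')).
    by apply: (chart_image_open hA hc); exact: (chart_open_dom hA).
  have o2 : open (d @` (cdom d `&` cdom d')).
    by apply: (chart_image_open hB hd); exact: (chart_open_dom hB).
  have oS : open S by rewrite ES; exact: open_setX.
  have [_ _ tA] := hA; have [_ _ tB] := hB.
  have s1 : smooth_on S ((c' \o cinv c) \o fst).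
    refine (smooth_on_comp oS o1 _ (@smooth_on_fst _ _ _ _) (tA _ _ hc hc')).
    by rewrite ES => x [].
  have s2 : smooth_on S ((d' \o cinv d) \o snd).
    refine (smooth_on_comp oS o2 _ (@smooth_on_snd _ _ _ _) (tB _ _ hd hd')).
    by rewrite ES => x [].
  exact: (smooth_on_pair oS s1 s2).
Qed.

Lemma smooth_at_fst (X : normedModType R) {bX : findim X} (f : M -> X) m n :
  smooth_at A f m -> smooth_at (prod_atlas A B) (fun p => f p.1) (m, n).
Proof.
move=> [c [hc cm [S [oS Sm sf]]]].
exists (prod_chart c (chart_at B n)); split.
- by exists c, (chart_at B n); split => //; exact: chart_at_charts.
- by split=> //; exact: chart_at_dom.
have oS2 : open (S `*` [set: W]) by apply: open_setX => //; exact: openT.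
exists (S `*` setT); split=> //.
by refine (smooth_on_comp oS2 oS _ (@smooth_on_fst _ _ _ _) sf) => x [].
Qed.

Lemma smooth_at_snd (X : normedModType R) {bX : findim X} (f : N -> X) m n :
  smooth_at B f n -> smooth_at (prod_atlas A B) (fun p => f p.2) (m, n).
Proof.
move=> [d [hd dn [S [oS Sn sf]]]].
exists (prod_chart (chart_at A m) d); split.
- by exists (chart_at A m), d; split => //; exact: chart_at_charts.
- by split=> //; exact: chart_at_dom.
have oS2 : open ([set: V] `*` S) by apply: open_setX => //; exact: openT.
exists (setT `*` S); split=> //.
by refine (smooth_on_comp oS2 oS _ (@smooth_on_snd _ _ _ _) sf) => x [].
Qed.

Lemma prod_chart_at (c : chart M V) (d : chart N W) : charts A c -> charts B d ->
  charts (prod_atlas A B) (prod_chart c d).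
Proof. by move=> hc hd; exists c, d. Qed.

Lemma smooth_on_pair_cst_r (S : set V) (y : W) : open S ->
  smooth_on S (fun x : V => (x, y)).
Proof.
by move=> oS; exact: (smooth_on_pair oS (@smooth_on_id _ _ _) (@smooth_on_cst _ _ _ _ y)).
Qed.

Lemma smooth_on_pair_cst_l (S : set W) (x : V) : open S ->
  smooth_on S (fun y : W => (x, y)).
Proof.
by move=> oS; exact: (smooth_on_pair oS (@smooth_on_cst _ _ _ _ x) (@smooth_on_id _ _ _)).
Qed.

Lemma open_slice_l (S : set (V * W)) y : open S -> open [set x | S (x, y)].
Proof.
move=> oS; rewrite openE => x Sxy.
have /= C : {for x, continuous (fun x : V => (x, y))}.
  by apply: cvg_pair; [exact: cvg_id|exact: cvg_cst].
by apply: C; exact: open_nbhs_nbhs.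
Qed.

Lemma open_slice_r (S : set (V * W)) x : open S -> open [set y | S (x, y)].
Proof.
move=> oS; rewrite openE => y Sxy.
have /= C : {for y, continuous (fun y : W => (x, y))}.
  by apply: cvg_pair; [exact: cvg_cst|exact: cvg_id].
by apply: C; exact: open_nbhs_nbhs.
Qed.

Section slices.
Context {X : normedModType R} {bX : findim X}.
Implicit Types (G : M * N -> X).

Lemma smooth_at_slice_l G m n : smooth_at (prod_atlas A B) G (m, n) ->
  smooth_at A (fun p => G (p, n)) m.
Proof.
move=> [_ [[c [d [hc hd ->]]] [/= cm dn] [S [oS Sm sG]]]].
have oS' := open_slice_l (d n) oS.
exists c; split=> //; exists [set x | S (x, d n)]; split=> //.
have E x : ((G \o cinv (prod_chart c d)) \o (fun x => (x, d n))) x =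
    G (cinv c x, n) by rewrite /= (cinvK hB hd dn).
rewrite (_ : _ \o _ = (G \o cinv (prod_chart c d)) \o (fun x => (x, d n))).
  by refine (smooth_on_comp oS' oS _ (@smooth_on_pair_cst_r _ _ oS') sG).
by apply/funext => x; rewrite E.
Qed.

Lemma smooth_at_slice_r G m n : smooth_at (prod_atlas A B) G (m, n) ->
  smooth_at B (fun q => G (m, q)) n.
Proof.
move=> [_ [[c [d [hc hd ->]]] [/= cm dn] [S [oS Sm sG]]]].
have oS' := open_slice_r (c m) oS.
exists d; split=> //; exists [set y | S (c m, y)]; split=> //.
have E y : ((G \o cinv (prod_chart c d)) \o (fun y => (c m, y))) y =
    G (m, cinv d y) by rewrite /= (cinvK hA hc cm).
rewrite (_ : _ \o _ = (G \o cinv (prod_chart c d)) \o (fun y => (c m, y))).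
  by refine (smooth_on_comp oS' oS _ (@smooth_on_pair_cst_l _ _ oS') sG).
by apply/funext => y; rewrite E.
Qed.

(** The two difference quotients are the same function of the increment, so the equality holds
    without differentiability. *)
Lemma derive_slice_l (F : V * W -> X) (x v : V) (y : W) :
  'D_v (fun x => F (x, y)) x = 'D_(v, 0) F (x, y).
Proof.
rewrite /derive; set F1 := (X in lim (X @ _)); set F2 := (X in _ = lim (X @ _)).
suff -> : F1 = F2 by [].
apply/funext => h; rewrite /F1 /F2 /=; congr (_ *: (F _ - _)).
by rewrite -[RHS]/(h *: v + x, h *: (0 : W) + y) scaler0 add0r.
Qed.

Lemma derive_slice_r (F : V * W -> X) (x : V) (y w : W) :
  'D_w (fun y => F (x, y)) y = 'D_(0, w) F (x, y).
Proof.
rewrite /derive; set F1 := (X in lim (X @ _)); set F2 := (X in _ = lim (X @ _)).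
suff -> : F1 = F2 by [].
apply/funext => h; rewrite /F1 /F2 /=; congr (_ *: (F _ - _)).
by rewrite -[RHS]/(h *: (0 : V) + x, h *: w + y) scaler0 add0r.
Qed.

Lemma dird_slice_l G m n v :
  dird (prod_atlas A B) G (m, n) (v, 0) = dird A (fun p => G (p, n)) m v.
Proof.
rewrite /dird /= -derive_slice_l; congr ('D_v _ _); apply/funext => x /=.
by rewrite (cinvK hB (chart_at_charts hB n) (chart_at_dom hB n)).
Qed.

Lemma dird_slice_r G m n w :
  dird (prod_atlas A B) G (m, n) (0, w) = dird B (fun q => G (m, q)) n w.
Proof.
rewrite /dird /= -derive_slice_r; congr ('D_w _ _); apply/funext => x /=.
by rewrite (cinvK hA (chart_at_charts hA m) (chart_at_dom hA m)).
Qed.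

Lemma dird_frame_l G m n c d v : smooth_at (prod_atlas A B) G (m, n) ->
  charts A c -> cdom c m -> charts B d -> cdom d n ->
  dird A (fun p => G (p, n)) m (frame A c v m) =
  'D_(v, 0) (G \o cinv (prod_chart c d)) (c m, d n).
Proof.
move=> sG hc cm hd dn; rewrite (dird_frame hA v (smooth_at_slice_l sG) hc cm).
rewrite -derive_slice_l; congr ('D_v _ _); apply/funext => x /=.
by rewrite (cinvK hB hd dn).
Qed.

Lemma dird_frame_r G m n c d w : smooth_at (prod_atlas A B) G (m, n) ->
  charts A c -> cdom c m -> charts B d -> cdom d n ->
  dird B (fun q => G (m, q)) n (frame B d w n) =
  'D_(0, w) (G \o cinv (prod_chart c d)) (c m, d n).
Proof.
move=> sG hc cm hd dn; rewrite (dird_frame hB w (smooth_at_slice_r sG) hd dn).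
rewrite -derive_slice_r; congr ('D_w _ _); apply/funext => x /=.
by rewrite (cinvK hA hc cm).
Qed.

(** Frames have constant components, so in a product chart this is a derivative of the expression of
    [G] in a constant direction. *)
Lemma smooth_at_frame_l G m n c v : smooth_at (prod_atlas A B) G (m, n) ->
  charts A c -> cdom c m ->
  smooth_at (prod_atlas A B) (fun p => dird A (fun q => G (q, p.2)) p.1
                                (frame A c v p.1)) (m, n).
Proof.
move=> sG hc cm; pose d := chart_at B n.
have hd : charts B d := chart_at_charts hB n.
have dn : cdom d n := chart_at_dom hB n.
have hcd := prod_chart_at hc hd.
have cd : cdom (prod_chart c d) (m, n) by split.
destruct (smooth_at_chart (d := prod_chart c d) smooth_atlas_prod hcd cd sG)
  as [S [oS Sm sG' SI]].
exists (prod_chart c d); split=> //; exists S; split=> //.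
refine (smooth_on_eq oS _ (smooth_on_derive (v, 0) sG')).
move=> z Sz; have [[p q] [/= cp dq] E] := SI _ Sz; subst z.
rewrite /= !(cinvK hA hc cp) !(cinvK hB hd dq); apply/esym/dird_frame_l => //.
by exists (prod_chart c d); split=> //; exists S.
Qed.

Lemma smooth_at_frame_r G m n d w : smooth_at (prod_atlas A B) G (m, n) ->
  charts B d -> cdom d n ->
  smooth_at (prod_atlas A B) (fun p => dird B (fun q => G (p.1, q)) p.2
                                (frame B d w p.2)) (m, n).
Proof.
move=> sG hd dn; pose c := chart_at A m.
have hc : charts A c := chart_at_charts hA m.
have cm : cdom c m := chart_at_dom hA m.
have hcd := prod_chart_at hc hd.
have cd : cdom (prod_chart c d) (m, n) by split.
destruct (smooth_at_chart (d := prod_chart c d) smooth_atlas_prod hcd cd sG)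
  as [S [oS Sm sG' SI]].
exists (prod_chart c d); split=> //; exists S; split=> //.
refine (smooth_on_eq oS _ (smooth_on_derive (0, w) sG')).
move=> z Sz; have [[p q] [/= cp dq] E] := SI _ Sz; subst z.
rewrite /= !(cinvK hA hc cp) !(cinvK hB hd dq); apply/esym/dird_frame_r => //.
by exists (prod_chart c d); split=> //; exists S.
Qed.

End slices.
End products.

(** * Partitions of unity *)

Section bumps.
Context {R : realType} {n : nat} {M : topologicalType}.
Variable A : atlas M 'rV[R]_n.
Hypotheses (hA : smooth_atlas A) (hM : hausdorff_space M).

Lemma compact_ball_rV (a : 'rV[R]_n) (r : R) : compact [set x | `|x - a| <= r].
Proof.
apply: bounded_closed_compact.
  exists (`|a| + r); split; first exact: num_real.
  move=> s rs x /= xa; apply: le_trans (ltW rs).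
  by rewrite -[x](subrK a) addrC (le_trans (ler_normD _ _)) // lerD2l.
have -> : [set x | `|x - a| <= r] = closed_ball_ Num.norm a r.
  by apply/seteqP; split => x; rewrite /closed_ball_ /= distrC.
exact: closed_closed_ball_.
Qed.

(** The bump of the model space is transported by the chart and extended by zero. [K] is compact,
    hence closed as [M] is Hausdorff, so a point outside the chart has a neighbourhood that misses
    [K]: this is what makes the extension smooth there. *)
Lemma chart_bump (m : M) (O : set M) : open O -> O m ->
  exists b : M -> R, exists K : set M,
    [/\ (forall p, smooth_at A b p) /\ (forall p, 0 <= b p),
        \forall p \near m, b p = 1,
        forall p, b p != 0 -> K p,
        compact K /\ closed K &
        K `<=` O `&` cdom (chart_at A m)].
Proof.
move=> oO Om; pose c := chart_at A m.
have hc : charts A c := chart_at_charts hA m.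
have cm : cdom c m := chart_at_dom hA m.
have : nbhs (c m) (c @` (cdom c `&` O)).
  apply: open_nbhs_nbhs; split; first exact: (chart_image_open hA hc oO).
  by exists m.
move=> /nbhs_ballP[d /= d0 dO].
pose r := d / 2; have r0 : 0 < r by rewrite divr_gt0.
have rO x : `|x - c m| <= r -> (c @` (cdom c `&` O)) x.
  move=> xr; apply: dO; rewrite -ball_normE /ball_ /= distrC.
  by apply: le_lt_trans xr _; rewrite /r ltr_pdivrMr // mulr2n mulrDr mulr1 ltrDl.
have [chi [schi chi0 chi1 chiN]] := bump_rV (c m) r0.
pose b p := if `[< cdom c p >] then chi (c p) else 0.
pose K := cinv c @` [set x | `|x - c m| <= r].
have cK : compact K.
  apply: continuous_compact; last exact: compact_ball_rV.
  apply: continuous_in_subspaceT => x; rewrite inE => /rO [p [cp _] <-].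
  exact: (cinv_continuous hA hc cp).
have clK : closed K by apply: compact_closed.
have bK p : b p != 0 -> K p.
  rewrite /b; case: asboolP => [cp|]; last by rewrite eqxx.
  by move=> /chiN cpr; exists (c p); [exact: ltW|exact: (cinvK hA)].
have KO : K `<=` O `&` cdom c.
  by move=> _ [x /rO [p [cp Op] <-] <-]; rewrite (cinvK hA hc cp).
exists b, K; split=> //; first split.
- move=> p; have [cp|ncp] := pselect (cdom c p).
    exists c; split=> //; exists (c @` cdom c).
    have oI : open (c @` cdom c) by have [h _ _] := hA; have [] := h _ hc.
    split=> //; first by exists p.
    have schi' : smooth_on (c @` cdom c) chi by exact: smooth_on_subset schi.
    refine (smooth_on_eq oI _ schi') => _ [q cq <-].
    by rewrite /= (cinvK hA hc cq) /b asboolT.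
  apply: (@smooth_at_eq _ _ _ _ hA _ (cst 0)); last exact: (smooth_at_cst hA).
  have nK : ~ K p by move=> /KO [].
  have : nbhs p (~` K) by apply: open_nbhs_nbhs; split=> //; exact: closed_openC.
  by apply: filterS => q nKq; apply/esym/eqP; apply: contrapT => /negP /bK.
- by move=> p; rewrite /b; case: asboolP.
- have n1 := chart_dom_nbhs hA hc cm.
  have n2 : nbhs (c m) [set x | `|x - c m| <= r / 2].
    apply/nbhs_ballP; exists (r / 2); first by rewrite /= divr_gt0.
    by move=> x; rewrite -ball_normE /ball_ /= distrC => /ltW.
  apply: filterS2 n1 (nbhs_cinv hA hc cm n2) => p cp.
  by rewrite /preimage /= => /chi1; rewrite /b asboolT.
Qed.

(* Paracompactness is used twice, which avoids the shrinking lemma: first for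
   a locally finite cover [B] by sets contained in compact sets, then for a
   locally finite refinement [B'] of a cover by positivity sets of bumps, each
   supported in a member of [B].  A set contained in a compact set meets only
   finitely many members of [B'], so the supports are locally finite. *)
Lemma partition_of_unity : paracompact M ->
  exists J : set M, exists b : M -> M -> R, exists K : M -> set M,
  [/\ (forall x p, smooth_at A (b x) p) /\ (forall x p, 0 <= b x p),
      forall x p, b x p != 0 -> K x p,
      forall x, closed (K x) /\ K x `<=` cdom (chart_at A x),
      forall p, exists2 x, J x & b x p != 0 &
      forall p : M, exists2 N : set M, nbhs p N &
        finite_set [set x | J x /\ K x `&` N !=set0]].
Proof.
(* The equivalence of the two notions of compactness is applied in a pointed space, so the empty
   manifold is set apart. The point [x0] is also the junk value of [z] below. *)
move=> pcM; have [[x0 _]|noM] := pselect (exists x : M, True); last first.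
  exists set0, (fun _ _ => 0), (fun=> set0).
  have no (T : Prop) (x : M) : T by exfalso; apply: noM; exists x.
  by split; [split=> x; exact: no|move=> x; exact: no..].
pose pM : ptopologicalType := HB.pack (Topological.sort M) M (isPointed.Build M x0).
(* The conditions on [O] stand under the existential so that [choice] applies to all points at
   once. *)
have bump x (O : set M) : exists bK : (M -> R) * set M, open O -> O x ->
    [/\ (forall p, smooth_at A bK.1 p) /\ (forall p, 0 <= bK.1 p),
        bK.1 x = 1, forall p, bK.1 p != 0 -> bK.2 p,
        compact bK.2 /\ closed bK.2 & bK.2 `<=` O `&` cdom (chart_at A x)].
  have [[oO Ox]|no] := pselect (open O /\ O x); last first.
    by exists (fun=> 0, set0) => oO Ox; exfalso; apply: no.
  have [b [K [h1 h2 h3 h4 h5]]] := chart_bump oO Ox.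
  by exists (b, K) => _ _; split => //=; exact: nbhs_singleton h2.
have open_pos x (O : set M) (b : M -> R) : (forall p, smooth_at A b p) ->
    open [set p | b p != 0].
  move=> sb; rewrite openE => p bp.
  have C : {for p, continuous b} := smooth_at_continuous hA (sb p).
  have n0 : nbhs (b p) [set r : R | r != 0].
    by apply: open_nbhs_nbhs; split=> //; exact: open_neq.
  exact: (C _ n0).
have [B [oB cB kB lB]] : exists B : set (set M), [/\ forall U, B U -> open U,
    \bigcup_(U in B) U = setT,
    forall U, B U -> exists2 K, compact K & U `<=` K &
    forall x : M, exists2 N : set M, nbhs x N & finite_set [set U | B U /\ U `&` N !=set0]].
  have [||B [oB cB rB lB]] := pcM [set U | open U /\ exists2 K, compact K & U `<=` K].
  - by move=> U [].
  - apply/seteqP; split=> // x _.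
    have [[b K] /= H] := bump x setT.
    have [[sb _] bx bK [cK _] _] := H openT I.
    exists [set p | b p != 0]; last by rewrite /= bx oner_neq0.
    by split; [exact: open_pos|exists K].
  - exists B; split=> // U /rB [U' [_ [K cK UK]] UU'].
    by exists K => //; apply: subset_trans UU' UK.
have [u Bu] : {u : M -> set M & forall x, B (u x) /\ u x x}.
  apply: (@choice _ _ (fun x U => B U /\ U x)) => x.
  have : (\bigcup_(U in B) U) x by rewrite cB.
  by move=> [U BU Ux]; exists U.
have [bK HbK] := choice (fun x => bump x (u x)).
have {}HbK x := HbK x (oB _ (Bu x).1) (Bu x).2.
have sb x : forall p, smooth_at A (bK x).1 p by have [[]] := HbK x.
have [||B' [oB' cB' rB' lB']] :=
  pcM [set U | exists x, U = [set p | (bK x).1 p != 0]].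
- by move=> U [x ->]; exact: open_pos.
- apply/seteqP; split=> // x _; exists [set p | (bK x).1 p != 0]; first by exists x.
  by have [_ bx _ _ _] := HbK x; rewrite /= bx oner_neq0.
have [z zP] : {z : set M -> M & forall U, B' U -> U `<=` [set p | (bK (z U)).1 p != 0]}.
  apply: (@choice _ _ (fun U x => B' U -> U `<=` [set p | (bK x).1 p != 0])) => U.
  have [BU|nBU] := pselect (B' U).
    by have [U' [x ->] UU] := rB' _ BU; exists x.
  by exists x0 => /nBU.
(* Bumps are indexed by their centres, and several members of [B'] may share one. Empty members are
   discarded since they say nothing about where the support of their bump lies. *)
exists (z @` [set U | B' U /\ U !=set0]), (fun x => (bK x).1), (fun x => (bK x).2).
split.
- by split=> x; have [[]] := HbK x.
- by move=> x; have [] := HbK x.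
- move=> x; have [_ _ _ [_ cK] KO] := HbK x; split=> //.
  by move=> p /KO [].
- move=> p; have : (\bigcup_(U in B') U) p by rewrite cB'.
  move=> [U BU Up]; exists (z U); last exact: zP BU _ Up.
  by exists U => //; split => //; exists p.
- move=> p; have [N nN fN] := lB p; exists N => //.
  have fin U : B U -> finite_set [set U' | B' U' /\ U' `&` U !=set0].
    move=> /kB [K cK UK].
    have [N' HN'] : {N' : M -> set M & forall q, nbhs q (N' q) /\
        finite_set [set U | B' U /\ U `&` N' q !=set0]}.
      apply: (@choice _ _ (fun q N => nbhs q N /\
        finite_set [set U | B' U /\ U `&` N !=set0])) => q.
      by have [N' h1 h2] := lB' q; exists N'.
    have : @cover_compact pM K by rewrite -compact_cover.
    move=> /(_ M setT (fun q => interior (N' q))) [].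
    + by move=> q _; exact: open_interior.
    + by move=> q _; exists q => //; have [] := HN' q.
    move=> D' _ KD'; have fD' : finite_set [set` D'] by exact: finite_fset.
    have fU : finite_set (\bigcup_(q in [set` D'])
        [set U' | B' U' /\ U' `&` N' q !=set0]).
      by apply: bigcup_finite => // q _; have [] := HN' q.
    apply: sub_finite_set fU.
    move=> U' [BU' [s [U's Us]]]; have [q D'q Nq] := KD' _ (UK _ Us).
    by exists q => //; split=> //; exists s; split=> //; exact: interior_subset Nq.
  pose T := \bigcup_(U in [set U | B U /\ U `&` N !=set0])
     [set U' | B' U' /\ U' `&` U !=set0].
  have fT : finite_set T by apply: bigcup_finite => // U [BU _]; exact: fin.
  (* If the support attached to [U'] meets [N], then so does the member [u (z U')] of [B] that
     contains it. The nonempty [U'] lies inside this member, so it is one of the finitely many sets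
     of [T]. *)
  apply: sub_finite_set (finite_image z fT) => _ [[U' [BU' [q U'q]] <-] [s [Ks Ns]]].
  exists U' => //; exists (u (z U')).
    split; first exact: (Bu _).1.
    by exists s; split=> //; have [_ _ _ _ /(_ _ Ks) []] := HbK (z U').
  split=> //; exists q; split=> //.
  have [_ _ bKK _ KO] := HbK (z U').
  by have /KO [] := bKK _ (zP _ BU' _ U'q).
Qed.

End bumps.

(** * Jets of a function times two linear forms *)

Section jets.
Context {R : realType} {V : normedModType R}.
Variable S : set V.
Hypothesis oS : open S.
Implicit Types (f g : V -> R) (a b c v x z : V).

Lemma derive_eq_on f g x v : (forall y, S y -> f y = g y) -> S x ->
  'D_v f x = 'D_v g x.
Proof.
move=> fg Sx; apply: near_eq_derive.
by apply: filterS (open_nbhs_nbhs (conj oS Sx)).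
Qed.

Lemma derive_bigsum_on (I : Type) (r : seq I) (F : I -> V -> R) x v :
  (forall i, smooth_on S (F i)) -> S x ->
  'D_v (fun y => \sum_(i <- r) F i y) x = \sum_(i <- r) 'D_v (F i) x.
Proof.
move=> sF Sx.
by have [_] := is_derive_bigsum r (fun i => smooth_on_is_derive v (sF i) Sx).
Qed.

Lemma is_derive_add f g x v (df dg : R) :
  is_derive x v f df -> is_derive x v g dg ->
  is_derive x v (fun y => f y + g y) (df + dg).
Proof. exact: is_deriveD. Qed.

Section product.
Variables (B : V -> R) (h k : {linear V -> R}).
Hypotheses (sB : smooth_on S B) (ch : continuous h) (ck : continuous k).

Lemma is_derive_linear (l : {linear V -> R}) x v : continuous l ->
  is_derive x v l (l v).
Proof. by move=> cl; exact: (is_derive_linear_comp cl (is_derive_id x v)). Qed.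

Lemma smooth_on_linear (l : {linear V -> R}) : continuous l -> smooth_on S l.
Proof. by move=> cl; exact: (smooth_on_linear_comp cl oS (@smooth_on_id _ _ _)). Qed.

(** [P c] and [Q c] are the coefficients of [h] and [k] in the derivative of the product along [c].
    This grouping keeps a factor that vanishes at [z] in each term. *)
Let P c x := 'D_c B x * k x + B x * k c.
Let Q c x := B x * h c.

Let is_derive_BQ c x v : S x -> is_derive x v (Q c) ('D_v B x * h c).
Proof.
move=> Sx; have := is_derive_mul (smooth_on_is_derive v sB Sx) (is_derive_cst (h c) x v).
by rewrite mulr0 add0r mulrC.
Qed.

Let is_derive_P c x v : S x -> is_derive x v (P c)
  ('D_c B x * k v + k x * 'D_v ('D_c B) x + 'D_v B x * k c).
Proof.
move=> Sx; have sDB := smooth_on_derive c sB.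
have d1 := is_derive_mul (smooth_on_is_derive v sDB Sx) (is_derive_linear x v ck).
have d2 := is_derive_mul (smooth_on_is_derive v sB Sx) (is_derive_cst (k c) x v).
apply: (is_derive_eq (is_deriveD d1 d2)).
by rewrite mulr0 add0r [k c * _]mulrC.
Qed.

Let is_derive_f x c : S x ->
  is_derive x c (fun y => B y * h y * k y) (P c x * h x + Q c x * k x).
Proof.
move=> Sx; have d1 := is_derive_mul (smooth_on_is_derive c sB Sx) (is_derive_linear x c ch).
apply: (is_derive_eq (is_derive_mul d1 (is_derive_linear x c ck))).
by rewrite /P /Q; ring.
Qed.

Let is_derive_f2 x b c : S x -> is_derive x b (fun y => P c y * h y + Q c y * k y)
  (P c x * h b + h x * ('D_c B x * k b + k x * 'D_b ('D_c B) x + 'D_b B x * k c) +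
   (Q c x * k b + k x * ('D_b B x * h c))).
Proof.
move=> Sx; apply: is_deriveD.
  exact: (is_derive_mul (is_derive_P c b Sx) (is_derive_linear x b ch)).
exact: (is_derive_mul (is_derive_BQ c b Sx) (is_derive_linear x b ck)).
Qed.

Lemma smooth_on_product : smooth_on S (fun y => B y * h y * k y).
Proof.
exact: (smooth_onM oS (smooth_onM oS sB (smooth_on_linear ch)) (smooth_on_linear ck)).
Qed.

Variable z : V.
Hypotheses (Sz : S z) (hz : h z = 0) (kz : k z = 0).

Lemma jet1_product c : 'D_c (fun y => B y * h y * k y) z = 0.
Proof. by have [_ ->] := is_derive_f c Sz; rewrite hz kz !mulr0 addr0. Qed.

Lemma jet2_product b c : 'D_b ('D_c (fun y => B y * h y * k y)) z =
  B z * (h b * k c + h c * k b).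
Proof.
rewrite (derive_eq_on b (fun y Sy => @derive_val _ _ _ _ _ _ _ (is_derive_f c Sy)) Sz).
have [_ ->] := is_derive_f2 b c Sz.
rewrite /P /Q hz kz.
by move: ('D_b ('D_c B) z) ('D_c B z) ('D_b B z) (B z) (h b) (h c) (k b) (k c) => *; ring.
Qed.

(** By the Leibniz rule a term survives at [z] only if exactly one derivative falls on [h] and
    exactly one on [k], since both vanish at [z] and are linear. The third falls on [B]. *)
Lemma jet3_product a b c : 'D_a ('D_b ('D_c (fun y => B y * h y * k y))) z =
  'D_a B z * (h b * k c + h c * k b) + 'D_b B z * (h a * k c + h c * k a) +
  'D_c B z * (h a * k b + h b * k a).
Proof.
have E y : S y -> 'D_b ('D_c (fun y => B y * h y * k y)) y =
   P c y * h b + h y * ('D_c B y * k b + k y * 'D_b ('D_c B) y + 'D_b B y * k c) +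
   (Q c y * k b + k y * ('D_b B y * h c)).
  move=> Sy.
  rewrite (derive_eq_on b (fun y Sy => @derive_val _ _ _ _ _ _ _ (is_derive_f c Sy)) Sy).
  by have [_ ->] := is_derive_f2 b c Sy.
rewrite (derive_eq_on a E Sz).
have cst_d (r : R) := is_derive_cst r z a.
have s1 := smooth_on_derive b sB; have s2 := smooth_on_derive c sB.
have s3 := smooth_on_derive b s2.
have dB v : is_derive z a ('D_v B) ('D_a ('D_v B) z).
  exact: (smooth_on_is_derive a (smooth_on_derive v sB) Sz).
have dk := is_derive_linear z a ck; have dh := is_derive_linear z a ch.
have d1 := is_derive_mul (is_derive_P c a Sz) (cst_d (h b)).
have d2 := is_derive_add (is_derive_add (is_derive_mul (dB c) (cst_d (k b)))
  (is_derive_mul dk (smooth_on_is_derive a s3 Sz))) (is_derive_mul (dB b) (cst_d (k c))).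
have d3 := is_derive_mul (is_derive_BQ c a Sz) (cst_d (k b)).
have d4 := is_derive_mul dk (is_derive_mul (dB b) (cst_d (h c))).
have [_ D] := is_derive_add (is_derive_add d1 (is_derive_mul dh d2)) (is_derive_add d3 d4).
apply: etrans D _; rewrite /P /Q /= hz kz.
move: ('D_a ('D_b ('D_c B)) z) ('D_a ('D_c B) z) ('D_a ('D_b B) z) ('D_b ('D_c B) z).
move: ('D_c B z) ('D_b B z) ('D_a B z) (h a) (h b) (h c) (k a) (k b) (k c) (B z).
by move=> *; ring.
Qed.

End product.

End jets.

(** * Second derivatives and coordinate frames on a manifold *)

Section more_smooth.
Context {R : realType} {V W : normedModType R} {bV : findim V} {bW : findim W}.

Lemma fdl_inj (w w' : W) : (forall i : fdI W, fdl i w = fdl i w') -> w = w'.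
Proof. by move=> E; rewrite [w]fdE [w']fdE; apply: eq_bigr => i _; rewrite E. Qed.

Lemma smooth_on_derive_comm (S : set V) (f : V -> W) x u v : open S ->
  smooth_on S f -> S x -> 'D_u ('D_v f) x = 'D_v ('D_u f) x.
Proof.
move=> oS sf Sx; apply: fdl_inj => i; pose g : V -> R := fun y => fdl i (f y).
have sg : smooth_on S g by exact: (proj1 (smooth_on_coordP f oS) sf i).
have Dg a y : S y -> 'D_a g y = fdl i ('D_a f y).
  move=> Sy.
  by have [_ ->] := is_derive_linear_comp (@fdl_continuous _ _ _ i) (smooth_on_is_derive a sf Sy).
have DDg a b : fdl i ('D_a ('D_b f) x) = 'D_a ('D_b g) x.
  have nS : \forall y \near x, S y by exact: open_nbhs_nbhs.
  rewrite (@near_eq_derive _ _ _ ('D_b g) (fun y => fdl i ('D_b f y))); last first.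
    by apply: filterS nS => y /Dg.
  by have [_ ->] := is_derive_linear_comp (@fdl_continuous _ _ _ i)
    (smooth_on_is_derive a (smooth_on_derive b sf) Sx).
rewrite !DDg; apply: derive_comm.
- have nS : \forall y \near x, S y by exact: open_nbhs_nbhs.
  apply: filterS nS => y Sy; split.
  + by have [] := smooth_on_is_derive v sg Sy.
  + by have [] := smooth_on_is_derive u sg Sy.
  + by have [] := smooth_on_is_derive u (smooth_on_derive v sg) Sy.
  + by have [] := smooth_on_is_derive v (smooth_on_derive u sg) Sy.
- exact: (smooth_on_continuous (smooth_on_derive u (smooth_on_derive v sg)) Sx).
- exact: (smooth_on_continuous (smooth_on_derive v (smooth_on_derive u sg)) Sx).
Qed.

Lemma smooth_on_scale (S : set V) (b : V -> R) (f : V -> W) : open S ->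
  smooth_on S b -> smooth_on S f -> smooth_on S (fun x => b x *: f x).
Proof.
move=> oS sb sf; apply/(smooth_on_coordP _ oS) => i.
have sfi : smooth_on S (fun x => fdl i (f x)) by exact: (proj1 (smooth_on_coordP f oS) sf i).
refine (smooth_on_eq oS _ (smooth_onM oS sb sfi)) => x _.
by rewrite linearZ.
Qed.

End more_smooth.

Section manifold_more.
Context {R : realType} {M : topologicalType} {V W : normedModType R}
  {bV : findim V} {bW : findim W}.
Variable A : atlas M V.
Hypothesis hA : smooth_atlas A.

Lemma smooth_at_scale (b : M -> R) (f : M -> W) m : smooth_at A b m ->
  smooth_at A f m -> smooth_at A (fun p => b p *: f p) m.
Proof.
move=> sb sf.
destruct (smooth_at2 hA sb sf) as [c [hc cm [S [oS Sm sb' sf']]]].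
exists c; split; [exact: hc|exact: cm|exists S; split; [exact: oS|exact: Sm|]].
exact: (smooth_on_scale oS sb' sf').
Qed.

Lemma smooth_at_derive_chart (f : M -> W) m c v : charts A c -> cdom c m ->
  smooth_at A f m -> smooth_at A (fun p => 'D_v (f \o cinv c) (c p)) m.
Proof.
move=> hc cm sf; destruct (smooth_at_chart hA hc cm sf) as [S [oS Sm sf' SI]].
exists c; split; [exact: hc|exact: cm|exists S; split; [exact: oS|exact: Sm|]].
refine (smooth_on_eq oS _ (smooth_on_derive v sf')) => x /SI [p cp <-].
by rewrite /= (cinvK hA hc cp).
Qed.

Lemma dird_frame2 (f : M -> W) m c u v : charts A c -> cdom c m -> smooth_at A f m ->
  dird A (fun p => 'D_v (f \o cinv c) (c p)) m (frame A c u m) =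
  'D_u ('D_v (f \o cinv c)) (c m).
Proof.
move=> hc cm sf; rewrite (dird_frame hA u (smooth_at_derive_chart v hc cm sf) hc cm).
apply: near_eq_derive; apply: filterS (near_cinvK hA hc cm) => x /= E.
by rewrite E.
Qed.

End manifold_more.

Section frames.
Context {R : realType} {M : topologicalType} {V : normedModType R} {bV : findim V}.
Variable A : atlas M V.
Hypothesis hA : smooth_atlas A.

Lemma frame_sum c p v : charts A c -> cdom c p ->
  frame A c v p = \sum_(i : fdI V) fdl i v *: frame A c (fde i) p.
Proof.
move=> hc cp; have sc : smooth_at A (chart_at A p : M -> V) p.
  exact: (smooth_at_chart_map hA (chart_at_charts hA p) (chart_at_dom hA p)).
have d : differentiable (chart_at A p \o cinv c) (c p).
  exact: (smooth_at_differentiable hA sc hc cp).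
exact: derive_coord.
Qed.

(* By symmetry of second derivatives. *)
Lemma bracket_frames c m (X Z : M -> V) u v : charts A c -> cdom c m ->
  (\forall p \near m, X p = frame A c v p) ->
  (\forall p \near m, Z p = frame A c u p) -> lie_bracket A Z X m = 0.
Proof.
move=> hc cm XE ZE; rewrite /lie_bracket; set c0 := chart_at A m.
have sc0 : smooth_at A (c0 : M -> V) m.
  exact: (smooth_at_chart_map hA (chart_at_charts hA m) (chart_at_dom hA m)).
have L (Y Y' : M -> V) a b : (\forall p \near m, Y p = frame A c a p) ->
    (\forall p \near m, Y' p = frame A c b p) ->
    lie A Y' (lie A Y c0) m = 'D_b ('D_a (c0 \o cinv c)) (c m).
  move=> YE YE'; rewrite {1}/lie (nbhs_singleton YE').
  rewrite (@dird_near_eq _ _ _ _ hA _ _ (fun p => 'D_a (c0 \o cinv c) (c p))).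
    exact: (dird_frame2 hA b a hc cm sc0).
  have n1 := chart_dom_nbhs hA hc cm; have n2 := smooth_at_near hA sc0.
  apply: filterS3 YE n1 n2 => p YEp cp sp.
  by rewrite /lie YEp; exact: dird_frame.
rewrite (L _ _ _ _ XE ZE) (L _ _ _ _ ZE XE).
destruct (smooth_at_chart hA hc cm sc0) as [S [oS Sm sf SI]].
by apply/eqP; rewrite subr_eq0; apply/eqP; exact: (smooth_on_derive_comm u v oS sf Sm).
Qed.

End frames.

(** * The bi-form d^L d^R D in product charts *)

Section square.
Context {R : realType} {M : topologicalType} {V : normedModType R} {bV : findim V}.
Variable A : atlas M V.
Hypothesis hA : smooth_atlas A.
Let hAA := smooth_atlas_prod hA hA.
Implicit Types (D G : M * M -> R).

Lemma square_chart D m n c d : smooth_at (prod_atlas A A) D (m, n) ->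
  charts A c -> cdom c m -> charts A d -> cdom d n ->
  exists S, [/\ open S, S (c m, d n),
    smooth_on S (D \o cinv (prod_chart c d)) &
    forall z, S z -> exists p q, [/\ cdom c p, cdom d q & z = (c p, d q)]].
Proof.
move=> sD hc cm hd dn; have hcd := prod_chart_at hc hd.
have cd : cdom (prod_chart c d) (m, n) by split.
destruct (smooth_at_chart (d := prod_chart c d) hAA hcd cd sD) as [S [oS Sm sS SI]].
exists S; split; [exact: oS|exact: Sm|exact: sS|].
by move=> z /SI [[p q] [/= cp dq] <-]; exists p, q.
Qed.

Lemma smooth_at_diag G m : smooth_at (prod_atlas A A) G (m, m) ->
  smooth_at A (fun p => G (p, p)) m.
Proof.
move=> sG; pose c := chart_at A m.
have hc : charts A c := chart_at_charts hA m.
have cm : cdom c m := chart_at_dom hA m.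
have [S [oS Sm sS _]] := square_chart sG hc cm hc cm.
have oT : open [set x | S (x, x)].
  rewrite openE => x Sx.
  have C : {for x, continuous (fun x : V => (x, x))} by apply: cvg_pair; exact: cvg_id.
  by apply: C; exact: open_nbhs_nbhs.
exists c; split; [exact: hc|exact: cm|exists [set x | S (x, x)]; split].
- exact: oT.
- exact: Sm.
- have sd : smooth_on [set x | S (x, x)] (fun x : V => (x, x)).
    exact: (smooth_on_pair oT (@smooth_on_id _ _ _) (@smooth_on_id _ _ _)).
  by refine (smooth_on_comp oT oS _ sd sS).
Qed.

Lemma smooth_at_swap G m n : smooth_at (prod_atlas A A) G (n, m) ->
  smooth_at (prod_atlas A A) (fun p => G (p.2, p.1)) (m, n).
Proof.
move=> [_ [[d [c [hd hc ->]]] [/= dn cm] [S [oS Sm sS]]]].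
have oT : open [set z : V * V | S (z.2, z.1)].
  rewrite openE => z Sz.
  have C : {for z, continuous (fun z : V * V => (z.2, z.1))}.
    by apply: cvg_pair; [exact: cvg_snd|exact: cvg_fst].
  by apply: C; exact: open_nbhs_nbhs.
exists (prod_chart c d); split; [by exists c, d|by []|].
exists [set z | S (z.2, z.1)]; split; [exact: oT|exact: Sm|].
have sd : smooth_on [set z : V * V | S (z.2, z.1)] (fun z : V * V => (z.2, z.1)).
  exact: (smooth_on_pair oT (@smooth_on_snd _ _ _ _) (@smooth_on_fst _ _ _ _)).
by refine (smooth_on_comp oT oS _ sd sS).
Qed.

Lemma dR_frame D m n c d w : smooth_at (prod_atlas A A) D (m, n) ->
  charts A c -> cdom c m -> charts A d -> cdom d n ->
  dR A D (m, n) (frame A d w n) =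
  'D_(0, w) (D \o cinv (prod_chart c d)) (c m, d n).
Proof.
move=> sD hc cm hd dn; rewrite /dR (dird_slice_r A hA).
exact: (dird_frame_r hA hA).
Qed.

Lemma smooth_at_dR D m n d w : smooth_at (prod_atlas A A) D (m, n) ->
  charts A d -> cdom d n ->
  smooth_at (prod_atlas A A) (fun p => dR A D p (frame A d w p.2)) (m, n).
Proof.
move=> sD hd dn; suff -> : (fun p => dR A D p (frame A d w p.2)) =
    (fun p => dird A (fun q => D (p.1, q)) p.2 (frame A d w p.2)).
  exact: (smooth_at_frame_r hA hA w sD hd dn).
by apply/funext => -[p q]; rewrite /dR (dird_slice_r A hA).
Qed.

(** The vector frozen by [dL] is the value at [n] of a frame field on the right factor, so freezing
    it amounts to moving along a left slice of a smooth function on the product. *)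
Lemma dLdR_frame D m n c d v w : smooth_at (prod_atlas A A) D (m, n) ->
  charts A c -> cdom c m -> charts A d -> cdom d n ->
  dL A (dR A D) (m, n) (frame A c v m) (frame A d w n) =
  'D_(v, 0) ('D_(0, w) (D \o cinv (prod_chart c d))) (c m, d n).
Proof.
move=> sD hc cm hd dn; rewrite /dL /=.
have E := dird_frame_l hA hA v (smooth_at_dR w sD hd dn) hc cm hd dn.
rewrite /= in E; rewrite E; apply: near_eq_derive.
have [S [oS Sm sS SI]] := square_chart sD hc cm hd dn.
have : nbhs (c m, d n) S := open_nbhs_nbhs (conj oS Sm).
apply: filterS => z Sz; have [p [q [cp dq zE]]] := SI _ Sz; rewrite zE /=.
rewrite (cinvK hA hc cp) (cinvK hA hd dq).
have sp : smooth_at (prod_atlas A A) D (p, q).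
  exists (prod_chart c d); split; [exact: (prod_chart_at hc hd)|by split|].
  by exists S; split; [exact: oS|rewrite /= -zE; exact: Sz|exact: sS].
exact: (dR_frame w sp hc cp hd dq).
Qed.

Lemma smooth_at_dLdR D m n c d v w : smooth_at (prod_atlas A A) D (m, n) ->
  charts A c -> cdom c m -> charts A d -> cdom d n ->
  smooth_at (prod_atlas A A)
    (fun p => dL A (dR A D) p (frame A c v p.1) (frame A d w p.2)) (m, n).
Proof.
move=> sD hc cm hd dn.
exact: (smooth_at_frame_l hA hA v (smooth_at_dR w sD hd dn) hc cm).
Qed.

(** Linearity in the right argument must hold at all nearby left points before the left derivative
    is taken, hence the passage to smoothness of [D] near [(m, n)]. *)
Lemma bilinear_dLdR D m n : smooth_at (prod_atlas A A) D (m, n) ->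
  bilinear_form (dL A (dR A D) (m, n)).
Proof.
move=> sD; have hn := chart_at_charts hA n; have dn := chart_at_dom hA n.
have sl y : smooth_at A (fun p => dR A D (p, n) y) m.
  have := smooth_at_slice_l hA (smooth_at_dR y sD hn dn).
  rewrite /= (frame_chart_at hA n y).
  exact.
split=> [a u u' y|a u y y']; rewrite /dL /=.
  exact: (dird_linear hA (sl y) a u u').
rewrite (@dird_near_eq _ _ _ _ hA _ _ (fun p => a * dR A D (p, n) y + dR A D (p, n) y')).
  have sa : smooth_at A (fun p => a * dR A D (p, n) y) m.
    exact: (smooth_atM hA (smooth_at_cst hA a m) (sl y)).
  by rewrite (dirdD hA u sa (sl y')) (dirdZ hA a u (sl y)).
have nD := smooth_at_near hAA sD.
have C : {for m, continuous (fun p => (p, n))} by apply: cvg_pair; [exact: cvg_id|exact: cvg_cst].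
have nC : \forall p \near m, smooth_at (prod_atlas A A) D (p, n) := C _ nD.
apply: filterS nC => p sp.
rewrite /dR.
have -> : (0, a *: y + y') = a *: (0, y) + (0, y') :> V * V.
  by congr (_, _); rewrite /= scaler0 addr0.
exact: (dird_linear hAA sp a (0, y) (0, y')).
Qed.

End square.

(** * Global extensions of frames and bilinear algebra *)

Section extension.
Context {R : realType} {n : nat} {M : topologicalType}.
Variable A : atlas M 'rV[R]_n.
Hypotheses (hA : smooth_atlas A) (hM : hausdorff_space M).

(** Connections, torsion and conjugacy are tested on global vector fields only. A frame multiplied
    by a bump equal to 1 near [m] makes them applicable to coordinate fields. *)
Lemma extend_frame c m (v : 'rV[R]_n) : charts A c -> cdom c m ->
  exists2 X, vector_field A X & \forall p \near m, X p = frame A c v p.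
Proof.
move=> hc cm.
have [b [K [[sb _] b1 bK [_ cK] KO]]] := chart_bump hA hM (chart_open_dom hA hc) cm.
exists (fun p => b p *: frame A c v p); last first.
  by apply: filterS b1 => p ->; rewrite scale1r.
move=> d hd; apply: (msmooth_local hA) => p dp.
have sd : smooth_at A (d : M -> 'rV[R]_n) p by exact: (smooth_at_chart_map hA hd dp).
have nd := smooth_at_near hA sd.
have [cp|ncp] := pselect (cdom c p).
  have s1 : smooth_at A (fun q => 'D_v (d \o cinv c) (c q)) p.
    exact: (smooth_at_derive_chart hA v hc cp sd).
  refine (smooth_at_eq hA _ (smooth_at_scale hA (sb p) s1)).
  apply: filterS2 nd (chart_dom_nbhs hA hc cp) => q sdq cq; rewrite /lie.
  rewrite -(dird_frame hA v sdq hc cq).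
  have df : differentiable (d \o cinv (chart_at A q)) (chart_at A q q).
    exact: (smooth_at_differentiable hA sdq (chart_at_charts hA q) (chart_at_dom hA q)).
  by rewrite /dird !deriveE // linearZ.
apply: (@smooth_at_eq _ _ _ _ hA _ (cst 0)); last exact: (smooth_at_cst hA).
have nK : ~ K p by move=> /KO [].
have : nbhs p (~` K) by apply: open_nbhs_nbhs; split=> //; exact: closed_openC.
apply: filterS => q nKq; have bq : b q = 0.
  by apply/eqP; apply: contrapT => /negP /bK.
by rewrite /lie bq scale0r /dird derive0.
Qed.

End extension.

Section bilinear.
Context {R : realType} {V W : normedModType R} {bV : findim V} {bW : findim W}.
Variable b : V -> W -> R.
Hypothesis hb : bilinear_form b.

Lemma bilinear0l w : b 0 w = 0.
Proof. by have := hb.1 (-1) 0 0 w; rewrite scaleN1r oppr0 addr0 mulN1r addNr. Qed.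

Lemma bilinear0r v : b v 0 = 0.
Proof. by have := hb.2 (-1) v 0 0; rewrite scaleN1r oppr0 addr0 mulN1r addNr. Qed.

Lemma bilinearBl v v' w : b (v - v') w = b v w - b v' w.
Proof. by have := hb.1 (-1) v' v w; rewrite scaleN1r addrC => ->; rewrite mulN1r addrC. Qed.

Lemma bilinearBr v w w' : b v (w - w') = b v w - b v w'.
Proof. by have := hb.2 (-1) v w' w; rewrite scaleN1r addrC => ->; rewrite mulN1r addrC. Qed.

Lemma bilinear_suml (I : Type) (r : seq I) (a : I -> R) (v : I -> V) w :
  b (\sum_(i <- r) a i *: v i) w = \sum_(i <- r) a i * b (v i) w.
Proof.
elim: r => [|i r IH]; first by rewrite !big_nil bilinear0l.
by rewrite !big_cons hb.1 IH.
Qed.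

Lemma bilinear_sumr (I : Type) (r : seq I) (a : I -> R) (w : I -> W) v :
  b v (\sum_(i <- r) a i *: w i) = \sum_(i <- r) a i * b v (w i).
Proof.
elim: r => [|i r IH]; first by rewrite !big_nil bilinear0r.
by rewrite !big_cons hb.2 IH.
Qed.

End bilinear.

(** * Symmetries of the first derivatives of the bi-form *)

Section local_form.
Context {R : realType} {M : topologicalType} {V : normedModType R} {bV : findim V}.
Variable A : atlas M V.
Hypothesis hA : smooth_atlas A.
Let hAA := smooth_atlas_prod hA hA.
Variables (varpi : M * M -> V -> V -> R) (U : set (M * M)).
Hypotheses (oU : open U) (dU : forall m, U (m, m)).
Hypothesis bilU : forall p, U p -> bilinear_form (varpi p).
Hypothesis smU : forall c d x y, charts A c -> charts A d ->
  msmooth (prod_atlas A A) (U `&` (cdom c `*` cdom d))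
    (fun p => varpi p (frame A c x p.1) (frame A d y p.2)).

Definition frame_coef (c : chart M V) (v w : V) (p : M * M) : R :=
  varpi p (frame A c v p.1) (frame A c w p.2).

Definition chart_coef c v w : V * V -> R :=
  frame_coef c v w \o cinv (prod_chart c c).

Lemma smooth_at_frame_coef c v w m n : charts A c -> cdom c m -> cdom c n ->
  U (m, n) -> smooth_at (prod_atlas A A) (frame_coef c v w) (m, n).
Proof.
move=> hc cm cn Umn.
have oO : open (U `&` (cdom c `*` cdom c)).
  by apply: openI => //; apply: open_setX; exact: (chart_open_dom hA hc).
have Om : (U `&` (cdom c `*` cdom c)) (m, n) by split.
exact: (smooth_at_msmooth hAA oO Om (smU v w hc hc)).
Qed.

Lemma chart_coef_sum c p q v w : charts A c -> cdom c p -> cdom c q -> U (p, q) ->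
  frame_coef c v w (p, q) = \sum_(i : fdI V * fdI V)
    fdl i.1 v * fdl i.2 w * frame_coef c (fde i.1) (fde i.2) (p, q).
Proof.
move=> hc cp cq Upq; rewrite /frame_coef /= (frame_sum hA v hc cp) (frame_sum hA w hc cq).
rewrite (bilinear_suml (bilU Upq)) -(pair_bigA _ (fun i j => fdl i v * fdl j w *
  varpi (p, q) (frame A c (fde i) p) (frame A c (fde j) q))) /=.
apply: eq_bigr => i _; rewrite (bilinear_sumr (bilU Upq)) mulr_sumr.
by apply: eq_bigr => j _; rewrite mulrA.
Qed.

Section at_point.
Variables (c : chart M V) (m : M).
Hypotheses (hc : charts A c) (cm : cdom c m).
Let z0 := (c m, c m).

(** The neighbourhood is made invariant under exchange of the two points because the local solution
    evaluates the bi-form in both orders. *)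
Lemma chart_coef_nbhd : exists S, [/\ open S, S z0,
  forall v w, smooth_on S (chart_coef c v w),
  forall z, S z -> exists p q, [/\ cdom c p, cdom c q, z = (c p, c q), U (p, q) & U (q, p)]
  & forall z, S z -> S (z.2, z.1)].
Proof.
pose Us := U `&` [set p | U (p.2, p.1)].
have oUs : open [set p : M * M | U (p.2, p.1)].
  rewrite openE => z Uz.
  have C : {for z, continuous (fun z : M * M => (z.2, z.1))}.
    by apply: cvg_pair; [exact: cvg_snd|exact: cvg_fst].
  have n0 : nbhs (z.2, z.1) U := open_nbhs_nbhs (conj oU Uz).
  exact: (C _ n0).
pose S := prod_chart c c @` (cdom (prod_chart c c) `&` Us).
have oS : open S.
  by apply: (chart_image_open hAA); [exact: prod_chart_at|exact: openI].
have SE z : S z -> exists p q, [/\ cdom c p, cdom c q, z = (c p, c q), U (p, q) & U (q, p)].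
  by move=> [[p q] [[/= cp cq] [/= U1 U2]] <-]; exists p, q.
exists S; split; [exact: oS| |move=> v w|exact: SE|].
- exists (m, m) => //; split; first by split.
  by split; exact: dU.
- have := smU v w hc hc (prod_chart_at hc hc).
  apply: smooth_on_subset => _ [[p q] [[/= cp cq] [/= U1 U2]] <-].
  by exists (p, q).
- move=> _ [[p q] [[/= cp cq] [/= U1 U2]] <-]; exists (q, p) => //.
Qed.

(** Lowered Christoffel symbols: [coefL u v w] is the metric applied to the [nabla]-derivative of
    the field [v] along [u], and to [w]; [coefR u v w] is the metric applied to [v] and to the
    conjugate derivative of [w] along [u]. See [nabla_frame] and [nabla'_frame]. *)
Definition coefL (u v w : V) : R := 'D_(u, 0) (chart_coef c v w) z0.
Definition coefR (u v w : V) : R := 'D_(0, u) (chart_coef c v w) z0.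

Lemma chart_coef0 v w : chart_coef c v w z0 = varpi (m, m) (frame A c v m) (frame A c w m).
Proof. by rewrite /chart_coef /frame_coef /= (cinvK hA hc cm). Qed.

(** It mediates between the symmetries, which hold for arbitrary vectors, and the local solution,
    which is written in components of a basis. *)
Lemma derive_chart_coef_sum a v w :
  'D_a (chart_coef c v w) z0 = \sum_(i : fdI V * fdI V)
    fdl i.1 v * fdl i.2 w * 'D_a (chart_coef c (fde i.1) (fde i.2)) z0.
Proof.
have [S [oS Sz sS SE _]] := chart_coef_nbhd.
rewrite (@derive_eq_on _ _ _ oS _ (fun z => \sum_(i : fdI V * fdI V)
    fdl i.1 v * fdl i.2 w * chart_coef c (fde i.1) (fde i.2) z) _ _ _ Sz); last first.
  move=> z Sz'; have [p [q [cp cq -> Upq _]]] := SE _ Sz'.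
  rewrite /chart_coef /= (cinvK hA hc cp) (cinvK hA hc cq).
  exact: chart_coef_sum.
have d i : is_derive z0 a (fun z => fdl i.1 v * fdl i.2 w * chart_coef c (fde i.1) (fde i.2) z)
   (fdl i.1 v * fdl i.2 w * 'D_a (chart_coef c (fde i.1) (fde i.2)) z0).
  have d1 := smooth_on_is_derive a (sS (fde i.1) (fde i.2)) Sz.
  apply: (is_derive_eq (is_derive_mul (is_derive_cst (fdl i.1 v * fdl i.2 w) z0 a) d1)).
  by rewrite mulr0 addr0.
by have [_] := is_derive_bigsum (index_enum (fdI V * fdI V)%type) d.
Qed.

Lemma coefLR u v w : 'D_(u, u) (chart_coef c v w) z0 = coefL u v w + coefR u v w.
Proof.
have [S [oS Sz sS _ _]] := chart_coef_nbhd.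
have df : differentiable (chart_coef c v w) z0.
  exact: (smooth_on_differentiable oS (sS v w) Sz).
rewrite /coefL /coefR !deriveE // -linearD; congr ('d _ _ _).
by congr (_, _); rewrite /= ?addr0 ?add0r.
Qed.

Lemma dird_frame_coef u v w :
  dird A (fun p => frame_coef c v w (p, m)) m (frame A c u m) = coefL u v w.
Proof.
have sm := smooth_at_frame_coef v w hc cm cm (dU m).
exact: (dird_frame_l hA hA u sm hc cm hc cm).
Qed.

(** Along the diagonal both points move, so the direction in the product chart is [(u, u)]. *)
Lemma dird_frame_coef_diag u v w :
  dird A (fun p => frame_coef c v w (p, p)) m (frame A c u m) =
  coefL u v w + coefR u v w.
Proof.
have sm := smooth_at_frame_coef v w hc cm cm (dU m).
rewrite (dird_frame hA u (smooth_at_diag hA sm) hc cm) -coefLR /derive.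
set F1 := (X in lim (X @ _)); set F2 := (X in _ = lim (X @ _)).
by suff -> : F1 = F2.
Qed.

End at_point.
End local_form.

Section symmetries.
Context {R : realType} {n : nat} {M : topologicalType}.
Notation V := 'rV[R]_n.
Variable A : atlas M V.
Hypotheses (hA : smooth_atlas A) (hM : hausdorff_space M).
Variables (varpi : M * M -> V -> V -> R) (U : set (M * M)).
Hypotheses (oU : open U) (dU : forall m, U (m, m)).
Hypothesis bilU : forall p, U p -> bilinear_form (varpi p).
Hypothesis smU : forall c d x y, charts A c -> charts A d ->
  msmooth (prod_atlas A A) (U `&` (cdom c `*` cdom d))
    (fun p => varpi p (frame A c x p.1) (frame A d y p.2)).
Variables nabla nabla' : (M -> V) -> (M -> V) -> (M -> V).
Hypothesis sym : forall m u v, varpi (m, m) u v = varpi (m, m) v u.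
Hypothesis hnabla : induced_connection A varpi nabla.
Hypothesis tor : torsion_free A nabla.
Hypothesis conj' : conjugate_connection A (diag_restr varpi) nabla nabla'.
Hypothesis tor' : torsion_free A nabla'.

(** The bracket subtracted in the left Lie derivative cancels the one added in the definition of the
    induced connection; what remains is a derivative in the left point with the right vector
    fixed. *)
Lemma nablaE (X Y Z : M -> V) m : vector_field A X -> vector_field A Y -> vector_field A Z ->
  varpi (m, m) (nabla Z X m) (Y m) =
  dird A (fun p => varpi (p, m) (X p) (Y m)) m (Z m).
Proof.
move=> hX hY hZ; have [_ H] := hnabla.
have -> : varpi (m, m) (nabla Z X m) (Y m) = diag_restr varpi m (nabla Z X m) (Y m) by [].
rewrite (H _ _ _ hX hY hZ) /left_lie /diag_restr {2}/biform_app /= subrK.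
by rewrite /lie /liftL /= (dird_slice_l _ hA).
Qed.

Section frames.
Variables (c : chart M V) (m : M).
Hypotheses (hc : charts A c) (cm : cdom c m).
Notation cL := (coefL A varpi c m).
Notation cR := (coefR A varpi c m).

Lemma nabla_frame (X Y Z : M -> V) u v w :
  vector_field A X -> vector_field A Y -> vector_field A Z ->
  (\forall p \near m, X p = frame A c v p) ->
  (\forall p \near m, Y p = frame A c w p) ->
  (\forall p \near m, Z p = frame A c u p) ->
  varpi (m, m) (nabla Z X m) (Y m) = cL u v w.
Proof.
move=> hX hY hZ XE YE ZE; rewrite (nablaE m hX hY hZ) (nbhs_singleton ZE).
rewrite -(dird_frame_coef hA oU dU smU hc cm).
apply: (dird_near_eq hA); apply: filterS XE => p ->.
by rewrite /frame_coef /= (nbhs_singleton YE).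
Qed.

(** Coordinate fields of one chart commute, so for their extensions the torsion identity at [m] has
    bracket zero. *)
Lemma coefL_sym u v w : cL u v w = cL v u w.
Proof.
have [X hX XE] := extend_frame hA hM v hc cm.
have [Y hY YE] := extend_frame hA hM w hc cm.
have [Z hZ ZE] := extend_frame hA hM u hc cm.
rewrite -(nabla_frame hX hY hZ XE YE ZE) -(nabla_frame hZ hY hX ZE YE XE).
apply/eqP; rewrite -subr_eq0 -(bilinearBl (bilU (dU m))) (tor hZ hX).
by rewrite (bracket_frames hA hc cm XE ZE) (bilinear0l (bilU (dU m))).
Qed.

(** The conjugacy identity splits the derivative of the metric along the diagonal, [coefL + coefR],
    into a [nabla] part and a [nabla'] part. The first equals [coefL], which leaves [coefR] for the
    second. *)
Lemma nabla'_frame (X Y Z : M -> V) u v w :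
  vector_field A X -> vector_field A Y -> vector_field A Z ->
  (\forall p \near m, X p = frame A c v p) ->
  (\forall p \near m, Y p = frame A c w p) ->
  (\forall p \near m, Z p = frame A c u p) ->
  varpi (m, m) (frame A c v m) (nabla' Z Y m) = cR u v w.
Proof.
move=> hX hY hZ XE YE ZE; have [_ H] := conj'.
have := H _ _ _ hX hY hZ m; rewrite /diag_restr (nabla_frame hX hY hZ XE YE ZE).
rewrite (nbhs_singleton XE) => E; apply/(addrI (cL u v w)); rewrite -{}E.
rewrite -(dird_frame_coef_diag hA oU dU smU hc cm) /lie (nbhs_singleton ZE).
apply: (dird_near_eq hA); apply: filterS2 XE YE => p -> ->.
reflexivity.
Qed.

Lemma coefR_sym u v w : cR u v w = cR w v u.
Proof.
have [X hX XE] := extend_frame hA hM v hc cm.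
have [Y hY YE] := extend_frame hA hM w hc cm.
have [Z hZ ZE] := extend_frame hA hM u hc cm.
rewrite -(nabla'_frame hX hY hZ XE YE ZE) -(nabla'_frame hX hZ hY XE ZE YE).
apply/eqP; rewrite -subr_eq0 -(bilinearBr (bilU (dU m))) (tor' hZ hY).
by rewrite (bracket_frames hA hc cm YE ZE) (bilinear0r (bilU (dU m))).
Qed.

Lemma coefLR_sym u v w : cL u v w + cR u v w = cL u w v + cR u w v.
Proof.
pose proof (dird_frame_coef_diag hA oU dU smU hc cm u v w) as Ev.
pose proof (dird_frame_coef_diag hA oU dU smU hc cm u w v) as Ew.
refine (eq_trans (esym Ev) (eq_trans _ Ew)); apply: (dird_near_eq hA).
by apply: nearW => p; exact: sym.
Qed.

End frames.
End symmetries.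

(** * The local solution *)

Section diff_coord.
Context {R : realType} {V : normedModType R} {bV : findim V}.

Definition diff_coord (i : fdI V) (z : V * V) : R := fdl i (z.2 - z.1).

Fact diff_coord_linear i : linear (diff_coord i).
Proof.
move=> a u v; rewrite /diff_coord -linearP; congr (fdl i _) => /=.
by rewrite scalerBr opprD addrACA.
Qed.
HB.instance Definition _ i :=
  GRing.isLinear.Build R (V * V)%type R *:%R (diff_coord i) (diff_coord_linear i).

Fact diff_coord_continuous i : continuous (diff_coord i).
Proof.
move=> z; have c1 : {for z, continuous (fun z : V * V => z.2 - z.1)}.
  by apply: cvgB; [exact: cvg_snd|exact: cvg_fst].
by have := continuous_comp c1 (@fdl_continuous _ _ _ i (z.2 - z.1)).
Qed.

Lemma diff_coordL i v : diff_coord i (v, 0) = - fdl i v.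
Proof. by rewrite /diff_coord /= sub0r linearN. Qed.

Lemma diff_coordR i v : diff_coord i (0, v) = fdl i v.
Proof. by rewrite /diff_coord /= subr0. Qed.

End diff_coord.

(** Shaped after the identity in [local_sol3]: its twelve sums over basis pairs become one sum,
    which can then be compared term by term. *)
Lemma sum_linear_combination (R : pzRingType) (I : finType) (t k : R)
    (a b c d e f g h a' b' c' d' : I -> R) :
  t * (\sum_i a i + k * \sum_i b i + \sum_i c i + k * \sum_i d i +
    \sum_i e i + k * \sum_i f i + \sum_i g i + k * \sum_i h i +
    (- 1) * (\sum_i a' i + k * \sum_i b' i + \sum_i c' i + k * \sum_i d' i)) =
  \sum_i t * (a i + k * b i + c i + k * d i + e i + k * f i + g i + k * h i +
    (- 1) * (a' i + k * b' i + c' i + k * d' i)).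
Proof. by rewrite -mulr_sumr !big_split /= -!mulr_sumr !big_split /= -!mulr_sumr. Qed.

Section one_form.
Context {R : realType} {M : topologicalType} {V : normedModType R} {bV : findim V}.
Variable A : atlas M V.
Hypothesis hA : smooth_atlas A.

(** It reduces arbitrary fields [X] to frames. When [X] is expanded in frames, the Leibniz rule
    pairs the derivatives of the components of [X] with values of the one-forms, and the components
    with their derivatives. *)
Lemma dird_one_form_eq (w w' : M -> V -> V -> R) (X : M -> V) c m y zeta :
  charts A c -> cdom c m -> vector_field A X ->
  (\forall p \near m, bilinear_form (w p)) ->
  (\forall p \near m, bilinear_form (w' p)) ->
  (forall i : fdI V, smooth_at A (fun p => w p (frame A c (fde i) p) y) m) ->
  (forall i : fdI V, smooth_at A (fun p => w' p (frame A c (fde i) p) y) m) ->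
  (forall i : fdI V, w m (frame A c (fde i) m) y = w' m (frame A c (fde i) m) y) ->
  (forall i : fdI V, dird A (fun p => w p (frame A c (fde i) p) y) m zeta =
     dird A (fun p => w' p (frame A c (fde i) p) y) m zeta) ->
  dird A (fun p => w p (X p) y) m zeta = dird A (fun p => w' p (X p) y) m zeta.
Proof.
move=> hc cm hX bw bw' sw sw' E0 E1.
have sX : smooth_at A (lie A X c) m by exact: (vector_field_smooth_at hA hX hc cm).
have sXi (i : fdI V) : smooth_at A (fun p => fdl i (lie A X c p)) m.
  have [c' [hc' cm' [S [oS Sm sS]]]] := sX.
  exists c'; split; [exact: hc'|exact: cm'|exists S; split; [exact: oS|exact: Sm|]].
  exact: (proj1 (smooth_on_coordP _ oS) sS i).
have key (v : M -> V -> V -> R) : (\forall p \near m, bilinear_form (v p)) ->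
    (forall i : fdI V, smooth_at A (fun p => v p (frame A c (fde i) p) y) m) ->
    dird A (fun p => v p (X p) y) m zeta = \sum_(i : fdI V)
      (fdl i (lie A X c m) * dird A (fun p => v p (frame A c (fde i) p) y) m zeta +
       v m (frame A c (fde i) m) y * dird A (fun p => fdl i (lie A X c p)) m zeta).
  move=> bv sv.
  have E : \forall p \near m, v p (X p) y =
      \sum_(i : fdI V) fdl i (lie A X c p) * v p (frame A c (fde i) p) y.
    apply: filterS2 bv (chart_dom_nbhs hA hc cm) => p bvp cp.
    rewrite -[X p](frame_dird hA (X p) hc cp) (frame_sum hA _ hc cp).
    exact: (bilinear_suml bvp).
  rewrite (dird_near_eq hA zeta E).
  have s2 (i : fdI V) : smooth_at A
      (fun p => fdl i (lie A X c p) * v p (frame A c (fde i) p) y) m.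
    exact: (smooth_atM hA (sXi i) (sv i)).
  have [_ ->] := @dird_sum _ _ _ _ _ hA _ (index_enum (fdI V)) _ _ zeta (fun i _ => s2 i).
  by apply: eq_bigr => i _; exact: (dirdM hA zeta (sXi i) (sv i)).
rewrite (key w bw sw) (key w' bw' sw'); apply: eq_bigr => i _.
by rewrite E0 E1.
Qed.

End one_form.

Section local_solution.
Context {R : realType} {M : topologicalType} {V : normedModType R} {bV : findim V}.
Variable A : atlas M V.
Hypothesis hA : smooth_atlas A.
Let hAA := smooth_atlas_prod hA hA.
Variables (varpi : M * M -> V -> V -> R) (U : set (M * M)).
Hypotheses (oU : open U) (dU : forall m, U (m, m)).
Hypothesis bilU : forall p, U p -> bilinear_form (varpi p).
Hypothesis smU : forall c d x y, charts A c -> charts A d ->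
  msmooth (prod_atlas A A) (U `&` (cdom c `*` cdom d))
    (fun p => varpi p (frame A c x p.1) (frame A d y p.2)).
Notation coef := (frame_coef A varpi).

(* The weights 1 and 2 are forced by matching the third derivatives. *)
Definition local_sol (c : chart M V) (p : M * M) : R :=
  \sum_(i : fdI V * fdI V) - (1 / 6) *
    (coef c (fde i.1) (fde i.2) (p.2, p.1) + 2 * coef c (fde i.1) (fde i.2) p) *
    diff_coord i.1 (c p.1, c p.2) * diff_coord i.2 (c p.1, c p.2).

Lemma smooth_at_local_sol c m n : charts A c -> cdom c m -> cdom c n ->
  U (m, n) -> U (n, m) -> smooth_at (prod_atlas A A) (local_sol c) (m, n).
Proof.
move=> hc cm cn Umn Unm.
have sK (i : fdI V) p : cdom c p -> smooth_at A (fun q => fdl i (c q)) p.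
  move=> cp; have [d [hd dp [S [oS Sp sS]]]] := smooth_at_chart_map hA hc cp.
  exists d; split; [exact: hd|exact: dp|exists S; split; [exact: oS|exact: Sp|]].
  exact: (proj1 (smooth_on_coordP _ oS) sS i).
have sd i : smooth_at (prod_atlas A A) (fun p => diff_coord i (c p.1, c p.2)) (m, n).
  have s1 : smooth_at (prod_atlas A A) (fun p => fdl i (c p.2)) (m, n).
    exact: (smooth_at_snd hA (f := fun q => fdl i (c q)) m (sK i n cn)).
  have s2 : smooth_at (prod_atlas A A) (fun p => fdl i (c p.1)) (m, n).
    exact: (smooth_at_fst hA (f := fun q => fdl i (c q)) n (sK i m cm)).
  pose proof (smooth_atM hAA (smooth_at_cst hAA (-1 : R) (m, n)) s2) as s3.
  suff -> : (fun p => diff_coord i (c p.1, c p.2)) =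
      (fun p => fdl i (c p.2) + cst (-1) p * fdl i (c p.1)).
    exact: (smooth_atD hAA s1 s3).
  by apply/funext => p; rewrite /diff_coord /= linearB mulN1r.
apply: (smooth_at_sum hAA) => i.
pose proof (smooth_at_swap (smooth_at_frame_coef hA oU smU (fde i.1) (fde i.2) hc cn cm Unm)) as s1.
pose proof (smooth_at_frame_coef hA oU smU (fde i.1) (fde i.2) hc cm cn Umn) as s2.
pose proof (smooth_atM hAA (smooth_at_cst hAA (2 : R) (m, n)) s2) as s3.
pose proof (smooth_atM hAA (smooth_at_cst hAA (- (1 / 6) : R) (m, n)) (smooth_atD hAA s1 s3)) as s4.
exact: (smooth_atM hAA (smooth_atM hAA s4 (sd i.1)) (sd i.2)).
Qed.

Section at_point.
Variables (c : chart M V) (m : M).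
Hypotheses (hc : charts A c) (cm : cdom c m).
Let z0 := (c m, c m).
Notation cL := (coefL A varpi c m).
Notation cR := (coefR A varpi c m).
Hypothesis sym : forall u v, varpi (m, m) u v = varpi (m, m) v u.
Hypothesis cL_sym : forall u v w, cL u v w = cL v u w.
Hypothesis cR_sym : forall u v w, cR u v w = cR w v u.
Hypothesis cLR_sym : forall u v w, cL u v w + cR u v w = cL u w v + cR u w v.

Lemma local_sol0 : local_sol c (m, m) = 0.
Proof.
rewrite /local_sol big1 // => i _.
by rewrite /diff_coord /= subrr !linear0 !mulr0.
Qed.

Let B (i : fdI V * fdI V) (z : V * V) : R := - (1 / 6) *
  (chart_coef A varpi c (fde i.1) (fde i.2) (z.2, z.1) +
   2 * chart_coef A varpi c (fde i.1) (fde i.2) z).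

Let Floc (z : V * V) : R := \sum_i B i z * diff_coord i.1 z * diff_coord i.2 z.

Let diff_coord_z0 i : diff_coord i z0 = 0.
Proof. by rewrite /diff_coord subrr linear0. Qed.

Let local_nbhd : exists S, [/\ open S, S z0, forall i, smooth_on S (B i),
    forall z, S z -> (local_sol c \o cinv (prod_chart c c)) z = Floc z &
    forall i v, 'D_v (B i) z0 = - (1 / 6) *
      ('D_(v.2, v.1) (chart_coef A varpi c (fde i.1) (fde i.2)) z0 +
       2 * 'D_v (chart_coef A varpi c (fde i.1) (fde i.2)) z0)].
Proof.
have [S [oS Sz sS SE Sw]] := chart_coef_nbhd hA oU dU smU hc cm.
have ssw : smooth_on S (fun z : V * V => (z.2, z.1)).
  exact: (smooth_on_pair oS (@smooth_on_snd _ _ _ _) (@smooth_on_fst _ _ _ _)).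
have s1 v w : smooth_on S (chart_coef A varpi c v w \o (fun z => (z.2, z.1))).
  exact: (smooth_on_comp oS oS Sw ssw (sS v w)).
have sc (r : R) : smooth_on S (cst r : V * V -> R) by exact: smooth_on_cst.
exists S; split; [exact: oS|exact: Sz| | |].
- move=> i; apply: (smooth_onM oS (sc _)); apply: (smooth_onD oS (s1 _ _)).
  exact: (smooth_onM oS (sc 2) (sS _ _)).
- move=> z /SE [p [q [cp cq -> _ _]]].
  rewrite /local_sol /Floc /B /chart_coef /= (cinvK hA hc cp) (cinvK hA hc cq).
  by [].
- move=> i v.
  have d1 := smooth_on_is_derive v (s1 (fde i.1) (fde i.2)) Sz.
  have d2 := smooth_on_is_derive v (sS (fde i.1) (fde i.2)) Sz.
  have d3 := is_derive_add d1 (is_derive_mul (is_derive_cst (2 : R) z0 v) d2).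
  have [_ ->] := is_derive_mul (is_derive_cst (- (1 / 6) : R) z0 v) d3.
  rewrite !mulr0 !addr0 /cst; congr (_ * (_ + _)).
Qed.

Let term (i : fdI V * fdI V) (z : V * V) := B i z * diff_coord i.1 z * diff_coord i.2 z.

Let smooth_term S i : open S -> smooth_on S (B i) -> smooth_on S (term i).
Proof.
move=> oS sB; exact: (smooth_on_product oS sB (@diff_coord_continuous _ _ _ i.1)
  (@diff_coord_continuous _ _ _ i.2)).
Qed.

Let derive_local_sol S x a : open S -> S x -> (forall i, smooth_on S (B i)) ->
  (forall z, S z -> (local_sol c \o cinv (prod_chart c c)) z = Floc z) ->
  'D_a (local_sol c \o cinv (prod_chart c c)) x = \sum_i 'D_a (term i) x.
Proof.
move=> oS Sx sB E; rewrite (derive_eq_on oS a E Sx).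
exact: (derive_bigsum_on _ _ (fun i => smooth_term oS (sB i)) Sx).
Qed.

Lemma local_sol1 v : 'D_v (local_sol c \o cinv (prod_chart c c)) z0 = 0.
Proof.
have [S [oS Sz sB E _]] := local_nbhd.
rewrite (derive_local_sol v oS Sz sB E) big1 // => i _.
exact: (jet1_product (sB i) (@diff_coord_continuous _ _ _ i.1)
  (@diff_coord_continuous _ _ _ i.2) Sz (diff_coord_z0 _) (diff_coord_z0 _)).
Qed.

(** On the diagonal the two orders of the points agree, so the weights add up to 3. *)
Let B_z0 i : B i z0 = - (1 / 2) * chart_coef A varpi c (fde i.1) (fde i.2) z0.
Proof. by rewrite /B /= -/z0; field. Qed.

Let chart_coef_z0_sum v w : \sum_(i : fdI V * fdI V)
    fdl i.1 v * fdl i.2 w * chart_coef A varpi c (fde i.1) (fde i.2) z0 =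
  varpi (m, m) (frame A c v m) (frame A c w m).
Proof.
rewrite -(chart_coef0 hA varpi hc cm v w) /chart_coef /= (cinvK hA hc cm).
by rewrite (chart_coef_sum hA bilU v w hc cm cm (dU m)).
Qed.

Lemma local_sol2 v w :
  'D_(v, 0) ('D_(0, w) (local_sol c \o cinv (prod_chart c c))) z0 =
  varpi (m, m) (frame A c v m) (frame A c w m).
Proof.
have [S [oS Sz sB E _]] := local_nbhd.
have E1 x : S x -> 'D_(0, w) (local_sol c \o cinv (prod_chart c c)) x =
    \sum_i 'D_(0, w) (term i) x by move=> Sx; exact: (derive_local_sol _ oS Sx sB E).
rewrite (derive_eq_on oS (v, 0) E1 Sz).
rewrite (derive_bigsum_on _ _ (fun i => smooth_on_derive (0, w) (smooth_term oS (sB i))) Sz).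
transitivity (\sum_(i : fdI V * fdI V) ((1 / 2) *
   (fdl i.1 v * fdl i.2 w * chart_coef A varpi c (fde i.1) (fde i.2) z0) + (1 / 2) *
   (fdl i.1 w * fdl i.2 v * chart_coef A varpi c (fde i.1) (fde i.2) z0))).
  apply: eq_bigr => i _.
  have J := jet2_product oS (sB i) (@diff_coord_continuous _ _ _ i.1)
    (@diff_coord_continuous _ _ _ i.2) Sz (diff_coord_z0 _) (diff_coord_z0 _) (v, 0) (0, w).
  (* [diff_coord] changes sign on left directions, which turns the factor -1/2 of [B] into the 1/2
     of each of the two sums. *)
  apply: etrans J _; rewrite B_z0 /= !diff_coordL !diff_coordR.
  by move: (chart_coef _ _ _ _ _ _) => C; field.
rewrite big_split /= -!mulr_sumr !chart_coef_z0_sum.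
by rewrite (sym (frame A c w m)); field.
Qed.

Lemma local_sol3 u v w :
  'D_(u, 0) ('D_(v, 0) ('D_(0, w) (local_sol c \o cinv (prod_chart c c)))) z0 =
  cL u v w.
Proof.
have [S [oS Sz sB E DB]] := local_nbhd.
have E1 x : S x -> 'D_(0, w) (local_sol c \o cinv (prod_chart c c)) x =
    \sum_i 'D_(0, w) (term i) x by move=> Sx; exact: (derive_local_sol _ oS Sx sB E).
have s1 i := smooth_on_derive (0, w) (smooth_term oS (sB i)).
have E2 x : S x -> 'D_(v, 0) ('D_(0, w) (local_sol c \o cinv (prod_chart c c))) x =
    \sum_i 'D_(v, 0) ('D_(0, w) (term i)) x.
  by move=> Sx; rewrite (derive_eq_on oS (v, 0) E1 Sx) (derive_bigsum_on _ _ s1 Sx).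
rewrite (derive_eq_on oS (u, 0) E2 Sz).
rewrite (derive_bigsum_on _ _ (fun i => smooth_on_derive (v, 0) (s1 i)) Sz).
(* The right-hand side is what [jet3_product] yields. Write each [cR a b c] as [cL a c b] plus a
   cubic form, totally symmetric by the three hypotheses. Its multiples cancel, four against four;
   so do those of [cL u w v] and [cL v w u], and six copies of [cL u v w] remain. *)
have -> : cL u v w = (1 / 6) * (cR u v w + 2 * cL u v w + cR u w v + 2 * cL u w v +
    cR v u w + 2 * cL v u w + cR v w u + 2 * cL v w u +
    (- 1) * (cL w u v + 2 * cR w u v + cL w v u + 2 * cR w v u)).
  have := cL_sym u v w; have := cL_sym u w v; have := cL_sym v w u.
  have := cR_sym u v w; have := cR_sym w u v; have := cR_sym u w v.
  have := cLR_sym u v w; have := cLR_sym v u w.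
  move: (cL u v w) (cL v u w) (cL u w v) (cL w u v) (cL v w u) (cL w v u).
  move: (cR u v w) (cR v u w) (cR u w v) (cR w u v) (cR v w u) (cR w v u).
  by move=> *; lra.
rewrite /coefL /coefR !(derive_chart_coef_sum hA oU dU bilU smU hc cm).
rewrite sum_linear_combination; apply: eq_bigr => i _.
have J := jet3_product oS (sB i) (@diff_coord_continuous _ _ _ i.1)
  (@diff_coord_continuous _ _ _ i.2) Sz (diff_coord_z0 _) (diff_coord_z0 _)
  (u, 0) (v, 0) (0, w).
apply: etrans J _; rewrite !DB /= !diff_coordL !diff_coordR.
move: ('D_(u, 0) (chart_coef _ _ _ _ _) _) ('D_(v, 0) (chart_coef _ _ _ _ _) _).
move: ('D_(w, 0) (chart_coef _ _ _ _ _) _) ('D_(0, u) (chart_coef _ _ _ _ _) _).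
move: ('D_(0, v) (chart_coef _ _ _ _ _) _) ('D_(0, w) (chart_coef _ _ _ _ _) _).
by move=> *; field.
Qed.

End at_point.
End local_solution.

(** * Gluing of jet solutions *)

Section solutions.
Context {R : realType} {M : topologicalType} {V : normedModType R} {bV : findim V}.
Variable A : atlas M V.
Hypothesis hA : smooth_atlas A.
Let hAA := smooth_atlas_prod hA hA.
Variable varpi : M * M -> V -> V -> R.

(* In the last condition the right-hand point is fixed, hence so is [y].  All
   conditions are affine in [D], and stable under partitions of unity that
   depend on the left-hand point only. *)
Definition jet_solution (m : M) (D : M * M -> R) : Prop :=
  [/\ smooth_at (prod_atlas A A) D (m, m),
      D (m, m) = 0,
      forall z, dird (prod_atlas A A) D (m, m) z = 0,
      forall x y, dL A (dR A D) (m, m) x y = varpi (m, m) x y &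
      forall X y u, vector_field A X ->
        dird A (fun p => dL A (dR A D) (p, m) (X p) y) m u =
        dird A (fun p => varpi (p, m) (X p) y) m u].

Lemma smooth_at_dR_slice D m n y : smooth_at (prod_atlas A A) D (m, n) ->
  smooth_at A (fun p => dR A D (p, n) y) m.
Proof.
move=> sD; have hn := chart_at_charts hA n; have dn := chart_at_dom hA n.
have := smooth_at_slice_l hA (smooth_at_dR hA y sD hn dn).
rewrite /= (frame_chart_at hA n y).
exact.
Qed.

(** This is the reason for a partition of unity in the left variable: its derivatives do not enter
    [dR], and only the two left derivatives remain to be controlled. *)
Lemma dird_fst (f : M -> R) m n y :
  dird (prod_atlas A A) (fun p => f p.1) (m, n) (0, y) = 0.
Proof. by rewrite (dird_slice_r A hA) /=; exact: dird_cst. Qed.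

Section sum.
Variables (I : eqType) (s : seq I) (rho : I -> M -> R) (F : I -> M * M -> R).
Variables (m : M) (D : M * M -> R).
Hypothesis srho : forall i, smooth_at A (rho i) m.
Hypothesis rho1 : \forall p \near m, \sum_(i <- s) rho i p = 1.
Hypothesis solF : forall i, i \in s -> jet_solution m (F i).
Hypothesis DE : \forall p \near (m, m), D p = \sum_(i <- s) rho i p.1 * F i p.

Let sF i : i \in s -> smooth_at (prod_atlas A A) (F i) (m, m).
Proof. by move=> /solF []. Qed.

Let term i (p : M * M) := rho i p.1 * F i p.

Let sterm i p q : smooth_at A (rho i) p -> smooth_at (prod_atlas A A) (F i) (p, q) ->
  smooth_at (prod_atlas A A) (term i) (p, q).
Proof.
by move=> s1 s2; exact: (smooth_atM hAA (smooth_at_fst hA (f := rho i) q s1) s2).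
Qed.

Let sD : smooth_at (prod_atlas A A) D (m, m).
Proof.
have [st _] := dird_sum hAA (F := term) 0 (fun i is_ => sterm (srho i) (sF is_)).
by refine (smooth_at_eq hAA _ st); apply: filterS DE => p ->.
Qed.

Let dird_term i p q z : smooth_at A (rho i) p -> smooth_at (prod_atlas A A) (F i) (p, q) ->
  dird (prod_atlas A A) (term i) (p, q) z =
  rho i p * dird (prod_atlas A A) (F i) (p, q) z +
  F i (p, q) * dird (prod_atlas A A) (fun p => rho i p.1) (p, q) z.
Proof.
by move=> s1 s2; exact: (dirdM hAA z (smooth_at_fst hA (f := rho i) q s1) s2).
Qed.

Let dR_near y : \forall p \near m,
  dR A D (p, m) y = \sum_(i <- s) rho i p * dR A (F i) (p, m) y.
Proof.
have C : {for m, continuous (fun p => (p, m))} by apply: cvg_pair; [exact: cvg_id|exact: cvg_cst].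
have n1 : \forall p \near m, \forall q \near (p, m), D q = \sum_(i <- s) rho i q.1 * F i q.
  by have := nbhs_interior DE => nD; exact: (C _ nD).
(* Smoothness must hold at all points near [m], as the identity will be differentiated once more on
   the left; the finitely many neighbourhoods are intersected along the list. *)
have n2 : \forall p \near m, forall i, i \in s ->
    smooth_at A (rho i) p /\ smooth_at (prod_atlas A A) (F i) (p, m).
  elim: (s) sF => [_|i r IH H]; first by apply: nearW => p i; rewrite in_nil.
  have n3 := IH (fun j jr => H j (mem_behead (s := i :: r) jr)).
  have n4 := smooth_at_near hA (srho i).
  have n5 : \forall p \near m, smooth_at (prod_atlas A A) (F i) (p, m).
    exact: (C _ (smooth_at_near hAA (H i (mem_head _ _)))).
  apply: filterS3 n3 n4 n5 => p h1 h2 h3 j; rewrite inE => /predU1P[->|/h1 //].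
  by split.
apply: filterS2 n1 n2 => p Dp sp; rewrite /dR (dird_near_eq hAA (0, y) Dp).
have st i : i \in s -> smooth_at (prod_atlas A A) (term i) (p, m).
  by move=> /sp [s1 s2]; exact: sterm.
have [_ ->] := dird_sum hAA (0, y) st.
rewrite big_seq_cond [RHS]big_seq_cond; apply: eq_bigr => i; rewrite andbT => is_.
have [s1 s2] := sp _ is_.
by rewrite (dird_term (0, y) s1 s2) dird_fst mulr0 addr0.
Qed.

Let se i y : i \in s -> smooth_at A (fun p => dR A (F i) (p, m) y) m.
Proof. by move=> /sF; exact: smooth_at_dR_slice. Qed.

Let e0 i y : i \in s -> dR A (F i) (m, m) y = 0.
Proof. by move=> /solF [_ _ + _ _]; rewrite /dR; exact. Qed.

Let dird_rho z : \sum_(i <- s) dird A (rho i) m z = 0.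
Proof.
have [_ <-] := dird_sum hA (F := rho) z (r := s) (fun i _ => srho i).
by rewrite (dird_near_eq hA (g := cst (1 : R)) z rho1) dird_cst.
Qed.

Lemma jet_solution_sum : jet_solution m D.
Proof.
have rhom : \sum_(i <- s) rho i m = 1 := nbhs_singleton rho1.
split; first exact: sD.
- rewrite (nbhs_singleton DE) big_seq big1 // => i /solF [_ F0 _ _ _].
  by rewrite F0 mulr0.
- move=> z; rewrite (dird_near_eq hAA z DE).
  have [_ ->] := dird_sum hAA (F := term) z (fun i is_ => sterm (srho i) (sF is_)).
  rewrite big_seq big1 // => i is_; rewrite (dird_term z (srho i) (sF is_)).
  by have [_ F0 F1 _ _] := solF is_; rewrite F0 F1 mulr0 mul0r addr0.
- move=> x y; rewrite /dL /= (dird_near_eq hA x (dR_near y)).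
  have st i : i \in s -> smooth_at A (fun p => rho i p * dR A (F i) (p, m) y) m.
    by move=> is_; exact: (smooth_atM hA (srho i) (se y is_)).
  have [_ ->] := dird_sum hA x st.
  transitivity (\sum_(i <- s) rho i m * varpi (m, m) x y); last first.
    by rewrite -mulr_suml rhom mul1r.
  rewrite big_seq [RHS]big_seq; apply: eq_bigr => i is_.
  rewrite (dirdM hA x (srho i) (se y is_)) e0 // mul0r addr0.
  by have [_ _ _ F2 _] := solF is_; rewrite -F2.
- move=> X y u hX; rewrite /dL /=.
  have sX : smooth_at A (lie A X (chart_at A m)) m.
    exact: (vector_field_smooth_at hA hX (chart_at_charts hA m) (chart_at_dom hA m)).
  have slie (f : M -> R) : smooth_at A f m -> smooth_at A (lie A X f) m.
    exact: (smooth_at_lie hA (chart_at_charts hA m) (chart_at_dom hA m) sX).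
  pose e i p := dR A (F i) (p, m) y.
  have n1 : \forall p \near m, dird A (fun q => dR A D (q, m) y) p (X p) =
      \sum_(i <- s) (rho i p * lie A X (e i) p + e i p * lie A X (rho i) p).
    have n2 := nbhs_interior (dR_near y).
    have n3 : \forall p \near m, forall i, i \in s ->
        smooth_at A (rho i) p /\ smooth_at A (e i) p.
      elim: (s) (fun i => @se i y) => [_|i r IH H]; first by apply: nearW => p i; rewrite in_nil.
      have n3 := IH (fun j jr => H j (mem_behead (s := i :: r) jr)).
      have n4 := smooth_at_near hA (srho i).
      have n5 := smooth_at_near hA (H i (mem_head _ _)).
      apply: filterS3 n3 n4 n5 => p h1 h2 h3 j; rewrite inE => /predU1P[->|/h1 //].
      by split.
    apply: filterS2 n2 n3 => p Ep sp; rewrite (dird_near_eq hA (X p) Ep).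
    have st i : i \in s -> smooth_at A (fun p => rho i p * e i p) p.
      by move=> /sp [s1 s2]; exact: (smooth_atM hA s1 s2).
    have [_ ->] := dird_sum hA (X p) st.
    rewrite big_seq [RHS]big_seq; apply: eq_bigr => i /sp [s1 s2].
    exact: (dirdM hA (X p) s1 s2).
  rewrite (dird_near_eq hA u n1).
  have s1 i : i \in s -> smooth_at A (fun p => rho i p * lie A X (e i) p) m.
    by move=> is_; exact: (smooth_atM hA (srho i) (slie _ (se y is_))).
  have s2 i : i \in s -> smooth_at A (fun p => e i p * lie A X (rho i) p) m.
    by move=> is_; exact: (smooth_atM hA (se y is_) (slie _ (srho i))).
  have st i : i \in s -> smooth_at A
      (fun p => rho i p * lie A X (e i) p + e i p * lie A X (rho i) p) m.
    by move=> is_; exact: (smooth_atD hA (s1 i is_) (s2 i is_)).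
  have [_ ->] := dird_sum hA u st.
  set T := dird A (fun p => varpi (p, m) (X p) y) m u.
  (* Second derivatives of [rho i] carry the factor [e i m], which is 0. First derivatives carry
     values of [varpi] that are the same for all [i], so their sums vanish by [dird_rho]. *)
  transitivity (\sum_(i <- s) (rho i m * T + (dird A (rho i) m u * varpi (m, m) (X m) y +
      dird A (rho i) m (X m) * varpi (m, m) u y))); last first.
    by rewrite !big_split /= -!mulr_suml !dird_rho rhom mul1r !mul0r !addr0.
  rewrite big_seq [RHS]big_seq; apply: eq_bigr => i is_.
  have [_ _ _ F2 F3] := solF is_.
  have D1 : dird A (fun p => rho i p * lie A X (e i) p) m u =
      rho i m * dird A (lie A X (e i)) m u + lie A X (e i) m * dird A (rho i) m u.
    exact: (dirdM hA u (srho i) (slie _ (se y is_))).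
  have D2 : dird A (fun p => e i p * lie A X (rho i) p) m u =
      e i m * dird A (lie A X (rho i)) m u + lie A X (rho i) m * dird A (e i) m u.
    exact: (dirdM hA u (se y is_) (slie _ (srho i))).
  have E1 : e i m = 0 by exact: e0.
  have E2 : dird A (lie A X (e i)) m u = T by exact: F3.
  have E3 : lie A X (e i) m = varpi (m, m) (X m) y by rewrite -F2.
  have E4 : dird A (e i) m u = varpi (m, m) u y by rewrite -F2.
  rewrite (dirdD hA u (s1 i is_) (s2 i is_)) D1 D2 E1 E2 E3 E4.
  by rewrite mul0r add0r -addrA [_ * dird A (rho i) m u]mulrC.
Qed.

End sum.
End solutions.

Section local_sol_solution.
Context {R : realType} {M : topologicalType} {V : normedModType R} {bV : findim V}.
Variable A : atlas M V.
Hypothesis hA : smooth_atlas A.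
Let hAA := smooth_atlas_prod hA hA.
Variables (varpi : M * M -> V -> V -> R) (U : set (M * M)).
Hypotheses (oU : open U) (dU : forall m, U (m, m)).
Hypothesis bilU : forall p, U p -> bilinear_form (varpi p).
Hypothesis smU : forall c d x y, charts A c -> charts A d ->
  msmooth (prod_atlas A A) (U `&` (cdom c `*` cdom d))
    (fun p => varpi p (frame A c x p.1) (frame A d y p.2)).
Variables (c : chart M V) (m : M).
Hypotheses (hc : charts A c) (cm : cdom c m).
Notation cL := (coefL A varpi c m).
Notation cR := (coefR A varpi c m).
Hypothesis sym : forall u v, varpi (m, m) u v = varpi (m, m) v u.
Hypothesis cL_sym : forall u v w, cL u v w = cL v u w.
Hypothesis cR_sym : forall u v w, cR u v w = cR w v u.
Hypothesis cLR_sym : forall u v w, cL u v w + cR u v w = cL u w v + cR u w v.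

Lemma jet_solution_local_sol : jet_solution A varpi m (local_sol A varpi c).
Proof.
set F := local_sol A varpi c.
have sF : smooth_at (prod_atlas A A) F (m, m).
  exact: (smooth_at_local_sol hA oU smU hc cm cm (dU m) (dU m)).
have cmm : cdom (prod_chart c c) (m, m) by split.
have metric x y : dL A (dR A F) (m, m) x y = varpi (m, m) x y.
  rewrite -(frame_dird hA x hc cm) -(frame_dird hA y hc cm).
  rewrite (dLdR_frame hA _ _ sF hc cm hc cm).
  exact: (local_sol2 hA oU dU bilU smU hc cm sym).
split; [exact: sF|exact: local_sol0| |exact: metric|].
- move=> z; rewrite (dird_chartE hAA z sF (prod_chart_at hc hc) cmm).
  exact: (local_sol1 hA oU dU smU hc cm).
move=> X y u hX.
have C : {for m, continuous (fun p => (p, m))} by apply: cvg_pair; [exact: cvg_id|exact: cvg_cst].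
have yE := frame_dird hA y hc cm; set w := dird A c m y in yE.
have uE := frame_dird hA u hc cm; set v := dird A c m u in uE.
have sG i : smooth_at (prod_atlas A A)
    (fun p => dL A (dR A F) p (frame A c (fde i) p.1) (frame A c w p.2)) (m, m).
  exact: (smooth_at_dLdR hA _ _ sF hc cm hc cm).
have sO i : smooth_at (prod_atlas A A) (frame_coef A varpi c (fde i) w) (m, m).
  exact: (smooth_at_frame_coef hA oU smU _ _ hc cm cm (dU m)).
(* With the right point fixed at [m], both sides are one-forms in the left point; [y] and [u] have
   been written as frame vectors so that [local_sol3] applies. *)
apply: (dird_one_form_eq hA (w := fun p => dL A (dR A F) (p, m))
  (w' := fun p => varpi (p, m)) hc cm hX).
- have n1 : \forall p \near m, smooth_at (prod_atlas A A) F (p, m).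
    exact: (C _ (smooth_at_near hAA sF)).
  by apply: filterS n1 => p; exact: bilinear_dLdR.
- have n1 : \forall p \near m, U (p, m) := C _ (open_nbhs_nbhs (conj oU (dU m))).
  by apply: filterS n1 => p; exact: bilU.
- by move=> i; have := smooth_at_slice_l hA (sG i); rewrite /= yE; exact.
- by move=> i; have := smooth_at_slice_l hA (sO i); rewrite /frame_coef /= yE; exact.
- by move=> i; exact: metric.
- move=> i; pose proof (dird_frame_l hA hA v (sG i) hc cm hc cm) as E1.
  pose proof (dird_frame_coef hA oU dU smU hc cm v (fde i) w) as E2.
  rewrite /frame_coef /= yE uE in E1 E2; rewrite E1 E2.
  rewrite -(local_sol3 hA oU dU bilU smU hc cm cL_sym cR_sym cLR_sym).
  apply: near_eq_derive.
  have [S [oS Sm sS SI]] := square_chart hA sF hc cm hc cm.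
  have : nbhs (c m, c m) S := open_nbhs_nbhs (conj oS Sm).
  apply: filterS => z Sz; have [p [q [cp cq zE]]] := SI _ Sz; rewrite zE /=.
  rewrite (cinvK hA hc cp) (cinvK hA hc cq).
  have sp : smooth_at (prod_atlas A A) F (p, q).
    exists (prod_chart c c); split; [exact: (prod_chart_at hc hc)|by split|].
    by exists S; split; [exact: oS|rewrite /= -zE; exact: Sz|exact: sS].
  exact: (dLdR_frame hA _ _ sp hc cp hc cq).
Qed.

End local_sol_solution.

(** * Globalization *)

Section locally_finite.
Context {R : realType} {M : topologicalType}.
Variables (J : set M) (b : M -> M -> R) (K : M -> set M).
Hypothesis bK : forall x p, b x p != 0 -> K x p.
Hypothesis cK : forall x, closed (K x).
Hypothesis fK : forall p : M, exists2 N : set M, nbhs p N &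
  finite_set [set x | J x /\ K x `&` N !=set0].

(** Membership is tested by the closed sets [K x] and not by nonvanishing of [b x]: the latter is an
    open condition, so its index set could grow near [p], while this one cannot. *)
Definition support_at (p : M) : set M := [set x | J x /\ K x p].

Lemma finite_support_at p : finite_set (support_at p).
Proof.
have [N nN fN] := fK p; apply: sub_finite_set fN => x [Jx Kx].
by split=> //; exists p; split=> //; exact: nbhs_singleton nN.
Qed.

(** A neighbourhood of [p] meets finitely many of the [K x]; those that do not contain [p] are
    closed and can be avoided by shrinking it. *)
Lemma near_support_at p : \forall q \near p, support_at q `<=` support_at p.
Proof.
have [N nN fN] := fK p.
have [X XE] := (proj1 finite_fsetP) fN.
have H (s : seq M) : \forall q \near p, forall x, x \in s -> K x q -> K x p.
  elim: s => [|x s IH]; first by apply: nearW => q x; rewrite in_nil.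
  have n1 : \forall q \near p, K x q -> K x p.
    have [Kp|nKp] := pselect (K x p); first by apply: nearW.
    have : nbhs p (~` K x) by apply: open_nbhs_nbhs; split=> //; exact: closed_openC.
    by apply: filterS => q nKq /nKq.
  by apply: filterS2 IH n1 => q h1 h2 y; rewrite inE => /predU1P[->|/h1].
apply: filterS2 nN (H X) => q Nq Hq x [Jx Kxq]; split=> //; apply: Hq => //.
have : [set x | J x /\ K x `&` N !=set0] x by split=> //; exists q.
by rewrite XE.
Qed.

Lemma sum_support_at (G : M -> R) p q :
  (forall x, b x q = 0 -> G x = 0) -> support_at q `<=` support_at p ->
  \sum_(x <- fset_set (support_at q)) G x = \sum_(x <- fset_set (support_at p)) G x.
Proof.
move=> G0 qp; apply: big_fset_incl.
  by rewrite -fset_set_sub; [exact: qp|exact: finite_support_at|exact: finite_support_at].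
move=> x; rewrite !in_fset_set; [|exact: finite_support_at|exact: finite_support_at].
move=> /set_mem [Jx _] /negP nq; apply: G0; apply/eqP/negPn/negP => /bK Kxq.
by apply: nq; apply/mem_set.
Qed.

End locally_finite.

Theorem theorem4p9 (R : realType) (n : nat) (M : topologicalType)
    (A : atlas M 'rV[R]_n) (hM : smooth_manifold A)
    (varpi : M * M -> 'rV[R]_n -> 'rV[R]_n -> R)
    (nabla : (M -> 'rV[R]_n) -> (M -> 'rV[R]_n) -> (M -> 'rV[R]_n))
    (hvarpi : contrast_biform A varpi)
    (hnabla : induced_connection A varpi nabla)
    (hstat : statistical_manifold A (diag_restr varpi) nabla) :
  exists D : M * M -> R,
    [/\ local_function A D,
        vanishes_to_first_order A D &
        statistically_equivalent A varpi (dL A (dR A D))].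
Proof.
have [hA hausM pcM _] := hM.
pose proof (smooth_atlas_prod hA hA) as hAA.
have [[U [oU dU] [bilU smU]] gM] := hvarpi.
have [_ _ tor [nabla' [conj' tor']]] := hstat.
have sym m u v : varpi (m, m) u v = varpi (m, m) v u by have [_ _ s _] := gM; exact: s.
have [J [b [K [[sb b_ge0] bK KP Jb fK]]]] := partition_of_unity hA hausM pcM.
have cK x : closed (K x) by have [] := KP x.
have Kdom x : K x `<=` cdom (chart_at A x) by have [] := KP x.
pose T p := support_at J K p.
pose sumb p := \sum_(x <- fset_set (T p)) b x p.
pose rho x p := b x p / sumb p.
pose F x := @local_sol _ _ _ findim_rV A varpi (chart_at A x).
(* The left-hand point alone selects the summands. Each [F x] is a total function, with values of no
   significance away from the diagonal. *)
pose D (p : M * M) := \sum_(x <- fset_set (T p.1)) rho x p.1 * F x p.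
have finT p : finite_set (T p) by exact: finite_support_at.
have nT p : \forall q \near p, T q `<=` T p by exact: near_support_at.
have sumbE p : \forall q \near p, sumb q = \sum_(x <- fset_set (T p)) b x q.
  by apply: filterS (nT p) => q; exact: (sum_support_at bK fK).
have ssumb p : smooth_at A sumb p.
  refine (smooth_at_eq hA _ (smooth_at_sum hA (fset_set (T p)) (fun x => sb x p))).
  by apply: filterS (sumbE p) => q ->.
have sumb_neq0 p : sumb p != 0.
  have [x Jx bxp] := Jb p; have xT : x \in fset_set (T p).
    by rewrite in_fset_set //; apply/mem_set; split=> //; exact: bK.
  rewrite gt_eqF // /sumb (big_fsetD1 x) //= ltr_pwDl ?sumr_ge0 //.
  by rewrite lt0r bxp b_ge0.
have srho x p : smooth_at A (rho x) p.
  exact: (smooth_atM hA (sb x p) (smooth_atV hA (ssumb p) (sumb_neq0 p))).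
have rho1 p : \forall q \near p, \sum_(x <- fset_set (T p)) rho x q = 1.
  apply: filterS (sumbE p) => q E.
  by rewrite -mulr_suml -E divff.
have DE (m m' : M) : \forall p \near (m, m'), D p = \sum_(x <- fset_set (T m)) rho x p.1 * F x p.
  have C : {for (m, m'), continuous (@fst M M)} by exact: cvg_fst.
  have n1 : \forall p \near (m, m'), T p.1 `<=` T m := C _ (nT m).
  apply: filterS n1 => p; apply: (sum_support_at bK fK) => x b0.
  by rewrite /rho b0 !mul0r.
(* These are the conditions under which [F x] is smooth at [p]; the bi-form is needed at [p] and at
   the exchanged pair. They are imposed only on the [x] whose support contains the left point, so
   near a given diagonal point only finitely many matter, and the interior taken next contains the
   diagonal. *)
pose O x (p : M * M) := K x p.1 ->
  [/\ U p, U (p.2, p.1), cdom (chart_at A x) p.1 & cdom (chart_at A x) p.2].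
pose U0 := interior [set p | forall x, J x -> O x p].
have oU0 : open U0 by exact: open_interior.
have U0O p x : U0 p -> J x -> O x p by move=> /interior_subset H; exact: H.
have dU0 m : U0 (m, m).
  have C : {for (m, m), continuous (@fst M M)} by exact: cvg_fst.
  have n1 : \forall p \near (m, m), T p.1 `<=` T m := C _ (nT m).
  have C' : {for (m, m), continuous (fun p : M * M => (p.2, p.1))}.
    by apply: cvg_pair; [exact: cvg_snd|exact: cvg_fst].
  have n2 : \forall p \near (m, m), U p := open_nbhs_nbhs (conj oU (dU m)).
  have n3 : \forall p \near (m, m), U (p.2, p.1) := C' _ n2.
  have n4 (s : seq M) : (forall x, x \in s -> K x m) -> \forall p \near (m, m),
      forall x, x \in s -> cdom (chart_at A x) p.1 /\ cdom (chart_at A x) p.2.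
    elim: s => [_|x s IH H]; first by apply: filterS n2 => p _ x; rewrite in_nil.
    have n5 := IH (fun y ys => H y (mem_behead (s := x :: s) ys)).
    have xm : cdom (chart_at A x) m by apply: Kdom; apply: H; exact: mem_head.
    have o6 : open (cdom (chart_at A x) `*` cdom (chart_at A x)).
      by apply: open_setX; exact: (chart_open_dom hA (chart_at_charts hA x)).
    have xx : (cdom (chart_at A x) `*` cdom (chart_at A x)) (m, m) by split.
    have n6 : nbhs (m, m) (cdom (chart_at A x) `*` cdom (chart_at A x)).
      exact: (open_nbhs_nbhs (conj o6 xx)).
    by apply: filterS2 n5 n6 => p h5 h6 y; rewrite inE => /predU1P[->|/h5].
  have n7 := n4 (fset_set (T m)) _.
  have {}n7 : \forall p \near (m, m), forall x, x \in fset_set (T m) ->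
      cdom (chart_at A x) p.1 /\ cdom (chart_at A x) p.2.
    by apply: n7 => x; rewrite in_fset_set // => /set_mem [].
  rewrite /U0 /interior; apply: filterS2 (filterI n1 n7) (filterI n2 n3).
  move=> p [h1 h7] [h2 h3] x Jx Kxp.
  have [|d1 d2] := h7 x.
    by rewrite in_fset_set //; apply/mem_set; exact: h1.
  by split.
have sF (m m' : M) x : U0 (m, m') -> x \in fset_set (T m) ->
    smooth_at (prod_atlas A A) (F x) (m, m').
  rewrite in_fset_set // => Um /set_mem [Jx Kxm].
  have [U1 U2 d1 d2] := U0O _ _ Um Jx Kxm.
  exact: (smooth_at_local_sol hA oU smU (chart_at_charts hA x) d1 d2 U1 U2).
have sD p : U0 p -> smooth_at (prod_atlas A A) D p.
  case: p => m m' Um.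
  have st x : x \in fset_set (T m) ->
      smooth_at (prod_atlas A A) (fun p => rho x p.1 * F x p) (m, m').
    move=> xT; exact: (smooth_atM hAA (smooth_at_fst hA (f := rho x) m' (srho x m)) (sF _ _ _ Um xT)).
  have [s _] := dird_sum hAA 0 st.
  by refine (smooth_at_eq hAA _ s); apply: filterS (DE m m') => p ->.
have sol m : jet_solution A varpi m D.
  apply: (jet_solution_sum hA (fun x => srho x m) (rho1 m) _ (DE m m)) => x xT.
  have [Jx Kxm] : T m x by move: xT; rewrite in_fset_set // => /set_mem.
  have hx := chart_at_charts hA x; have mx := Kdom _ _ Kxm.
  apply: (jet_solution_local_sol hA oU dU bilU smU hx mx (sym m)).
  - exact: (coefL_sym hA hausM oU dU bilU smU hnabla tor hx mx).
  - exact: (coefR_sym hA hausM oU dU bilU smU hnabla conj' tor' hx mx).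
  - exact: (coefLR_sym hA oU dU smU sym hx mx).
have metric m u v : diag_restr varpi m u v = diag_restr (dL A (dR A D)) m u v.
  by have [_ _ _ E _] := sol m; rewrite /diag_restr E.
exists D; split.
- exists U0; first by split.
  by apply: (msmooth_local hAA) => p; exact: sD.
- move=> m; have [_ D0 D1 _ _] := sol m; split=> // Z _.
  exact: D1.
split; [exact: hvarpi| |exact: metric|].
- split; last first.
    suff -> : diag_restr (dL A (dR A D)) = diag_restr varpi by exact: gM.
    by apply/funext => m; apply/funext => u; apply/funext => v; rewrite metric.
  exists U0; first by split.
  split=> [[m m'] Um|c d x y hc hd]; first exact: (bilinear_dLdR hA (sD _ Um)).
  apply: (msmooth_local hAA) => -[m m'] [Um [/= cm dm']].
  exact: (smooth_at_dLdR hA x y (sD _ Um) hc cm hd dm').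
- exists nabla; split; [exact: hnabla|split]; first by have [] := hnabla.
  move=> X Y Z hX hY hZ m; have [_ _ _ E2 E3] := sol m.
  (* Only the jet identities of the new bi-form are used from here on. As in [nablaE], the bracket
     terms cancel, and the remaining derivative agrees with that of [varpi]. *)
  move: metric E2 E3; move: (dL A (dR A D)) => w' metric E2 E3.
  rewrite -!metric /left_lie /diag_restr {2}/biform_app /= E2 subrK.
  rewrite /lie /liftL /= (dird_slice_l _ hA) /biform_app /= (E3 _ _ _ hX).
  exact: (nablaE hA hnabla m hX hY hZ).
Qed.
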